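(* Fix an arbitrary but finite time horizon $T>0$. Then, for every smooth test function $G\in\mathscr{S}(\mathbb{R})$, $$\lim_{N\uparrow\infty}\;\limsup_{\varepsilon\downarrow0}\int_0^T dt\,\mathbf{E}_\varepsilon\left(\int_0^tF_N(Y_s^\varepsilon,G)\,ds-\int_0^tV_\varepsilon^G(\xi_{s\varepsilon^{-2}})\,ds\right)^2=0,$$ where $$F_N(\mathcal{Y},G)=-\int_{\mathbb{R}}G'(u)\,(\mathcal{Y}\star d_N)^2(u)\,du\quad\mbox{and}\quad V_\varepsilon^G(\xi)=-\sum_{x\in\mathbb{Z}}G'(\varepsilon x)\,\xi(x)\xi(x+1)$$ for $\mathcal{Y}\in\mathscr{S}'(\mathbb{R})$ and $\xi\in\{-1,1\}^{\mathbb{Z}}$, respectively.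
   Context: Fix a constant $\tilde\gamma\in\mathbb{R}$. For $\varepsilon>0$ (small enough that $|\tilde\gamma|\sqrt\varepsilon\le1$) let $p,q\ge0$ with $p+q=1$ and $p-q=\tilde\gamma\sqrt\varepsilon$. Let $(\eta_t)_{t\ge0}$ be the simple exclusion process on $\{0,1\}^{\mathbb{Z}}$, i.e. the Feller process whose generator acts on local functions $f$ by $$L_\varepsilon f(\eta)=\sum_{x\in\mathbb{Z}}\big(2p\,\eta(x)(1-\eta(x+1))[f(\eta^{x,x+1})-f(\eta)]+2q\,\eta(x)(1-\eta(x-1))[f(\eta^{x,x-1})-f(\eta)]\big),$$ where $\eta^{x,y}$ is $\eta$ with the values at $x$ and $y$ exchanged. The process is started from its invariant measure $\nu_{1/2}$, the Bernoulli product measure on $\{0,1\}^{\mathbb{Z}}$ with $\nu_{1/2}(\eta(x)=1)=1/2$, and $\mathbf{E}_\varepsilon$ is the corresponding expectation. Put $\xi_t(x)=(\eta_t(x)-1/2)/\sqrt{1/4}\in\{-1,1\}$. The density fluctuation field is $$Y_s^\varepsilon=\sqrt\varepsilon\sum_{x\in\mathbb{Z}}\xi_{s\varepsilon^{-2}}(x)\,\delta_{\varepsilon x},\qquad s\ge0,$$ where $\delta_{\varepsilon x}$ is the Dirac measure at $\varepsilon x$. The mollifier $d$ is a fixed even non-negative smooth test function on $\mathbb{R}$ with $\mathrm{supp}\,d=[-1,1]$ and $\int_{\mathbb{R}}d(u)\,du=1$, and $d_N(x)=N\,d(Nx)$ for $N\ge1$. $\mathscr{S}(\mathbb{R})$ is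 the Schwartz space, $\mathscr{S}'(\mathbb{R})$ its dual, and $\star$ denotes convolution, so that $(Y_s^\varepsilon\star d_N)(u)=\sqrt\varepsilon\sum_{x\in\mathbb{Z}}\xi_{s\varepsilon^{-2}}(x)\,d_N(u-\varepsilon x)$. *)

(* Defs.v *)
From HB Require Import structures.
From mathcomp Require Import all_boot all_order all_algebra.
From mathcomp Require Import all_classical all_reals all_analysis.
Set Implicit Arguments.
Unset Strict Implicit.
Unset Printing Implicit Defensive.
Import Order.TTheory GRing.Theory Num.Theory.
Import numFieldNormedType.Exports.
Local Open Scope classical_set_scope.
Local Open Scope ring_scope.

(* Meant for absolutely convergent families only: the symmetric partial sums
   run over x = -n, ..., n. *)
Definition sumZ (R : realType) (a : int -> R) : R :=
  limn (fun n : nat => \sum_(i < n.*2.+1) a (i%:Z - n%:Z)).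

Section test_functions.
Variable R : realType.
Implicit Types f d : R -> R.

Definition smooth f := forall (n : nat) (x : R), derivable (derive1n n f) x 1.

Definition schwartz f :=
  smooth f /\
  forall k n : nat, exists C : R, forall x : R, `|x ^+ k * derive1n n f x| <= C.

Definition mollifier d :=
  [/\ smooth d,
      forall x, d (- x) = d x,
      forall x, 0 <= d x,
      closure [set x | d x != 0] = `[-1, 1]%classic &
      (\int[lebesgue_measure]_(x in setT) (d x)%:E = 1)%E].

Definition dilate d (N : nat) : R -> R := fun x => N%:R * d (N%:R * x).

End test_functions.

(* {0,1}^Z with its product topology, true standing for an occupied site *)
Definition conf := {ptws int -> bool}.

Definition exchange (x y : int) (h : conf) : conf :=
  fun z => if z == x then h y else if z == y then h x else h z.

Definition local (R : realType) (f : conf -> R) :=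
  exists s : seq int, forall h k : conf,
    (forall x, x \in s -> h x = k x) -> f h = f k.

Definition exclusion_gen (R : realType) (p q : R) (f : conf -> R) (h : conf)
    : R :=
  sumZ (fun x : int =>
    2 * p * (h x)%:R * (1 - (h (x + 1))%:R) * (f (exchange x (x + 1) h) - f h)
  + 2 * q * (h x)%:R * (1 - (h (x - 1))%:R) * (f (exchange x (x - 1) h) - f h)).

Section feller.
Variables (R : realType) (X : topologicalType).
Implicit Types (S : R -> (X -> R) -> X -> R) (f g : X -> R).

(* X is meant to be compact; only the values S t f with 0 <= t and f
   continuous are constrained. *)
Definition feller_semigroup S :=
  [/\ forall t f, 0 <= t -> continuous f -> continuous (S t f),
      forall t (a : R) f g, 0 <= t -> continuous f -> continuous g ->
        S t (fun x => a * f x + g x) = (fun x => a * S t f x + S t g x),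
      forall t, 0 <= t -> S t (fun=> 1) = (fun=> 1) &
      forall t f, 0 <= t -> continuous f -> (forall x, 0 <= f x) ->
        forall x, 0 <= S t f x] /\
  [/\ forall f, continuous f -> S 0 f = f,
      forall s t f, 0 <= s -> 0 <= t -> continuous f ->
        S (s + t) f = S s (S t f) &
      forall f, continuous f -> forall e : R, 0 < e ->
        \forall t \near 0^'+, forall x, `|S t f x - f x| < e].

(* f is in the domain of the infinitesimal generator of S, with image g; the
   limit is in the supremum norm. *)
Definition generates S f g :=
  continuous f /\
  forall e : R, 0 < e ->
    \forall t \near 0^'+, forall x, `|(S t f x - f x) / t - g x| < e.

End feller.

Section processes.
Variables (R : realType) (d : measure_display) (Omega : measurableType d).
Variable P : probability Omega R.
Implicit Type eta : R -> Omega -> conf.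

Definition history eta (s : R) : set (set Omega) :=
  <<s [set A | exists u x, [/\ 0 <= u, u <= s & A = [set w | eta u w x]]] >>.

Definition cadlag eta :=
  forall w, (forall t, 0 <= t -> eta s w @[s --> t^'+] --> eta t w) /\
            (forall t, 0 < t -> exists l : conf, eta s w @[s --> t^'-] --> l).

Definition markov_process (S : R -> (conf -> R) -> conf -> R) eta :=
  forall (s t : R) (f : conf -> R) (A : set Omega),
    0 <= s -> 0 <= t -> continuous f -> history eta s A ->
    (\int[P]_(w in A) (f (eta (s + t) w))%:E =
     \int[P]_(w in A) (S t f (eta s w))%:E)%E.

(* Local functions form a core for the generator of the exclusion process, so
   at most one Feller semigroup S satisfies the condition below. *)
Definition exclusion_process (p q : R) eta :=
  [/\ forall t x, 0 <= t -> measurable [set w | eta t w x],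
      cadlag eta &
      exists S : R -> (conf -> R) -> conf -> R,
        [/\ feller_semigroup S,
            forall f, local f -> generates S f (exclusion_gen p q f) &
            markov_process S eta]].

(* The law of h is the Bernoulli product measure with density rho. *)
Definition bernoulli_law (rho : R) (h : Omega -> conf) :=
  forall (s : seq int) (v : conf), uniq s ->
    P [set w | forall x, x \in s -> h w x = v x] =
    (\prod_(x <- s) (if v x then rho else 1 - rho))%:E.

End processes.

Section fields.
Variable R : realType.

Definition xi (h : conf) : int -> R :=
  fun x => ((h x)%:R - 1 / 2) / Num.sqrt (1 / 4).

(* A distribution is represented by its action on test functions. *)
Definition fluctuation_field (eps : R) (z : int -> R) : (R -> R) -> R :=
  fun phi => Num.sqrt eps * sumZ (fun x : int => z x * phi (eps * x%:~R)).

Definition convol (Y : (R -> R) -> R) (phi : R -> R) : R -> R :=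
  fun u => Y (fun v => phi (u - v)).

Definition FN (d : R -> R) (N : nat) (Y : (R -> R) -> R) (G : R -> R) : R :=
  - \int[lebesgue_measure]_(u in setT) (derive1 G u * convol Y (dilate d N) u ^+ 2).

Definition VG (eps : R) (G : R -> R) (z : int -> R) : R :=
  - sumZ (fun x : int => derive1 G (eps * x%:~R) * z x * z (x + 1)).

End fields.

(* Main.v *)
Require Import Defs.
From HB Require Import structures.
From mathcomp Require Import all_boot all_order all_algebra.
From mathcomp Require Import all_classical all_reals all_analysis.
From mathcomp Require Import measurable_realfun.
From mathcomp Require Import ring lra zify.
Set Implicit Arguments.
Unset Strict Implicit.
Unset Printing Implicit Defensive.
Import Order.TTheory GRing.Theory Num.Theory.
Import numFieldNormedType.Exports.
Local Open Scope classical_set_scope.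
Local Open Scope ring_scope.

(** Expanding the square in [FN] with [xi x * xi x = 1] leaves a deterministic
    diagonal and the pairs [coef x k * xi x * xi (x + k)] of sites whose
    mollifiers overlap ([quadratic_expansion]). The diagonal is nearly constant
    in [u], and the derivative of the test function has mean zero, so its
    contribution is negligible ([diag_integral_bound]). The sum of [coef x k] over [k] is close to
    [G' (eps * x)], because the integral of [2 d Psi] is the increment of
    [Psi ^+ 2] when [Psi] is a primitive of the mollifier [d] ([bump_square_mass],
    [defect_bound]). If each [xi (x + k)] could be replaced by [xi (x + 1)], the
    square would therefore become the nearest neighbour functional [VG] up to a
    small defect; and the defect, in its turn, is harmless once
    [xi (x + 1)] is replaced by an average over [1 / eps] sites, as this average has
    a small variance ([static_variance]). The algebra is in
    [square_neighbour_decomp].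

    The replacement moves spins through gradients [xi z - xi (z + 1)], multiplied
    by spins further to the left ([transport_gradsum]). Time integrals of such
    functions are small by the argument of Kipnis and Varadhan ([kv_gradient]):
    solving approximately the resolvent equation [f = u - eps ^- 2 * L u] turns
    the integral into boundary terms and a martingale, both controlled by the
    energy of [u]; and the energy is bounded by duality, the gradient of a spin
    being odd under the exchange of [z] and [z + 1] ([gradient_duality],
    [resolvent_decomp]). The energy only sees the symmetric part of the dynamics,
    so the bounds do not depend on the asymmetry. The solution [u] is local, being
    reached by finitely many Euler corrections whose contraction factors have a
    product tending to 0 ([dense_range]).

    What is used of the process follows from the generator on local functions.
    The Markov property is tested on local functions of the past
    ([markov_expand]), and the martingale is observed on a fine time grid, time
    integrals being recovered by right-continuity ([riemann_sum_cvg],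
    [path_second_moment]). Stationarity of the Bernoulli measure ([stationary])
    follows from [nu (L f) = 0] and the analyticity in time
    of the expectations of local functions: the [k]-th derivative is bounded
    by a geometric factor times [k`!].

    For [2 * eps * N ^ 3 <= 1] all these estimates bound the second moment at each
    time [t <= T] by a constant over [N] ([fluctuation_second_moment]). *)

(** * Symmetric sums over the integers *)

Lemma eq_sum_support (I : eqType) (V : nmodType) (s1 s2 : seq I) (F : I -> V) :
  uniq s1 -> uniq s2 ->
  (forall x, x \in s1 -> x \notin s2 -> F x = 0) ->
  (forall x, x \in s2 -> x \notin s1 -> F x = 0) ->
  \sum_(x <- s1) F x = \sum_(x <- s2) F x.
Proof.
move=> u1 u2 h1 h2.
rewrite (bigID (mem s2)) /= [X in _ + X]big_seq_cond [X in _ + X]big1 ?addr0; last first.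
  by move=> x /andP[]; exact: h1.
rewrite [RHS](bigID (mem s1)) /= [X in _ = _ + X]big_seq_cond [X in _ = _ + X]big1 ?addr0; last first.
  by move=> x /andP[]; exact: h2.
rewrite -big_filter -[RHS]big_filter; apply: perm_big.
apply: uniq_perm; rewrite ?filter_uniq// => x.
by rewrite !mem_filter andbC.
Qed.

Definition zbox (n : nat) : seq int := [seq i%:Z - n%:Z | i <- iota 0 n.*2.+1].

Lemma zbox_uniq n : uniq (zbox n).
Proof. by rewrite map_inj_uniq ?iota_uniq// => i j; lia. Qed.

Lemma mem_zbox n (x : int) : (x \in zbox n) = (`|x|%N <= n)%N.
Proof.
apply/mapP/idP => [[i]|h]; first by rewrite mem_iota => hi ->; lia.
exists (absz (x + n%:Z)); last by lia.
by rewrite mem_iota; lia.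
Qed.

Lemma size_zbox n : size (zbox n) = n.*2.+1.
Proof. by rewrite size_map size_iota. Qed.

Lemma sum_zboxE (V : nmodType) n (F : int -> V) :
  \sum_(i < n.*2.+1) F (i%:Z - n%:Z) = \sum_(x <- zbox n) F x.
Proof.
rewrite big_map -[iota _ _]/(index_iota 0 n.*2.+1) big_mkord.
by [].
Qed.

Lemma sum_zbox_widen (V : nmodType) m n (F : int -> V) : (m <= n)%N ->
  (forall x, (m < `|x|)%N -> F x = 0) ->
  \sum_(x <- zbox n) F x = \sum_(x <- zbox m) F x.
Proof.
move=> mn F0; apply: eq_sum_support; rewrite ?zbox_uniq// => x; rewrite !mem_zbox.
  by rewrite -ltnNge => _; exact: F0.
by move=> h /negP[]; lia.
Qed.

Lemma sum_zbox_shift (V : nmodType) m n (F : int -> V) (a : int) :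
  (m + `|a| <= n)%N -> (forall x, (m < `|x|)%N -> F x = 0) ->
  \sum_(x <- zbox n) F (x + a) = \sum_(x <- zbox n) F x.
Proof.
move=> mn F0.
rewrite -(big_map (fun x => x + a) predT F); apply: eq_sum_support.
- by rewrite map_inj_uniq ?zbox_uniq//; exact: addIr.
- exact: zbox_uniq.
- by move=> x _; rewrite mem_zbox => h; apply: F0; lia.
- move=> x _ h; apply: F0; rewrite ltnNge; apply/negP => hx; move/negP: h; apply.
  by apply/mapP; exists (x - a); rewrite ?mem_zbox; lia.
Qed.

Section sumZ.
Variable R : realType.

Lemma sumZE (a : int -> R) (l : R) :
  (\sum_(x <- zbox n) a x) @[n --> \oo] --> l -> sumZ a = l.
Proof.
move=> h; apply/cvg_lim => //.
by under eq_fun do rewrite sum_zboxE.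
Qed.

Lemma sumZ_eventually (a : int -> R) m (l : R) :
  (forall n, (m <= n)%N -> \sum_(x <- zbox n) a x = l) -> sumZ a = l.
Proof.
by move=> al; apply: sumZE; apply: cvg_near_cst; exists m => // n /= mn; exact: al.
Qed.

End sumZ.

(** * Local functions and the exclusion generator *)

Section locality.
Variable R : realType.
Implicit Types (f g u : conf -> R) (h k : conf) (x y z : int) (m n : nat).

Definition loc m f := forall h k, (forall x, (`|x| <= m)%N -> h x = k x) -> f h = f k.

Lemma loc_local m f : loc m f -> local f.
Proof.
move=> lf; exists (zbox m) => h k hk; apply: lf => x xm; apply: hk.
by rewrite mem_zbox.
Qed.

Lemma locW m n f : (m <= n)%N -> loc m f -> loc n f.
Proof. by move=> mn lf h k hk; apply: lf => x xm; apply: hk; exact: leq_trans mn. Qed.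

Lemma loc_cst m (a : R) : loc m (fun=> a). Proof. by []. Qed.

Lemma locD m f g : loc m f -> loc m g -> loc m (fun h => f h + g h).
Proof. by move=> lf lg h k hk; rewrite (lf h k)// (lg h k). Qed.

Lemma locM m f g : loc m f -> loc m g -> loc m (fun h => f h * g h).
Proof. by move=> lf lg h k hk; rewrite (lf h k)// (lg h k). Qed.

Lemma locN m f : loc m f -> loc m (fun h => - f h).
Proof. by move=> lf h k hk; rewrite (lf h k). Qed.

Lemma locB m f g : loc m f -> loc m g -> loc m (fun h => f h - g h).
Proof. by move=> lf lg; apply: locD => //; exact: locN. Qed.

Lemma locZ m (a : R) f : loc m f -> loc m (fun h => a * f h).
Proof. by move=> lf h k hk; rewrite (lf h k). Qed.

Lemma locX m i f : loc m f -> loc m (fun h => f h ^+ i).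
Proof. by move=> lf h k hk; rewrite (lf h k). Qed.

Lemma loc_sum_in (I : eqType) (s : seq I) (F : I -> conf -> R) m :
  (forall i, i \in s -> loc m (F i)) -> loc m (fun h => \sum_(i <- s) F i h).
Proof. by move=> lF h k hk; apply: eq_big_seq => i /lF; exact. Qed.

Definition sw x : conf -> conf := exchange x (x + 1).

Lemma swK x : involutive (sw x).
Proof.
move=> h; apply/funext => z; rewrite /sw /exchange.
have [->|zx] := eqVneq z x; first by rewrite eqxx; case: eqP => [/eqP|//]; lia.
have [->|zx1] := eqVneq z (x + 1); last by [].
by rewrite eqxx.
Qed.

Lemma sw_l x h : sw x h x = h (x + 1).
Proof. by rewrite /sw /exchange eqxx. Qed.

Lemma sw_r x h : sw x h (x + 1) = h x.
Proof. by rewrite /sw /exchange eqxx; case: eqP => // /eqP; lia. Qed.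

Lemma sw_out x y h : y != x -> y != x + 1 -> sw x h y = h y.
Proof. by rewrite /sw /exchange => /negPf-> /negPf->. Qed.

Lemma sw_id x h : h x = h (x + 1) -> sw x h = h.
Proof.
move=> hx; apply/funext => z.
have [->|zx] := eqVneq z x; first by rewrite sw_l.
have [->|zx1] := eqVneq z (x + 1); first by rewrite sw_r.
by rewrite sw_out.
Qed.

Lemma exchangeC x y h : exchange x y h = exchange y x h.
Proof.
apply/funext => z; rewrite /exchange.
by have [zx|_] := eqVneq z x; have [zy|_] := eqVneq z y; rewrite // -zx -zy.
Qed.

Definition grad x f : conf -> R := fun h => f (sw x h) - f h.

Lemma grad_loc m f x h : loc m f -> (m.+1 < `|x|)%N -> grad x f h = 0.
Proof.
move=> lf mx; apply/eqP; rewrite subr_eq0; apply/eqP; apply: lf => y ym.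
by apply: sw_out; lia.
Qed.

Variables p q : R.

Definition exchange_rate x h : R :=
  2 * p * (h x)%:R * (1 - (h (x + 1))%:R) + 2 * q * (h (x + 1))%:R * (1 - (h x)%:R).

(** It agrees with the generator on the functions of the spins in a smaller
    box. *)
Definition box_gen n f : conf -> R := fun h => \sum_(x <- zbox n) exchange_rate x h * grad x f h.

Lemma gen_widen m n f h : loc m f -> (m < n)%N -> box_gen n f h = box_gen m.+1 f h.
Proof.
move=> lf mn; apply: sum_zbox_widen => // x mx.
by rewrite (grad_loc _ lf) ?mulr0.
Qed.

(** A jump from [x] to [x - 1] and a jump from [x - 1] to [x] make the same
    exchange, so once the second sum is shifted by a site the generator is a
    single sum over bonds, of which finitely many move a local function. *)
Lemma exclusion_genE m n f : loc m f -> (m < n)%N -> exclusion_gen p q f = box_gen n f.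
Proof.
move=> lf mn; apply/funext => h; rewrite /exclusion_gen.
apply: (@sumZ_eventually _ _ m.+2) => k km.
rewrite (gen_widen _ lf mn) -(gen_widen h lf (ltnW km)) /box_gen.
rewrite big_split/=.
pose B x := 2 * q * (h (x + 1))%:R * (1 - (h x)%:R) * grad x f h.
have -> : \sum_(x <- zbox k) 2 * q * (h x)%:R * (1 - (h (x - 1))%:R) *
    (f (exchange x (x - 1) h) - f h) = \sum_(x <- zbox k) B (x + (-1)).
  apply: eq_bigr => x _; rewrite /B /grad /sw subrK exchangeC.
  by [].
rewrite (@sum_zbox_shift _ m.+1) => [||x mx].
- rewrite -big_split/=; apply: eq_bigr => x _.
  by rewrite /B /exchange_rate /grad; ring.
- by have -> : absz (-1) = 1%N by []; lia.
- by rewrite /B (grad_loc _ lf) ?mulr0.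
Qed.

(** A bond that moves [f] meets the box of radius [m], so both of its ends are
    within distance [m + 1] of the origin. *)
Lemma loc_exclusion_gen m f : loc m f -> loc m.+1 (exclusion_gen p q f).
Proof.
move=> lf; rewrite (exclusion_genE lf (ltnSn m)) => h k hk.
rewrite /box_gen; apply: eq_big_seq => x; rewrite mem_zbox => xm.
have [xE|xm'] := eqVneq `|x|%N m.+1.
  have [->|x1] := eqVneq x m.+1%:Z.
    have e h' : f (sw m.+1%:Z h') = f h' by apply: lf => y ym; apply: sw_out; lia.
    by rewrite /grad !e !subrr !mulr0.
  have xE' : x = - m.+1%:Z by lia.
  rewrite /exchange_rate !hk; try lia.
  congr (_ * _); rewrite /grad; congr (_ - _); apply: lf => y ym; last by apply: hk; lia.
  rewrite /sw /exchange.
  by case: ifP => _; [|case: ifP => _]; apply: hk; lia.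
rewrite /exchange_rate !hk; try lia.
congr (_ * _); rewrite /grad; congr (_ - _); apply: lf => y ym; last by apply: hk; lia.
rewrite /sw /exchange.
by case: ifP => _; [|case: ifP => _]; apply: hk; lia.
Qed.

End locality.

(** * Approximate local solutions of the resolvent equation *)

Section generator.
Variables (R : realType) (p q : R).
Hypotheses (p0 : 0 <= p) (q0 : 0 <= q) (pq1 : p + q = 1).
Implicit Types (f g u : conf -> R) (h k : conf) (x y z : int) (m n : nat).
Local Notation rate := (exchange_rate p q).
Local Notation L := (exclusion_gen p q).

Lemma rate_ge0 x h : 0 <= rate x h.
Proof. move: p0 q0 pq1; rewrite /exchange_rate; case: (h x); case: (h (x + 1)) => /= *; lra. Qed.

Lemma rate_le2 x h : rate x h <= 2.
Proof. move: p0 q0 pq1; rewrite /exchange_rate; case: (h x); case: (h (x + 1)) => /= *; lra. Qed.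

Lemma exclusion_gen_lin m f g (a b : R) : loc m f -> loc m g ->
  L (fun h => a * f h + b * g h) = (fun h => a * L f h + b * L g h).
Proof.
move=> lf lg; have lfg : loc m (fun h => a * f h + b * g h).
  by apply: locD; exact: locZ.
rewrite (exclusion_genE _ _ lf (ltnSn m)) (exclusion_genE _ _ lg (ltnSn m)).
rewrite (exclusion_genE _ _ lfg (ltnSn m)); apply/funext => h.
rewrite /box_gen !mulr_sumr -big_split/=; apply: eq_bigr => x _.
by rewrite /grad; ring.
Qed.

Lemma sum_zbox_le (F : int -> R) n (C : R) : (forall x, F x <= C) ->
  \sum_(x <- zbox n) F x <= n.*2.+1%:R * C.
Proof.
move=> FC; apply: (@le_trans _ _ (\sum_(x <- zbox n) C)).
  by apply: ler_sum.
by rewrite big_const_seq count_predT size_zbox iter_addr addr0 mulr_natl.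
Qed.

(** At most [2 * m + 3] bonds move [f], each at rate at most 2. *)
Lemma exclusion_gen_bound m f (C : R) : loc m f -> (forall h, `|f h| <= C) ->
  forall h, `|L f h| <= 8 * m.+2%:R * C.
Proof.
move=> lf fC h; rewrite (exclusion_genE _ _ lf (ltnSn m)).
apply: (le_trans (ler_norm_sum _ _ _)).
have C0 : 0 <= C by exact: le_trans (fC h).
apply: (@le_trans _ _ (m.+1.*2.+1%:R * (4 * C))).
  apply: sum_zbox_le => x; rewrite normrM ger0_norm ?rate_ge0// /grad.
  have := ler_normB (f (sw x h)) (f h); have := fC h; have := fC (sw x h).
  have := rate_ge0 x h; have := rate_le2 x h; have := normr_ge0 (f (sw x h) - f h).
  nra.
rewrite mulrA; apply: ler_wpM2r => //.
have -> : (m.+1.*2.+1 = m.*2 + 3)%N by lia.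
by rewrite natrD -muln2 natrM -addn2 natrD; lra.
Qed.

(** For a small time step the Euler scheme is a convex combination of
    [f] and of the [f \o sw x], because only finitely many bonds move [f]. *)
Lemma euler_step_bound m f (C : R) : loc m f -> (forall h, `|f h| <= C) ->
  forall h, `|f h + (4 * m.+2%:R)^-1 * L f h| <= C.
Proof.
move=> lf fC h; rewrite (exclusion_genE _ _ lf (ltnSn m)) /box_gen.
have C0 : 0 <= C by exact: le_trans (fC h).
set a := _^-1.
have a0 : 0 < a by rewrite invr_gt0 mulr_gt0.
pose S := \sum_(x <- zbox m.+1) rate x h.
have S0 : 0 <= S by apply: sumr_ge0 => x _; exact: rate_ge0.
have aS : a * S <= 1.
  rewrite mulrC ler_pdivrMr ?mul1r ?mulr_gt0//.
  apply: (le_trans (sum_zbox_le _ (fun x => rate_le2 x h))).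
  have -> : (m.+1.*2.+1 = m.*2 + 3)%N by lia.
  by rewrite natrD -muln2 natrM -addn2 natrD; lra.
have -> : f h + a * (\sum_(x <- zbox m.+1) rate x h * grad x f h) =
    (1 - a * S) * f h + a * \sum_(x <- zbox m.+1) rate x h * f (sw x h).
  rewrite mulrBl mul1r -addrA; congr (_ + _).
  rewrite -mulrA -mulrN -mulrDr; congr (_ * _).
  rewrite /S mulr_suml -sumrN -big_split/=; apply: eq_bigr => x _.
  by rewrite /grad; ring.
apply: (le_trans (ler_normD _ _)); rewrite !normrM (ger0_norm (ltW a0)).
rewrite (@ger0_norm _ (1 - _)) ?subr_ge0//.
have : `|\sum_(x <- zbox m.+1) rate x h * f (sw x h)| <= S * C.
  apply: (le_trans (ler_norm_sum _ _ _)); rewrite /S mulr_suml.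
  by apply: ler_sum => x _; rewrite normrM ger0_norm ?rate_ge0// ler_wpM2l// rate_ge0.
have := fC h; set A := `|f h|; set B := `|_| => hA hB.
have h1 : (1 - a * S) * A <= (1 - a * S) * C by rewrite ler_wpM2l// subr_ge0.
have h2 : a * B <= a * (S * C) by rewrite ler_wpM2l// ltW.
by lra.
Qed.

(** The correction turns [f] into a multiple smaller than 1 of an Euler step,
    and Euler steps are contractions. *)
Lemma dense_range_step m f (mu C : R) : loc m f -> (forall h, `|f h| <= C) ->
  0 < mu -> forall h,
  `|f h - (4 * m.+2%:R + mu)^-1 * (mu * f h - L f h)| <=
    C * (1 - mu / (4 * m.+2%:R + mu)).
Proof.
move=> lf fC mu0 h; have := euler_step_bound lf fC h.
have m0 : 0 < 4 * m.+2%:R :> R by rewrite mulr_gt0.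
set M := 4 * _ in m0 *; move=> fL.
have -> : f h - (M + mu)^-1 * (mu * f h - L f h) =
   (1 - mu / (M + mu)) * (f h + M^-1 * L f h).
  by field; rewrite !gt_eqF// addr_gt0.
have e : 0 <= 1 - mu / (M + mu).
  by rewrite subr_ge0 ler_pdivrMr ?addr_gt0//; lra.
by rewrite normrM (ger0_norm e) mulrC ler_wpM2r.
Qed.

(** Each correction enlarges the box by one site, hence the contraction at
    step [i] is only of order [1 / i] away from 1. *)
Lemma dense_range_iter m f (mu C : R) J : loc m f -> (forall h, `|f h| <= C) ->
  0 < mu -> exists u r, [/\ loc (m + J) u, loc (m + J) r,
    (forall h, mu * u h - L u h = f h - r h) &
    (forall h, `|r h| <= C * \prod_(0 <= i < J) (1 - mu / (4 * (m + i).+2%:R + mu)))].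
Proof.
move=> lf fC mu0; elim: J => [|J [u [r [lu lr ur rC]]]].
  exists (fun=> 0), f; split; rewrite ?addn0//.
    move=> h; rewrite mulr0 sub0r subrr (exclusion_genE _ _ (@loc_cst R m 0) (ltnSn m)).
    by rewrite /box_gen big1 ?oppr0// => x _; rewrite /grad subrr mulr0.
  by move=> h; rewrite big_geq// mulr1.
pose a := (4 * (m + J).+2%:R + mu)^-1.
pose r' h := r h - a * (mu * r h - L r h).
have lLr : loc (m + J.+1) (L r) by rewrite addnS; exact: loc_exclusion_gen.
exists (fun h => 1 * u h + a * r h), r'; split.
- by apply: locD; apply: locZ; [apply: locW lu|apply: locW lr]; lia.
- rewrite /r'; apply: locB; first by apply: locW lr; lia.
  by apply: locZ; apply: locB => //; apply: locZ; apply: locW lr; lia.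
- move=> h; rewrite (exclusion_gen_lin _ _ lu lr) /r'.
  have -> : f h = mu * u h - L u h + r h by rewrite ur subrK.
  by ring.
- by move=> h; rewrite big_nat_recr//= mulrA; exact: dense_range_step.
Qed.

(** The inverse of the product dominates a multiple of the partial sums of the
    harmonic series. *)
Lemma prod_cvg0 m (mu e : R) : 0 < mu -> 0 < e ->
  exists J, \prod_(0 <= i < J) (1 - mu / (4 * (m + i).+2%:R + mu)) <= e.
Proof.
move=> mu0 e0.
pose S n := \sum_(0 <= i < n) (m + i).+2%:R^-1 : R.
have bnd J : \prod_(0 <= i < J) (1 - mu / (4 * (m + i).+2%:R + mu)) <=
    (1 + mu / 4 * S J)^-1.
  have S0 n : 0 <= S n by apply: sumr_ge0 => i _.
  have D0 n : 0 < 1 + mu / 4 * S n.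
    by rewrite ltr_wpDr// mulr_ge0// divr_ge0// ltW.
  elim: J => [|J IH]; first by rewrite big_geq// /S big_geq// mulr0 addr0 invr1.
  rewrite big_nat_recr//=.
  set k : R := (m + J).+2%:R.
  have k0 : 0 < k by rewrite ltr0n.
  have -> : 1 - mu / (4 * k + mu) = (1 + mu / 4 * k^-1)^-1.
    by field; rewrite !gt_eqF//; lra.
  apply: (@le_trans _ _ ((1 + mu / 4 * S J)^-1 * (1 + mu / 4 * k^-1)^-1)).
    by apply: ler_wpM2r => //; rewrite invr_ge0 addr_ge0// mulr_ge0// ?invr_ge0 ?divr_ge0// ltW.
  have kk : 0 < 1 + mu / 4 * k^-1 by rewrite ltr_wpDr// mulr_ge0// ?invr_ge0 ?divr_ge0// ltW.
  rewrite -invfM lef_pV2 ?posrE ?mulr_gt0// /S big_nat_recr//= -/(S J) -/k.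
  have : 0 <= (mu / 4 * S J) * (mu / 4 * k^-1).
    by rewrite !mulr_ge0// ?invr_ge0 ltW.
  by move=> xy; rewrite -subr_ge0 (_ : _ - _ = mu / 4 * S J * (mu / 4 * k^-1)) //; ring.
have [J hJ] : exists J, e^-1 <= 1 + mu / 4 * S J; last first.
  exists J; apply: (le_trans (bnd J)); rewrite -[leRHS]invrK.
  by rewrite lef_pV2 ?posrE ?invr_gt0//; apply: lt_le_trans hJ; rewrite invr_gt0.
have [B hB] : exists B, B = e^-1 / (mu / 4) by eexists.
have [J hJ] : exists J, B <= S J; last first.
  exists J; move: hJ; rewrite hB ler_pdivrMr ?divr_gt0// mulrC => hJ.
  by apply: (le_trans hJ); lra.
apply: contrapT => /forallNP nB.
apply: (@dvg_harmonic R).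
apply: nondecreasing_is_cvgn.
  by apply/nondecreasing_seqP => n; rewrite /series /= big_nat_recr//= lerDl.
exists (\sum_(0 <= i < m.+1) harmonic i + B) => _ [n _ <-].
rewrite /series /=; apply: (@le_trans _ _ (\sum_(0 <= i < n + m.+1) (harmonic i : R))).
  rewrite (@big_cat_nat _ _ _ n _ _ _ _ (leq0n _) (leq_addr _ _)) /= lerDl.
  by apply: sumr_ge0 => i _.
rewrite (@big_cat_nat _ _ _ m.+1 _ _ _ _ (leq0n _) (leq_addl _ _)) /= lerD2l.
apply/ltW; rewrite ltNge; apply/negP => le; apply: (nB n); apply: (le_trans le).
rewrite -{1}[m.+1]add0n big_addn addnK; apply: ler_sum => i _.
by rewrite /harmonic /= addnS addnC.
Qed.

(** Local functions are a core: the resolvent equation has approximate local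
    solutions, the error vanishing since the harmonic series diverges. *)
Lemma dense_range m f (mu e : R) : loc m f -> (exists C : R, forall h, `|f h| <= C) ->
  0 < mu -> 0 < e -> exists M u r, [/\ (m <= M)%N, loc M u, loc M r,
    (forall h, mu * u h - L u h = f h - r h) & (forall h, `|r h| <= e)].
Proof.
move=> lf [C fC] mu0 e0.
have C0 : 0 <= C by exact: le_trans (fC (fun=> false)).
have [|J hJ] := @prod_cvg0 m mu (e / (C + 1)) mu0; first by rewrite divr_gt0// ltr_wpDl.
have [u [r [lu lr ur rC]]] := dense_range_iter J lf fC mu0.
exists (m + J)%N, u, r; split=> //; first by rewrite leq_addr.
move=> h; apply: (le_trans (rC h)).
apply: (@le_trans _ _ (C * (e / (C + 1)))); first exact: ler_wpM2l.
rewrite mulrCA -[leRHS]mulr1 ler_wpM2l//; first exact: ltW.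
by rewrite ler_pdivrMr ?ltr_wpDl// mul1r lerDl.
Qed.

End generator.

(** * The Bernoulli measure on boxes and the energy estimate *)

Definition box_conf (m : nat) := {ffun 'I_m.*2.+1 -> bool}.

(** Sites outside the box are left empty, a choice that functions of the box
    do not see. *)
Definition ext m (v : box_conf m) : conf :=
  fun x => [exists i : 'I_m.*2.+1, (i%:Z - m%:Z == x) && v i].

Definition res m (h : conf) : box_conf m := [ffun i : 'I_m.*2.+1 => h (i%:Z - m%:Z)].

Lemma ext_in m (v : box_conf m) (i : 'I_m.*2.+1) : ext v (i%:Z - m%:Z) = v i.
Proof.
apply/existsP/idP => [[j /andP[/eqP ji]]|vi]; last by exists i; rewrite eqxx.
by have -> : j = i by apply/val_inj => /=; lia.
Qed.

Lemma ext_out m (v : box_conf m) (x : int) : (m < `|x|)%N -> ext v x = false.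
Proof.
move=> mx; apply/negbTE/existsPn => i; apply/nandP; left.
by have := ltn_ord i; lia.
Qed.

Lemma extK m (v : box_conf m) : res m (ext v) = v.
Proof. by apply/ffunP => i; rewrite ffunE ext_in. Qed.

Lemma resK m h (x : int) : (`|x| <= m)%N -> ext (res m h) x = h x.
Proof.
move=> xm; have im : (absz (x + m%:Z)%R < m.*2.+1)%N by lia.
have {1}-> : x = (Ordinal im)%:Z - m%:Z by rewrite /=; lia.
by rewrite ext_in ffunE /=; congr h; lia.
Qed.

Section nu.
Variable R : realType.
Implicit Types (f g u : conf -> R) (h k : conf) (x y z : int) (m n : nat).

Lemma loc_res m f h : loc m f -> f (ext (res m h)) = f h.
Proof. by move=> lf; apply: lf => x xm; rewrite resK. Qed.

Lemma loc_bounded m f : loc m f -> exists C : R, forall h, `|f h| <= C.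
Proof.
move=> lf; exists (\sum_(v : box_conf m) `|f (ext v)|) => h.
rewrite -(loc_res h lf) (bigD1 (res m h))//= lerDl.
exact: sumr_ge0.
Qed.

(** Integration against the Bernoulli product measure of density 1/2: on
    functions of the box of radius [n] it is a uniform average, and averages
    over larger boxes agree with it. *)
Definition nu n f : R := (#|{: box_conf n}|%:R)^-1 * \sum_(v : box_conf n) f (ext v).

Lemma cfg_gt0 n : 0 < #|{: box_conf n}|%:R :> R.
Proof. by rewrite ltr0n; apply/card_gt0P; exists [ffun=> false]. Qed.

Lemma nuD n f g : nu n (fun h => f h + g h) = nu n f + nu n g.
Proof. by rewrite /nu big_split mulrDr. Qed.

Lemma nuZ n (a : R) f : nu n (fun h => a * f h) = a * nu n f.
Proof. by rewrite /nu -mulr_sumr mulrCA. Qed.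

Lemma nuN n f : nu n (fun h => - f h) = - nu n f.
Proof. by rewrite /nu sumrN mulrN. Qed.

Lemma nuB n f g : nu n (fun h => f h - g h) = nu n f - nu n g.
Proof. by rewrite nuD nuN. Qed.

Lemma nu_sum n (I : Type) (s : seq I) (F : I -> conf -> R) :
  nu n (fun h => \sum_(i <- s) F i h) = \sum_(i <- s) nu n (F i).
Proof. by rewrite /nu exchange_big/= mulr_sumr. Qed.

Lemma nu_cst n (a : R) : nu n (fun=> a) = a.
Proof.
rewrite /nu sumr_const -(mulr_natl a) mulrA mulVf ?mul1r//.
by rewrite gt_eqF// cfg_gt0.
Qed.

Lemma nu_le n f g : (forall h, f h <= g h) -> nu n f <= nu n g.
Proof.
move=> fg; rewrite /nu ler_pM2l ?invr_gt0 ?cfg_gt0//.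
by apply: ler_sum => v _.
Qed.

Lemma nu_ge0 n f : (forall h, 0 <= f h) -> 0 <= nu n f.
Proof. by move=> f0; rewrite -(nu_cst n 0); exact: nu_le. Qed.

Lemma eq_nu n f g : (forall h, f h = g h) -> nu n f = nu n g.
Proof. by move=> fg; rewrite /nu; congr (_ * _); apply: eq_bigr. Qed.

Arguments eq_nu {n f g}.

Lemma nu_inv n f (t : conf -> conf) : involutive t ->
  (forall h, (forall x, (n < `|x|)%N -> h x = false) ->
     forall x, (n < `|x|)%N -> t h x = false) ->
  nu n (fun h => f (t h)) = nu n f.
Proof.
move=> tK t0; rewrite /nu; congr (_ * _).
have e (v : box_conf n) : ext (res n (t (ext v))) = t (ext v).
  apply/funext => x; have [xn|xn] := leqP `|x| n; first by rewrite resK.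
  by rewrite ext_out// t0// => y; exact: ext_out.
pose T (v : box_conf n) := res n (t (ext v)).
have TK : involutive T by move=> v; rewrite /T e tK extK.
rewrite [RHS](reindex_inj (inv_inj TK)) /=.
by apply: eq_bigr => v _; rewrite /T e.
Qed.

Lemma nu_sw n f x : (`|x| < n)%N -> nu n (fun h => f (sw x h)) = nu n f.
Proof.
move=> xn; apply: nu_inv; first exact: swK.
by move=> h h0 y yn; rewrite sw_out ?h0//; lia.
Qed.

Definition flip x h : conf := fun y => if y == x then ~~ h y else h y.

Lemma flipK x : involutive (flip x).
Proof.
by move=> h; apply/funext => y; rewrite /flip; case: eqP => // _; rewrite negbK.
Qed.

Lemma nu_flip n f x : (`|x| <= n)%N -> nu n (fun h => f (flip x h)) = nu n f.
Proof.
move=> xn; apply: nu_inv; first exact: flipK.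
move=> h h0 y yn; rewrite /flip; case: eqP => [yx|_]; last exact: h0.
by move: yn; rewrite yx; lia.
Qed.

(** Flipping a spin permutes the configurations of the box. *)
Lemma nu_odd n f x : (`|x| <= n)%N -> (forall h, f (flip x h) = - f h) -> nu n f = 0.
Proof.
move=> xn fo; have := nu_flip f xn; rewrite (eq_nu fo) nuN.
by lra.
Qed.

Local Notation xi := (xi R).

Lemma xiE h x : xi h x = if h x then 1 else -1.
Proof.
have s4 : Num.sqrt (1 / 4) = 1 / 2 :> R.
  by rewrite (_ : 1 / 4 = (1 / 2) ^+ 2) ?sqrtr_sqr ?ger0_norm//; field.
by rewrite /Defs.xi s4; case: (h x) => /=; field.
Qed.

Lemma xi_sqr h x : xi h x * xi h x = 1.
Proof. by rewrite xiE; case: (h x); ring. Qed.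

Lemma xi_norm h x : `|xi h x| = 1.
Proof. by rewrite xiE; case: (h x); rewrite ?normrN normr1. Qed.

Lemma loc_xi m x : (`|x| <= m)%N -> loc m (fun h => xi h x).
Proof. by move=> xm h k hk; rewrite !xiE hk. Qed.

Lemma xi_flip h x : xi (flip x h) x = - xi h x.
Proof. by rewrite !xiE /flip eqxx; case: (h x); rewrite //= ?opprK. Qed.

Lemma xi_flip_out h x y : y != x -> xi (flip x h) y = xi h y.
Proof. by rewrite !xiE /flip => /negPf->. Qed.

Lemma xi_sw_l h x : xi (sw x h) x = xi h (x + 1).
Proof. by rewrite !xiE sw_l. Qed.

Lemma xi_sw_r h x : xi (sw x h) (x + 1) = xi h x.
Proof. by rewrite !xiE sw_r. Qed.

Lemma xi_sw_out h x y : y != x -> y != x + 1 -> xi (sw x h) y = xi h y.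
Proof. by move=> yx yx1; rewrite !xiE sw_out. Qed.

Lemma nu_xixi n x y : (`|x| <= n)%N -> (`|y| <= n)%N ->
  nu n (fun h => xi h x * xi h y) = (x == y)%:R.
Proof.
move=> xn yn; have [<-|xy] := eqVneq x y.
  by rewrite (eq_nu (g := fun=> 1)) ?nu_cst// => h; rewrite xi_sqr.
apply: (nu_odd xn) => h; rewrite xi_flip xi_flip_out ?mulNr//.
by rewrite eq_sym.
Qed.

(** Spins are orthonormal. *)
Lemma nu_linear_sqr n (I : eqType) (s : seq I) (y : I -> int) (b : I -> R) :
  uniq s -> injective y -> (forall i, i \in s -> (`|y i| <= n)%N) ->
  nu n (fun h => (\sum_(i <- s) b i * xi h (y i)) ^+ 2) = \sum_(i <- s) b i ^+ 2.
Proof.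
move=> us yi yn.
rewrite (eq_nu (g := fun h => \sum_(i <- s) \sum_(j <- s)
    (b i * b j) * (xi h (y i) * xi h (y j)))); last first.
  move=> h; rewrite expr2 mulr_suml; apply: eq_bigr => i _.
  by rewrite mulr_sumr; apply: eq_bigr => j _; ring.
rewrite nu_sum; apply: eq_big_seq => i si.
rewrite nu_sum (bigD1_seq i)//= nuZ nu_xixi ?yn// eqxx mulr1 expr2.
rewrite big_seq_cond big1 ?addr0// => j /andP[sj ji].
by rewrite nuZ nu_xixi ?yn// (inj_eq yi) eq_sym (negPf ji) mulr0.
Qed.

End nu.
Arguments eq_nu {R n f g}.

Section dirichlet.
Variables (R : realType) (p q : R).
Hypotheses (p0 : 0 <= p) (q0 : 0 <= q) (pq1 : p + q = 1).
Implicit Types (f g u : conf -> R) (h k : conf) (x y z : int) (m n : nat).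
Local Notation rate := (exchange_rate p q).
Local Notation L := (exclusion_gen p q).
Local Notation xi := (xi R).

(** Summed over a box the imbalance [rate \o sw x - rate] telescopes to sites
    that [f] does not see, so the asymmetric part does not move the mean. *)
Lemma nu_gen0 m n f : loc m f -> (m.+2 <= n)%N -> nu n (L f) = 0.
Proof.
clear p0 q0 pq1; move=> lf mn; rewrite (exclusion_genE _ _ lf (ltnSn m)) /box_gen nu_sum.
have e x : x \in zbox m.+1 -> nu n (fun h => rate x h * grad x f h) =
   nu n (fun h => f h * (2 * (p - q) * ((h (x + 1))%:R - (h x)%:R))).
  rewrite mem_zbox => xm; rewrite /grad.
  under eq_nu => h do rewrite mulrBr.
  rewrite nuB -(nu_sw (n := n) (fun h => rate x h * f (sw x h)) (x := x)); last by lia.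
  under eq_nu => h do rewrite swK.
  rewrite -nuB; apply: eq_nu => h; rewrite /exchange_rate sw_l sw_r.
  by case: (h x); case: (h (x + 1)) => /=; ring.
rewrite (eq_big_seq _ e) -nu_sum.
rewrite (eq_nu (g := fun h => 2 * (p - q) *
   (f h * (h (m.+1%:Z + 1))%:R - f h * (h (- m.+1%:Z))%:R))); last first.
  move=> h; rewrite -mulr_sumr -mulr_sumr.
  have -> : \sum_(x <- zbox m.+1) ((h (x + 1))%:R - (h x)%:R : R) =
      (h (m.+1%:Z + 1))%:R - (h (- m.+1%:Z))%:R.
    rewrite big_map -[iota _ _]/(index_iota 0 m.+1.*2.+1).
    pose F (i : nat) : R := (h (i%:Z - m.+1%:Z))%:R.
    rewrite (eq_bigr (fun i : nat => F i.+1 - F i)); last first.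
      move=> i _; rewrite /F; congr ((h _)%:R - _); lia.
    rewrite telescope_sumr// /F; congr ((h _)%:R - (h _)%:R); lia.
  by ring.
(* a spin that [f] does not see is independent of [f] and has mean zero *)
have half y : (`|y| <= n)%N -> (m < `|y|)%N ->
    nu n (fun h => f h * (h y)%:R) = 1 / 2 * nu n f.
  move=> yn my.
  rewrite (eq_nu (g := fun h => 1 / 2 * f h + 1 / 2 * (f h * xi h y))); last first.
    by move=> h; rewrite xiE; case: (h y) => /=; field.
  rewrite nuD !nuZ (@nu_odd _ _ (fun h => f h * xi h y) y)// ?mulr0 ?addr0//.
  move=> h; rewrite xi_flip mulrN (lf _ h)// => x xm.
  by rewrite /flip; case: eqP => // xy; move: my; rewrite -xy; lia.
by rewrite nuZ nuB !half ?subrr ?mulr0//; lia.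
Qed.

(** Since [L (f ^+ 2)] has mean zero, [f * L f] has minus half the mean of the
    sum over bonds of the rate times the squared gradient; the rates before
    and after an exchange that changes the configuration add up to 2, whatever
    the asymmetry. *)
Lemma dirichlet_form m n f : loc m f -> (m.+2 <= n)%N ->
  - nu n (fun h => f h * L f h) =
  1 / 2 * \sum_(x <- zbox m.+1) nu n (fun h => grad x f h ^+ 2).
Proof.
clear p0 q0; move=> lf mn; have lf2 : loc m (fun h => f h * f h) by exact: locM.
have := nu_gen0 lf2 mn.
rewrite (exclusion_genE _ _ lf (ltnSn m)) (exclusion_genE _ _ lf2 (ltnSn m)).
rewrite /box_gen.
rewrite (eq_nu (g := fun h => \sum_(x <- zbox m.+1) rate x h * grad x f h ^+ 2
  + 2 * (f h * \sum_(x <- zbox m.+1) rate x h * grad x f h))); last first.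
  move=> h; rewrite !mulr_sumr -big_split/=; apply: eq_bigr => x _.
  by rewrite /grad; ring.
rewrite nuD nuZ.
have -> : nu n (fun h => \sum_(x <- zbox m.+1) rate x h * grad x f h ^+ 2) =
   \sum_(x <- zbox m.+1) nu n (fun h => grad x f h ^+ 2); last first.
  by move=> e0; lra.
rewrite nu_sum; apply: eq_big_seq => x; rewrite mem_zbox => xm.
have e : nu n (fun h => rate x (sw x h) * grad x f h ^+ 2) =
         nu n (fun h => rate x h * grad x f h ^+ 2).
  rewrite -(nu_sw (fun h => rate x h * grad x f h ^+ 2) (x := x)); last by lia.
  apply: eq_nu => h; rewrite /grad swK; congr (_ * _).
  by rewrite -sqrrN opprB.
have : nu n (fun h => (rate x (sw x h) + rate x h) * grad x f h ^+ 2) =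
   nu n (fun h => 2 * grad x f h ^+ 2).
  apply: eq_nu => h; have [hx|hx] := eqVneq (h x) (h (x + 1)).
    by rewrite /grad sw_id// subrr expr0n/= !mulr0.
  congr (_ * _); transitivity (2 * (p + q)); last by rewrite pq1 mulr1.
  rewrite /exchange_rate sw_l sw_r.
  by move: hx; case: (h x); case: (h (x + 1)) => //= _; ring.
rewrite (eq_nu (g := fun h => rate x (sw x h) * grad x f h ^+ 2
    + rate x h * grad x f h ^+ 2)) => [|h]; last by rewrite mulrDl.
by rewrite nuD e nuZ => ?; lra.
Qed.

(** Duality: [xi z - xi (z + 1)] is odd under the exchange [sw z], so
    pairing it with [u] only tests the gradient of [u]. *)
Lemma gradient_duality m M n u (g : int -> conf -> R) (kap : R) : loc M u ->
  (m <= M.+1)%N -> (M.+2 <= n)%N -> 0 < kap ->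
  (forall z h, g z (sw z h) = g z h) ->
  nu n (fun h => u h * \sum_(z <- zbox m) g z h * (xi h z - xi h (z + 1))) <=
  kap * \sum_(z <- zbox m) nu n (fun h => g z h ^+ 2)
  - nu n (fun h => u h * L u h) / (2 * kap).
Proof.
clear p0 q0; move=> lu mM Mn kap0 gi.
rewrite -mulNr (dirichlet_form lu Mn).
pose D z := nu n (fun h => grad z u h ^+ 2).
have D0 z : 0 <= D z by apply: nu_ge0 => h; exact: sqr_ge0.
apply: (@le_trans _ _ (kap * \sum_(z <- zbox m) nu n (fun h => g z h ^+ 2) +
    1 / 2 * (\sum_(z <- zbox m) D z) / (2 * kap))); last first.
  rewrite lerD2l ler_pM2r ?invr_gt0 ?mulr_gt0// ler_pM2l//.
  have -> : \sum_(z <- zbox m) D z = \sum_(z <- zbox M.+1 | (`|z| <= m)%N) D z.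
    rewrite -[RHS]big_filter; apply: perm_big; apply: uniq_perm.
    - exact: zbox_uniq.
    - exact/filter_uniq/zbox_uniq.
    - by move=> z; rewrite mem_filter !mem_zbox; lia.
  rewrite [leRHS](bigID (fun z => (`|z| <= m)%N)) /= lerDl.
  by apply: sumr_ge0 => z _; exact: D0.
rewrite (eq_nu (g := fun h => \sum_(z <- zbox m) u h * (g z h * (xi h z - xi h (z + 1)))));
  last by move=> h; rewrite mulr_sumr.
rewrite nu_sum !mulr_sumr mulr_suml -big_split/=.
rewrite big_seq [leRHS]big_seq; apply: ler_sum => z; rewrite mem_zbox => zm.
set w := fun h => g z h * (xi h z - xi h (z + 1)).
have e : nu n (fun h => u h * w h) = nu n (fun h => - (1 / 2) * (w h * grad z u h)).
  have e2 : nu n (fun h => u h * w h) = nu n (fun h => - (u (sw z h) * w h)).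
    rewrite -(nu_sw (fun h => u h * w h) (x := z)); last by lia.
    by apply: eq_nu => h; rewrite /w gi xi_sw_l xi_sw_r; ring.
  have -> : nu n (fun h => - (1 / 2) * (w h * grad z u h)) =
    nu n (fun h => 1 / 2 * (u h * w h) + 1 / 2 * - (u (sw z h) * w h)).
    by apply: eq_nu => h; rewrite /grad; ring.
  by rewrite nuD !nuZ -e2; lra.
rewrite e /D -nuZ.
have -> : 1 / 2 * nu n (fun h => grad z u h ^+ 2) / (2 * kap) =
   nu n (fun h => (4 * kap)^-1 * grad z u h ^+ 2).
  by rewrite nuZ; field; rewrite gt_eqF.
rewrite -nuD; apply: nu_le => h; rewrite /w.
set a := g z h; set b := grad z u h; set x := _ - _.
have x4 : x ^+ 2 <= 4.
  by rewrite /x !xiE; case: (h z); case: (h (z + 1)); lra.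
(* completing the square in [b], the gradient of a spin being at most 2 *)
have e3 : kap * a ^+ 2 + (4 * kap)^-1 * b ^+ 2 - (- (1 / 2) * (a * x * b)) =
   (4 * kap)^-1 * (b + kap * a * x) ^+ 2 + kap / 4 * (a ^+ 2 * (4 - x ^+ 2)).
  by field; rewrite gt_eqF.
rewrite -subr_ge0 e3; apply: addr_ge0; apply: mulr_ge0.
- by rewrite invr_ge0 mulr_ge0// ltW.
- exact: sqr_ge0.
- by rewrite divr_ge0// ltW.
- by rewrite mulr_ge0 ?sqr_ge0 ?subr_ge0.
Qed.

(** The solution [u] of the resolvent equation obeys the energy estimate
    [nu(u^2) + D(u) / kap = nu(u (f - r))], closed with [gradient_duality]. *)
Lemma resolvent_decomp m (b : int -> int -> R) (kap e : R) :
  0 < kap -> 0 < e ->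
  let f h := \sum_(z <- zbox m)
    (\sum_(x <- zbox m | x < z) b x z * xi h x) * (xi h z - xi h (z + 1)) in
  exists M u r, [/\ (m.+1 <= M)%N, loc M u /\ loc M r,
    (forall h, f h = u h - kap^-1 * L u h + r h), (forall h, `|r h| <= e) &
    forall n, (M.+2 <= n)%N ->
      nu n (fun h => u h ^+ 2) - nu n (fun h => u h * L u h) / kap <=
      2 * kap * \sum_(z <- zbox m) \sum_(x <- zbox m | x < z) b x z ^+ 2 + e ^+ 2].
Proof.
move=> kap0 e0 f; have kap00 : kap != 0 by rewrite gt_eqF.
pose g z h := \sum_(x <- zbox m | x < z) b x z * xi h x.
have lg z : loc m (g z).
  move=> h k hk; rewrite /g big_seq_cond [RHS]big_seq_cond.
  apply: eq_bigr => x /andP[]; rewrite mem_zbox => xm _; congr (_ * _).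
  exact: (@loc_xi R m x xm h k hk).
have lf : loc m.+1 f.
  apply: loc_sum_in => z; rewrite mem_zbox => zm; apply: locM.
    by apply: locW (lg z).
  by apply: locB; apply: loc_xi; lia.
have lkf : loc m.+1 (fun h => kap * f h) by exact: locZ.
have [|M [u [r [mM lu lr ur re]]]] :=
    dense_range p0 q0 pq1 lkf (loc_bounded lkf) kap0 (e := kap * e).
  exact: mulr_gt0.
have fE h : f h = u h - kap^-1 * L u h + kap^-1 * r h.
  have : kap * f h = kap * u h - L u h + r h by rewrite ur subrK.
  by move=> e1; rewrite -[LHS](mulKf kap00) e1; field.
have rE h : `|kap^-1 * r h| <= e.
  by rewrite normrM gtr0_norm ?invr_gt0// mulrC ler_pdivrMr// mulrC; exact: re.
exists M, u, (fun h => kap^-1 * r h); split => //.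
  by split=> //; exact: locZ.
move=> n Mn.
have gsw z h : g z (sw z h) = g z h.
  by apply: eq_bigr => x xz; rewrite xi_sw_out//; lia.
have := gradient_duality (m := m) lu _ Mn kap0 gsw.
have -> : \sum_(z <- zbox m) nu n (fun h => g z h ^+ 2) =
    \sum_(z <- zbox m) \sum_(x <- zbox m | x < z) b x z ^+ 2.
  apply: eq_big_seq => z; rewrite mem_zbox => zm; rewrite -[RHS]big_filter.
  rewrite -(@nu_linear_sqr _ n _ _ id)//; last 2 first.
  - exact/filter_uniq/zbox_uniq.
  - by move=> x; rewrite mem_filter mem_zbox => /andP[_]; lia.
  by apply: eq_nu => h; rewrite /g big_filter.
set B := \sum_(z <- _) _; move=> /(_ ltac:(lia)) dual.
have {}dual : nu n (fun h => u h * f h) <= kap * B - nu n (fun h => u h * L u h) / (2 * kap).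
  exact: dual.
have e1 : nu n (fun h => u h * f h) = nu n (fun h => u h ^+ 2)
    - kap^-1 * nu n (fun h => u h * L u h) + nu n (fun h => u h * (kap^-1 * r h)).
  rewrite -nuZ -nuB -nuD; apply: eq_nu => h; rewrite fE; ring.
have e2 : - nu n (fun h => u h * (kap^-1 * r h)) <=
   1 / 2 * nu n (fun h => u h ^+ 2) + 1 / 2 * e ^+ 2.
  rewrite -nuN -nuZ -(nu_cst n (1 / 2 * e ^+ 2)) -nuD; apply: nu_le => h.
  have := rE h; set y := kap^-1 * r h => /ler_normlP[y1 y2].
  have : 0 <= (u h + y) ^+ 2 by exact: sqr_ge0.
  have : y ^+ 2 <= e ^+ 2.
    by rewrite -(ler_sqrt (y ^+ 2)) ?sqr_ge0// !sqrtr_sqr (gtr0_norm e0); exact: rE.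
  by lra.
have e3 : nu n (fun h => u h * L u h) / (2 * kap) = 1 / 2 * (kap^-1 * nu n (fun h => u h * L u h)).
  by field.
rewrite [_ / kap]mulrC; rewrite e3 in dual; lra.
Qed.

End dirichlet.

(** * The Markov property tested on local functions *)

Section bounded_measurable.
Variables (R : realType) (d : measure_display) (Omega : measurableType d).
Variable P : probability Omega R.
Implicit Types X Y : Omega -> R.

Definition bounded_meas X := measurable_fun setT X /\ exists C : R, forall w, `|X w| <= C.

Lemma bm_cst (a : R) : bounded_meas (fun=> a).
Proof. by split; [exact: measurable_cst | exists `|a|]. Qed.

Lemma bmD X Y : bounded_meas X -> bounded_meas Y -> bounded_meas (fun w => X w + Y w).
Proof.
move=> [mX [C XC]] [mY [D YD]]; split; first exact: measurable_funD.
exists (C + D) => w; apply: (le_trans (ler_normD _ _)); exact: lerD.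
Qed.

Lemma bmM X Y : bounded_meas X -> bounded_meas Y -> bounded_meas (fun w => X w * Y w).
Proof.
move=> [mX [C XC]] [mY [D YD]]; split; first exact: measurable_funM.
by exists (C * D) => w; rewrite normrM ler_pM.
Qed.

Lemma bmZ (a : R) X : bounded_meas X -> bounded_meas (fun w => a * X w).
Proof. by apply: bmM; exact: bm_cst. Qed.

Lemma bmN X : bounded_meas X -> bounded_meas (fun w => - X w).
Proof. by move=> /(bmZ (-1)); under eq_fun do rewrite mulN1r. Qed.

Lemma bmB X Y : bounded_meas X -> bounded_meas Y -> bounded_meas (fun w => X w - Y w).
Proof. by move=> bX bY; apply: bmD => //; exact: bmN. Qed.

Lemma bmX X n : bounded_meas X -> bounded_meas (fun w => X w ^+ n).
Proof.
move=> bX; elim: n => [|n IH]; first exact: bm_cst.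
by under eq_fun do rewrite exprS; exact: bmM.
Qed.

Lemma bm_sum (I : Type) (s : seq I) (F : I -> Omega -> R) :
  (forall i, bounded_meas (F i)) -> bounded_meas (fun w => \sum_(i <- s) F i w).
Proof.
move=> bF; elim: s => [|i s IH].
  by under eq_fun do rewrite big_nil; exact: bm_cst.
by under eq_fun do rewrite big_cons; exact: bmD.
Qed.

Lemma bm_integrable X : bounded_meas X -> P.-integrable setT (EFin \o X).
Proof.
move=> [mX [C XC]]; apply: measurable_bounded_integrable => //.
  exact: (le_lt_trans (probability_le1 P measurableT) (ltry 1)).
exists C; split; first exact: num_real.
by move=> M CM w _; apply: le_trans (ltW CM); exact: XC.
Qed.

Definition expect X : R := \int[P]_w X w.

Lemma ExD X Y : bounded_meas X -> bounded_meas Y -> expect (fun w => X w + Y w) = expect X + expect Y.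
Proof. by move=> bX bY; rewrite /expect RintegralD//; exact: bm_integrable. Qed.

Lemma ExZ (a : R) X : bounded_meas X -> expect (fun w => a * X w) = a * expect X.
Proof. by move=> bX; rewrite /expect RintegralZl//; exact: bm_integrable. Qed.

Lemma ExN X : bounded_meas X -> expect (fun w => - X w) = - expect X.
Proof.
by move=> bX; rewrite -mulN1r -ExZ//; congr expect; apply/funext => w; rewrite mulN1r.
Qed.

Lemma ExB X Y : bounded_meas X -> bounded_meas Y -> expect (fun w => X w - Y w) = expect X - expect Y.
Proof. by move=> bX bY; rewrite ExD ?ExN//; exact: bmN. Qed.

Lemma Ex_cst (a : R) : expect (fun=> a) = a.
Proof. by rewrite /expect /Rintegral integral_cst//= probability_setT mule1. Qed.

Lemma Ex_le X Y : bounded_meas X -> bounded_meas Y -> (forall w, X w <= Y w) -> expect X <= expect Y.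
Proof. by move=> bX bY XY; apply: le_Rintegral => //; exact: bm_integrable. Qed.

Lemma Ex_abs_le X C : bounded_meas X -> (forall w, `|X w| <= C) -> `|expect X| <= C.
Proof.
move=> bX XC; rewrite ler_norml -{1}(Ex_cst (- C)) -{2}(Ex_cst C).
by apply/andP; split; apply: Ex_le => //; try exact: bm_cst; move=> w;
  have := XC w; rewrite ler_norml => /andP[].
Qed.

Lemma Ex_sum (I : Type) (s : seq I) (F : I -> Omega -> R) :
  (forall i, bounded_meas (F i)) -> expect (fun w => \sum_(i <- s) F i w) = \sum_(i <- s) expect (F i).
Proof.
move=> bF; elim: s => [|i s IH].
  by under [X in expect X]eq_fun do rewrite big_nil; rewrite Ex_cst big_nil.
under [X in expect X]eq_fun do rewrite big_cons.
by rewrite ExD ?IH ?big_cons//; exact: bm_sum.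
Qed.

Lemma bm_indic (A : set Omega) : measurable A -> bounded_meas (\1_A).
Proof.
move=> mA; split; first exact: measurable_indic.
by exists 1 => w; rewrite indicE; case: (w \in A); rewrite ?normr1 ?normr0.
Qed.

Lemma Ex_indic X (A : set Omega) : measurable A ->
  expect (fun w => X w * \1_A w) = fine (\int[P]_(w in A) (X w)%:E)%E.
Proof.
move=> mA; rewrite /expect -/(Rintegral P A X) [RHS]Rintegral_mkcond; congr Rintegral.
apply/funext => w; rewrite /patch indicE; case: ifP => _; first by rewrite mulr1.
by rewrite mulr0.
Qed.

End bounded_measurable.

Lemma near_right0 (R : realType) (Q : R -> Prop) : (\forall t \near 0^'+, Q t) ->
  exists2 e : R, 0 < e & forall t, 0 < t -> t < e -> Q t.
Proof.
case=> e /= e0 eQ; exists e => // t t0 te; apply: eQ => //=.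
by rewrite sub0r normrN gtr0_norm.
Qed.

Section semigroup.
Variables (R : realType) (p q : R) (S : R -> (conf -> R) -> conf -> R).
Hypothesis fS : feller_semigroup S.
Hypothesis gS : forall f, local f -> generates S f (exclusion_gen p q f).
Implicit Types (f g : conf -> R) (t C e : R).

Lemma loc_continuous m f : loc m f -> continuous f.
Proof. by move=> /loc_local /gS[]. Qed.

Lemma semigroup_continuous t f : 0 <= t -> continuous f -> continuous (S t f).
Proof. by move=> t0 cf; have [[+ _ _ _] _] := fS; exact. Qed.

(** Positivity is applied to [C - f] and to [C + f]. *)
Lemma semigroup_bound t f C : 0 <= t -> continuous f -> (forall h, `|f h| <= C) ->
  forall h, `|S t f h| <= C.
Proof.
move=> t0 cf fC h; have [[_ lin one pos] _] := fS.
have c1 : continuous ((fun=> 1) : conf -> R) by move=> x; exact: cvg_cst.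
have SC : S t (fun=> C) = (fun=> C).
  have -> : (fun=> C) = (fun x : conf => (C - 1) * (fun=> 1) x + (fun=> 1) x :> R).
    by apply/funext => x; rewrite mulr1 subrK.
  by rewrite lin// one.
have cC : continuous ((fun=> C) : conf -> R) by move=> x; exact: cvg_cst.
have h1 : 0 <= S t (fun x => -1 * f x + (fun=> C) x) h.
  apply: pos => // [x|x]; last by have := fC x; rewrite ler_norml => /andP[]; lra.
  by apply: cvgD; [apply: cvgM; [exact: cvg_cst|exact: cf]|exact: cvg_cst].
have h2 : 0 <= S t (fun x => 1 * f x + (fun=> C) x) h.
  apply: pos => // [x|x]; last by have := fC x; rewrite ler_norml => /andP[]; lra.
  by apply: cvgD; [apply: cvgM; [exact: cvg_cst|exact: cf]|exact: cvg_cst].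
move: h1 h2; rewrite !lin// SC => h1 h2.
by rewrite ler_norml; apply/andP; split; lra.
Qed.

Lemma semigroup_expand m f (e : R) : loc m f -> 0 < e ->
  exists2 D : R, 0 < D & forall t, 0 < t -> t < D ->
    forall h, `|S t f h - f h - t * exclusion_gen p q f h| <= t * e.
Proof.
move=> lf e0; have [_ /(_ _ e0)/near_right0[D D0 HD]] := gS (loc_local lf).
exists D => // t t0 tD h; have := HD t t0 tD h.
move/ltW => le; have t00 : t != 0 by rewrite gt_eqF.
have -> : S t f h - f h - t * exclusion_gen p q f h =
    t * ((S t f h - f h) / t - exclusion_gen p q f h) by field.
by rewrite normrM gtr0_norm// ler_pM2l.
Qed.

End semigroup.

Lemma ext_res_cvg (h : conf) : (fun n => (ext (res n h) : conf)) @ \oo --> h.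
Proof.
apply/cvg_sup => x; apply/cvg_image => [|W /= Wx].
  by rewrite eqEsubset; split=> v // _; exists (fun=> v).
exists ((fun k : conf => k x) @^-1` W); last first.
  by rewrite eqEsubset; split => [v [k + <-//]|v Wv]; exists (fun=> v).
exists `|x|%N => // n /= xn; rewrite resK//; exact: nbhs_singleton.
Qed.

Section process.
Variables (R : realType) (p q : R) (S : R -> (conf -> R) -> conf -> R).
Variables (d : measure_display) (Omega : measurableType d).
Variables (P : probability Omega R) (eta : R -> Omega -> conf).
Hypothesis fS : feller_semigroup S.
Hypothesis gS : forall f, local f -> generates S f (exclusion_gen p q f).
Hypothesis meas : forall (t : R) x, 0 <= t -> measurable [set w | eta t w x].
Hypothesis markov : markov_process P S eta.
Hypothesis init : bernoulli_law P (1 / 2) (eta 0).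
Implicit Types (f g u : conf -> R) (h k : conf) (x y z : int) (m n : nat).
Implicit Types r s t e C : R.
Local Notation L := (exclusion_gen p q).
Local Notation Ex := (expect P).

Definition cyl m t (v : box_conf m) : set Omega := [set w | res m (eta t w) = v].

(** A cylinder is the complement of a finite union of events that concern one
    site. The sigma-algebra is arbitrary because both the ambient one and the
    history are needed. *)
Lemma cyl_sigma (M : set (set Omega)) m t (v : box_conf m) : sigma_algebra setT M ->
  (forall x, M [set w | eta t w x]) -> M (cyl t v).
Proof.
move=> [M0 MC MU] Mx.
pose B n : set Omega :=
  if (n < m.*2.+1)%N then
    if ext v (n%:Z - m%:Z) then setT `\` [set w | eta t w (n%:Z - m%:Z)]
    else [set w | eta t w (n%:Z - m%:Z)]
  else set0.
have -> : cyl t v = setT `\` \bigcup_n B n.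
  apply/seteqP; split => w /=.
    move=> wv; split => // -[n _]; rewrite /B; case: ifP => // nm.
    have e : ext v (n%:Z - m%:Z) = eta t w (n%:Z - m%:Z).
      by rewrite -wv (ext_in _ (Ordinal nm)) ffunE.
    by rewrite e; case: ifP => [Ht [_]|Hf]//=; rewrite Hf.
  move=> [_ nB]; apply/ffunP => i; rewrite ffunE.
  have ni : ~ B i w by move=> Bi; apply: nB; exists (val i).
  move: ni; rewrite /B ltn_ord ext_in; case: (v i) => /=.
    by case: (eta t w _) => // ni; exfalso; apply: ni.
  by case: (eta t w _).
apply: (MC); apply: MU => n; rewrite /B; case: ifP => // _.
by case: ifP => // _; apply: MC.
Qed.

Lemma measurable_cyl m t (v : box_conf m) : 0 <= t -> measurable (cyl t v).
Proof.
move=> t0; apply: cyl_sigma => [|x]; last exact: meas.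
split; [exact: measurable0|by move=> A mA; exact: measurableD|].
by move=> A mA; exact: bigcupT_measurable.
Qed.

Lemma history_cyl m r s (v : box_conf m) : 0 <= r -> r <= s -> history eta s (cyl r v).
Proof.
move=> r0 rs; apply: cyl_sigma => [|x]; first exact: smallest_sigma_algebra.
by apply: sub_sigma_algebra; exists r, x; split.
Qed.

Lemma loc_cyl m f t w : loc m f ->
  f (eta t w) = \sum_(v : box_conf m) f (ext v) * \1_(cyl t v) w.
Proof.
move=> lf; rewrite (bigD1 (res m (eta t w)))//= indicE mem_set// mulr1.
rewrite (loc_res _ lf) big1 ?addr0// => v vr.
rewrite indicE memNset ?mulr0// => wv; move: vr; rewrite -wv.
by rewrite /cyl eqxx.
Qed.

Lemma bm_loc m f t : loc m f -> 0 <= t -> bounded_meas (fun w => f (eta t w)).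
Proof.
move=> lf t0; under eq_fun do rewrite (loc_cyl _ _ lf).
by apply: bm_sum => v; apply: bmZ; apply: bm_indic; exact: measurable_cyl.
Qed.

(** Truncation to growing boxes makes a continuous function a limit of local
    ones. *)
Lemma bm_continuous f t C : continuous f -> (forall h, `|f h| <= C) -> 0 <= t ->
  bounded_meas (fun w => f (eta t w)).
Proof.
move=> cf fC t0; split; last by exists C.
apply: (@measurable_fun_cvg _ _ _ _ (fun n w => f (ext (res n (eta t w))))) => [n|w _].
  have lf : loc n (fun h => f (ext (res n h))).
    move=> h k hk; congr (f (ext _)); apply/ffunP => i; rewrite !ffunE hk//.
    by have := ltn_ord i; lia.
  by have [] := bm_loc lf t0.
exact: (cvg_comp _ _ (@ext_res_cvg (eta t w)) (cf (eta t w))).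
Qed.

(** All the cylinders on a box have the same initial probability. *)
Lemma Ex_init n f : loc n f -> Ex (fun w => f (eta 0 w)) = nu n f.
Proof.
move=> lf; under [X in Ex X]eq_fun do rewrite (loc_cyl _ _ lf).
rewrite Ex_sum; last first.
  by move=> v; apply: bmZ; apply: bm_indic; exact: measurable_cyl.
rewrite /nu mulr_sumr; apply: eq_bigr => v _.
rewrite ExZ; last by apply: bm_indic; exact: measurable_cyl.
rewrite mulrC; congr (_ * _).
have -> : Ex (\1_(cyl 0 v)) = fine (P (cyl 0 v)).
  by rewrite /expect /Rintegral integral_indic ?setIT//; exact: measurable_cyl.
have -> : cyl 0 v = [set w | forall x, x \in zbox n -> eta 0 w x = ext v x].
  apply/seteqP; split => w /=.
    by move=> <- x; rewrite mem_zbox => xn; rewrite resK.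
  move=> wv; apply/ffunP => i; rewrite ffunE wv ?ext_in//.
  by rewrite mem_zbox; have := ltn_ord i; lia.
rewrite (init _ (zbox_uniq n)) /=.
rewrite (eq_bigr (fun=> 1 / 2)); last by move=> x _; case: ifP => // _; field.
rewrite big_const_seq count_predT size_zbox iter_mulr mulr1 card_ffun card_bool card_ord.
by rewrite natrX -exprVn mul1r.
Qed.

(** A local function of the configuration at time [r] is a combination of
    indicators of cylinders, and these belong to the history at time [s]. *)
Lemma markov_loc m n f g r s t : loc m f -> loc n g -> 0 <= r -> r <= s -> 0 <= t ->
  Ex (fun w => f (eta (s + t) w) * g (eta r w)) =
  Ex (fun w => S t f (eta s w) * g (eta r w)).
Proof.
move=> lf lg r0 rs t0; have s0 : 0 <= s by exact: le_trans rs.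
have [C fC] := loc_bounded lf.
have cf : continuous f by exact: (loc_continuous gS lf).
have bf : bounded_meas (fun w => f (eta (s + t) w)) by apply: (bm_loc lf); rewrite addr_ge0.
have bS : bounded_meas (fun w => S t f (eta s w)).
  apply: (@bm_continuous _ _ C) => //; first exact: semigroup_continuous fS _ _ t0 cf.
  exact: semigroup_bound fS _ _ _ t0 cf fC.
have e (X : Omega -> R) : bounded_meas X -> Ex (fun w => X w * g (eta r w)) =
    \sum_(v : box_conf n) g (ext v) * Ex (fun w => X w * \1_(cyl r v) w).
  move=> bX; have bXi (v : box_conf n) : bounded_meas (fun w => X w * \1_(cyl r v) w).
    by apply: bmM => //; apply: bm_indic; exact: measurable_cyl.
  rewrite (eq_bigr (fun v => Ex (fun w => g (ext v) * (X w * \1_(cyl r v) w))));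
    last by move=> v _; rewrite ExZ.
  rewrite -Ex_sum => [|v]; last exact: bmZ.
  congr (expect P); apply/funext => w; rewrite (loc_cyl _ _ lg) mulr_sumr.
  by apply: eq_bigr => v _; rewrite mulrCA.
rewrite !e//; apply: eq_bigr => v _; congr (_ * _).
have mc := measurable_cyl v r0.
rewrite !Ex_indic//; congr fine; apply: markov => //.
exact: history_cyl.
Qed.

(** The generator expands the semigroup uniformly over configurations, hence
    the error is uniform in [r] and [s]; this allows summation along a time
    grid. *)
Lemma markov_expand m n f g e : loc m f -> loc n g -> 0 < e ->
  forall C, (forall h, `|g h| <= C) -> exists2 D : R, 0 < D &
    forall t, 0 < t -> t < D -> forall r s, 0 <= r -> r <= s ->
    `|Ex (fun w => (f (eta (s + t) w) - f (eta s w) - t * L f (eta s w)) * g (eta r w))|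
      <= t * e * C.
Proof.
move=> lf lg e0 C gC; have [D D0 HD] := semigroup_expand gS lf e0.
exists D => // t t0 tD r s r0 rs; have s0 : 0 <= s by exact: le_trans rs.
have [Cf fC] := loc_bounded lf.
have cf : continuous f by exact: (loc_continuous gS lf).
have bg := bm_loc lg r0; have bfs := bm_loc lf s0.
have lL : loc m.+1 (L f) by exact: loc_exclusion_gen.
have bL := bm_loc lL s0.
have bf : bounded_meas (fun w => f (eta (s + t) w)).
  by apply: (bm_loc lf); rewrite addr_ge0// ltW.
have bS : bounded_meas (fun w => S t f (eta s w)).
  apply: (@bm_continuous _ _ Cf) => //; first exact: semigroup_continuous fS _ _ (ltW t0) cf.
  exact: semigroup_bound fS _ _ _ (ltW t0) cf fC.
have b1 : bounded_meas (fun w => (f (eta s w) + t * L f (eta s w)) * g (eta r w)).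
  by apply: bmM => //; apply: bmD => //; exact: bmZ.
have -> : Ex (fun w => (f (eta (s + t) w) - f (eta s w) - t * L f (eta s w)) * g (eta r w)) =
    Ex (fun w => (S t f (eta s w) - f (eta s w) - t * L f (eta s w)) * g (eta r w)).
  transitivity (Ex (fun w => f (eta (s + t) w) * g (eta r w) -
       (f (eta s w) + t * L f (eta s w)) * g (eta r w))).
    by congr (expect P); apply/funext => w; ring.
  rewrite ExB//; last exact: bmM.
  rewrite (markov_loc lf lg r0 rs (ltW t0)) -ExB//; last exact: bmM.
  by congr (expect P); apply/funext => w; ring.
apply: Ex_abs_le.
  by apply: bmM => //; apply: bmB; [exact: bmB|exact: bmZ].
move=> w; rewrite normrM ler_pM//; exact: HD.
Qed.

End process.

(** * Stationarity and martingales on a time grid *)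

Section real_lemmas.
Variable R : realType.
Implicit Types (a b s t h e : R) (k n : nat).

Lemma small_mesh t (D : R) : 0 <= t -> 0 < D ->
  exists n0, forall n, (n0 <= n)%N -> (0 < n)%N /\ t / n%:R < D.
Proof.
move=> t0 D0; exists (Num.truncn (t / D)).+1 => n n0.
have n1 : (0 < n)%N by exact: leq_trans n0.
split=> //; rewrite ltr_pdivrMr ?ltr0n// mulrC -ltr_pdivrMr//.
apply: lt_le_trans (_ : (Num.truncn (t / D)).+1%:R <= _); last by rewrite ler_nat.
by rewrite truncnS_gt.
Qed.

Lemma powD_lower s h k : 0 <= s -> 0 <= h ->
  s ^+ k.+1 + k.+1%:R * h * s ^+ k <= (s + h) ^+ k.+1.
Proof.
move=> s0 h0; elim: k => [|k IH]; first by rewrite !expr1 expr0 mulr1 mul1r.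
rewrite [leRHS]exprS; apply: le_trans (ler_wpM2l (addr_ge0 s0 h0) IH).
rewrite -subr_ge0 [X in 0 <= X](_ : _ = k.+1%:R * h ^+ 2 * s ^+ k).
  by rewrite !mulr_ge0 ?exprn_ge0.
by rewrite -[k.+2%:R]natr1 !exprS; ring.
Qed.

(** A function with generalized derivative [phi], in the uniform right-sided
    sense, is bounded by the primitive of any power bounding [phi]. *)
Lemma right_derivative_bound (psi phi : R -> R) (A : R) k :
  psi 0 = 0 -> 0 <= A ->
  (forall e, 0 < e -> exists2 D : R, 0 < D & forall h, 0 < h -> h < D ->
     forall s, 0 <= s -> `|psi (s + h) - psi s - h * phi s| <= h * e) ->
  (forall s, 0 <= s -> `|phi s| <= A * s ^+ k) ->
  forall t, 0 <= t -> `|psi t| <= A * t ^+ k.+1 / k.+1%:R.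
Proof.
move=> psi0 A0 der phiA t; rewrite le_eqVlt => /predU1P[<-|t0].
  by rewrite psi0 normr0 expr0n /= mulr0 mul0r.
apply/ler_addgt0Pr => e e0.
have [D D0 HD] := der (e / t) (divr_gt0 e0 t0).
have [n0 Hn] := small_mesh (ltW t0) D0; have [n1 nD] := Hn n0 (leqnn _).
set n := n0 in n1 nD; pose h := t / n%:R.
have h0 : 0 < h by rewrite divr_gt0// ltr0n.
have step j : `|psi (h * j%:R)| <= A * (h * j%:R) ^+ k.+1 / k.+1%:R + h * j%:R * (e / t).
  elim: j => [|j IH].
    by rewrite mulr0 psi0 normr0 expr0n/= mulr0 !mul0r addr0.
  set s := h * j%:R in IH *; have s0 : 0 <= s by rewrite mulr_ge0// ltW.
  have -> : h * j.+1%:R = s + h by rewrite -natr1 mulrDr mulr1.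
  have h1 := HD h h0 nD s s0; have h2 := phiA s s0.
  have -> : psi (s + h) = (psi (s + h) - psi s - h * phi s) + (psi s + h * phi s) by ring.
  apply: (le_trans (ler_normD _ _)).
  have h3 : `|psi s + h * phi s| <= `|psi s| + h * (A * s ^+ k).
    apply: (le_trans (ler_normD _ _)); rewrite lerD2l normrM gtr0_norm//.
    by rewrite ler_pM2l.
  have h4 : A * s ^+ k.+1 / k.+1%:R + h * (A * s ^+ k) <= A * (s + h) ^+ k.+1 / k.+1%:R.
    rewrite ler_pdivlMr ?ltr0n// mulrDl divfK ?pnatr_eq0//.
    apply: le_trans (ler_wpM2l A0 (powD_lower k s0 (ltW h0))).
    by rewrite mulrDr lerD2l le_eqVlt; apply/orP; left; apply/eqP; ring.
  apply: (le_trans (lerD h1 h3)); move: IH h4; rewrite mulrDl.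
  set X := A * (s + h) ^+ _ / _; set Y := A * s ^+ k.+1 / _.
  by set Z := h * (A * _); move=> IH h4; lra.
have := step n; rewrite /h divfK ?pnatr_eq0 -?lt0n//.
by rewrite [t * (e / t)]mulrC divfK ?gt_eqF.
Qed.

Lemma bin_le_exp2 n k : ('C(n, k) <= 2 ^ n)%N.
Proof.
elim: n k => [|n IH] [|k]; rewrite ?bin0 ?expn_gt0//.
by rewrite binS expnS mul2n -addnn leq_add.
Qed.

Lemma sum_sqr_le n (F : nat -> R) :
  (\sum_(j < n) F j) ^+ 2 <= n%:R * \sum_(j < n) F j ^+ 2.
Proof.
elim: n => [|[|n] IH]; first by rewrite !big_ord0 expr0n mulr0.
  by rewrite !big_ord_recr !big_ord0/= !add0r mul1r.
rewrite [in leLHS]big_ord_recr [in leRHS]big_ord_recr.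
set a := \big[_/_]_(j < _) F _ in IH *.
set b := \big[_/_]_(j < _) F _ ^+ 2 in IH *; rewrite /=; set x := F n.+1.
have h : 2 * a * x <= b + n.+1%:R * x ^+ 2.
  have n1 : 0 < n.+1%:R :> R by rewrite ltr0n.
  by rewrite -(ler_pM2l n1); have := sqr_ge0 (a - n.+1%:R * x); lra.
by rewrite -[n.+2%:R]natr1; lra.
Qed.

End real_lemmas.

Section process.
Variables (R : realType) (p q : R) (S : R -> (conf -> R) -> conf -> R).
Variables (d : measure_display) (Omega : measurableType d).
Variables (P : probability Omega R) (eta : R -> Omega -> conf).
Hypotheses (p0 : 0 <= p) (q0 : 0 <= q) (pq1 : p + q = 1).
Hypothesis fS : feller_semigroup S.
Hypothesis gS : forall f, local f -> generates S f (exclusion_gen p q f).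
Hypothesis meas : forall (t : R) x, 0 <= t -> measurable [set w | eta t w x].
Hypothesis markov : markov_process P S eta.
Hypothesis init : bernoulli_law P (1 / 2) (eta 0).
Implicit Types (f g u : conf -> R) (x y z : int) (m n : nat).
Implicit Types r s t e h C : R.
Local Notation L := (exclusion_gen p q).
Local Notation Ex := (expect P).

Let bml m f t : loc m f -> 0 <= t -> bounded_meas (fun w => f (eta t w)) := @bm_loc _ _ _ _ meas m f t.

Lemma mean_gen0 m f : loc m f -> Ex (fun w => L f (eta 0 w)) = 0.
Proof.
move=> lf; have lL : loc m.+2 (L f).
  by apply: locW (leqnSn _) _; exact: loc_exclusion_gen.
by rewrite (Ex_init meas init lL) (nu_gen0 _ _ lf).
Qed.

(** All derivatives at [s0] of [t |-> E f(eta t)] vanish since [L ^+ k f] is a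
    local function, and [L ^+ k f] grows like [k`!] times a geometric factor, as
    the number of bonds acting grows linearly with [k]. *)
Lemma taylor_bound s0 : 0 <= s0 ->
  (forall m f, loc m f -> Ex (fun w => f (eta s0 w)) = Ex (fun w => f (eta 0 w))) ->
  forall (k m : nat) f C t, loc m f -> (forall h : conf, `|f h| <= C) -> 0 <= t ->
  `|Ex (fun w => f (eta (s0 + t) w)) - Ex (fun w => f (eta 0 w))| <=
    2 * C * (8 * t) ^+ k * 'C(m.+1 + k, k)%:R.
Proof.
move=> s00 stat; elim=> [|k IH] m f C t lf fC t0.
  rewrite expr0 bin0 !mulr1; apply: (le_trans (ler_normB _ _)).
  have st : 0 <= s0 + t by exact: addr_ge0.
  have := Ex_abs_le P (bml lf st) (fun w => fC _).
  have := Ex_abs_le P (bml lf (lexx 0)) (fun w => fC _).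
  by lra.
have C0 : 0 <= C by exact: le_trans (fC (fun=> false)).
have lL : loc m.+1 (L f) by exact: loc_exclusion_gen.
have LC := exclusion_gen_bound p0 q0 pq1 lf fC.
pose psi t := Ex (fun w => f (eta (s0 + t) w)) - Ex (fun w => f (eta 0 w)).
pose phi t := Ex (fun w => L f (eta (s0 + t) w)).
pose A := 2 * (8 * m.+2%:R * C) * 8 ^+ k * 'C(m.+2 + k, k)%:R.
have := @right_derivative_bound _ psi phi A k _ _ _ _ t t0.
have -> : A * t ^+ k.+1 / k.+1%:R = 2 * C * (8 * t) ^+ k.+1 * 'C(m.+1 + k.+1, k.+1)%:R.
  have e : m.+2%:R * 'C(m.+2 + k, k)%:R = k.+1%:R * 'C(m.+2 + k, k.+1)%:R :> R.
    by rewrite -!natrM mul_bin_left addnK.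
  rewrite /A -addSnnS; apply: (@mulIf _ k.+1%:R); first by rewrite pnatr_eq0.
  rewrite divfK ?pnatr_eq0// exprMn.
  transitivity (2 * C * (8 ^+ k.+1 * t ^+ k.+1) * (m.+2%:R * 'C(m.+2 + k, k)%:R)).
    by rewrite !exprS; ring.
  by rewrite e; ring.
apply.
- by rewrite /psi addr0 (stat _ _ lf) subrr.
- by rewrite /A !mulr_ge0// exprn_ge0.
- move=> e e0.
  have n1 (h : conf) : `|1 : R| <= 1 by rewrite normr1.
  have [D D0 HD] := markov_expand fS gS meas markov lf (@loc_cst R 0 1) e0 n1.
  exists D => // h h0 hD s s1.
  have ss : 0 <= s0 + s by exact: addr_ge0.
  have := HD h h0 hD 0 (s0 + s) (lexx 0) ss.
  rewrite mulr1 /psi /phi; congr (`|_| <= _).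
  under [in LHS]eq_fun do rewrite mulr1.
  have b1 : bounded_meas (fun w => f (eta (s0 + s + h) w)) by apply: (bml lf); rewrite addr_ge0// ltW.
  have b2 := bml lf ss; have b3 := bml lL ss.
  rewrite ExB//; last exact: bmZ.
  - by rewrite ExB// ExZ// addrA; ring.
  - exact: bmB.
- move=> s s1; have := IH m.+1 (L f) _ s lL LC s1.
  rewrite (mean_gen0 lf) subr0 => /le_trans; apply.
  by rewrite /A exprMn le_eqVlt; apply/orP; left; apply/eqP; ring.
Qed.

(** For [t <= 1 / 32] the bound of [taylor_bound] decays geometrically in [k],
    the binomial coefficient growing no faster than [2 ^+ k]. *)
Lemma stationary_step s0 : 0 <= s0 ->
  (forall m f, loc m f -> Ex (fun w => f (eta s0 w)) = Ex (fun w => f (eta 0 w))) ->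
  forall m f t, loc m f -> 0 <= t -> t <= 32^-1 ->
  Ex (fun w => f (eta (s0 + t) w)) = Ex (fun w => f (eta 0 w)).
Proof.
move=> s00 stat m f t lf t0 t32; have [C fC] := loc_bounded lf.
have C0 : 0 <= C by exact: le_trans (fC (fun=> false)).
apply/eqP; rewrite -subr_eq0 -normr_le0; apply/ler_addgt0Pr => e e0; rewrite add0r.
pose K := 2 * C * 2 ^+ m.+1.
have K0 : 0 <= K by rewrite !mulr_ge0// exprn_ge0.
have bk k : `|Ex (fun w => f (eta (s0 + t) w)) - Ex (fun w => f (eta 0 w))| <= K * (1 / 2) ^+ k.
  apply: (le_trans (taylor_bound s00 stat k lf fC t0)).
  have b1 : 'C(m.+1 + k, k)%:R <= 2 ^+ m.+1 * 2 ^+ k :> R.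
    by rewrite -exprD -natrX ler_nat bin_le_exp2.
  have b2 : (8 * t) ^+ k <= (1 / 4) ^+ k.
    by apply: lerXn2r; rewrite ?nnegrE; lra.
  apply: (@le_trans _ _ (2 * C * (1 / 4) ^+ k * (2 ^+ m.+1 * 2 ^+ k))).
    apply: ler_pM => //; first by rewrite !mulr_ge0// exprn_ge0// mulr_ge0.
    by rewrite ler_wpM2l// mulr_ge0.
  have -> : 2 * C * (1 / 4) ^+ k * (2 ^+ m.+1 * 2 ^+ k) = K * ((1 / 4) ^+ k * 2 ^+ k).
    by rewrite /K; ring.
  by rewrite -exprMn (_ : 1 / 4 * 2 = 1 / 2)//; field.
have [k hk] : exists k : nat, K * (1 / 2) ^+ k <= e.
  have [n0 /(_ n0 (leqnn _))[n1 nK]] := small_mesh K0 e0.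
  exists n0; apply: le_trans (ltW nK); rewrite ler_wpM2l//.
  rewrite div1r exprVn lef_pV2 ?posrE ?ltr0n ?exprn_gt0//.
  by rewrite -natrX ler_nat ltnW// ltn_expl.
exact: le_trans (bk k) hk.
Qed.

Lemma stationary m f t : loc m f -> 0 <= t ->
  Ex (fun w => f (eta t w)) = Ex (fun w => f (eta 0 w)).
Proof.
move=> lf t0.
have H n : forall m f t, loc m f -> 0 <= t -> t <= n%:R * 32^-1 ->
    Ex (fun w => f (eta t w)) = Ex (fun w => f (eta 0 w)).
  elim: n => [|n IH] m' f' s lf' s0 sn.
    by have -> : s = 0 by apply/eqP; rewrite eq_le s0 andbT; lra.
  have [sn'|sn'] := leP s (n%:R * 32^-1); first exact: (IH m').
  have a0 : 0 <= n%:R * 32^-1 :> R by rewrite mulr_ge0// invr_ge0.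
  have -> : s = n%:R * 32^-1 + (s - n%:R * 32^-1) by ring.
  apply: (stationary_step a0 _ lf').
  - by move=> m2 f2 lf2; apply: (IH m2).
  - by lra.
  - by rewrite -natr1 in sn; lra.
apply: (H (Num.truncn (t * 32)).+1 m) => //.
by rewrite ler_pdivlMr// ltW// truncnS_gt.
Qed.

Lemma Ex_nu n f t : loc n f -> 0 <= t -> Ex (fun w => f (eta t w)) = nu n f.
Proof. by move=> lf t0; rewrite (stationary lf t0) (Ex_init meas init lf). Qed.

Section martingale.
Variables (m : nat) (u : conf -> R).
Hypothesis lu : loc m u.

(** The Dynkin martingale of [u] along the times [h, 2 h, ...], with the time
    integral replaced by a Riemann sum. The grid starts at [h] rather than 0,
    to fit the right-endpoint sums of [path_sum]. *)
Definition mart (h : R) (j : nat) (w : Omega) : R :=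
  u (eta (h * j.+1%:R) w) - u (eta (h * 1%:R) w)
  - \sum_(i < j) h * L u (eta (h * i.+1%:R) w).

Let incr (h : R) j w := u (eta (h * j.+1%:R + h) w) - u (eta (h * j.+1%:R) w)
   - h * L u (eta (h * j.+1%:R) w).

Lemma martS h j w : mart h j.+1 w = mart h j w + incr h j w.
Proof.
rewrite /mart /incr big_ord_recr/= (_ : h * j.+2%:R = h * j.+1%:R + h); first ring.
by rewrite -[j.+2]addn1 natrD mulrDr mulr1.
Qed.

(** The increments are almost orthogonal to the past, and their total variance
    is the one predicted by the Dirichlet form [D u = - nu (u * L u)]. *)
Lemma martingale_bound (T e : R) : 0 < T -> 0 < e ->
  exists2 D : R, 0 < D & forall h, 0 < h -> h < D -> forall n, h * n%:R <= T ->
  Ex (fun w => mart h n w ^+ 2) <=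
    h * n%:R * (2 * - nu m.+2 (fun k => u k * L u k)) + e.
Proof.
move=> T0 e0.
have lL : loc m.+1 (L u) by exact: loc_exclusion_gen.
have [Cu uC] := loc_bounded lu; have [CL LC] := loc_bounded lL.
have Cu0 : 0 <= Cu by exact: le_trans (uC (fun=> false)).
have CL0 : 0 <= CL by exact: le_trans (LC (fun=> false)).
pose K := 2 * (3 * Cu + (T + 1) * CL).
have K0 : 0 <= K by rewrite /K mulr_ge0// addr_ge0// mulr_ge0// addr_ge0// ltW.
pose e' := e / (T * (K + 1)).
have K1 : 0 < K + 1 by lra.
have e'0 : 0 < e' by rewrite divr_gt0// mulr_gt0.
have [D1 D10 H1] := markov_expand fS gS meas markov lu lu e'0 uC.
have [D2 D20 H2] := markov_expand fS gS meas markov lu lL e'0 LC.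
exists (Num.min 1 (Num.min D1 D2)); first by rewrite !lt_min ltr01 D10.
move=> h h0; rewrite !lt_min => /and3P[h1 hD1 hD2] n nT.
pose Du := - nu m.+2 (fun k => u k * L u k).
pose tau (j : nat) := h * j.+1%:R.
have tau0 j : 0 <= tau j by rewrite mulr_ge0// ltW.
have tauh0 j : 0 <= tau j + h by rewrite addr_ge0// ltW.
have bU j := bml lu (tau0 j); have bL j := bml lL (tau0 j).
have bU' j := bml lu (tauh0 j).
have bI j : bounded_meas (incr h j).
  by apply: bmB; [apply: bmB; [exact: bU'|exact: bU]|apply: bmZ; exact: bL].
have bMt j : bounded_meas (mart h j).
  apply: bmB; [apply: bmB; [exact: bU|exact: (bU 0%N)]|].
  by apply: bm_sum => i; apply: bmZ; exact: bL.
have past (X : Omega -> R) j i : (i <= j)%N -> tau i <= tau j.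
  by move=> ij; rewrite /tau ler_pM2l// ler_nat.
have EU i j : (i <= j)%N -> `|Ex (fun w => incr h j w * u (eta (tau i) w))| <= h * e' * Cu.
  by move=> ij; apply: (H1 h h0 hD1 (tau i) (tau j)) => //; exact: past.
have EL i j : (i <= j)%N -> `|Ex (fun w => incr h j w * L u (eta (tau i) w))| <= h * e' * CL.
  by move=> ij; apply: (H2 h h0 hD2 (tau i) (tau j)) => //; exact: past.
have cross j : h * j%:R <= T ->
    `|Ex (fun w => incr h j w * mart h j w)| <= h * e' * (2 * Cu + T * CL).
  move=> jT.
  have -> : Ex (fun w => incr h j w * mart h j w) =
     Ex (fun w => incr h j w * u (eta (tau j) w)) -
     Ex (fun w => incr h j w * u (eta (tau 0%N) w)) -
     \sum_(i < j) h * Ex (fun w => incr h j w * L u (eta (tau i) w)).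
    rewrite (eq_bigr (fun i : 'I_j => Ex (fun w => h * (incr h j w * L u (eta (tau i) w)))));
      last by move=> i _; rewrite ExZ//; apply: bmM; [exact: bI|exact: bL].
    have bs i : bounded_meas (fun w => h * (incr h j w * L u (eta (tau i) w))).
      by apply: bmZ; apply: bmM; [exact: bI|exact: bL].
    have b1 i : bounded_meas (fun w => incr h j w * u (eta (tau i) w)).
      by apply: bmM; [exact: bI|exact: bU].
    rewrite -Ex_sum => [|i]; last exact: bs.
    have bsum : bounded_meas (fun w => \sum_(i < j) h * (incr h j w * L u (eta (tau i) w))).
      by apply: bm_sum => i; exact: bs.
    rewrite -(ExB P (b1 j) (b1 0%N)) -(ExB P (bmB (b1 j) (b1 0%N)) bsum).
    congr (expect P); apply/funext => w; rewrite /mart mulrBr mulrBr mulr_sumr.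
    by congr (_ - _); apply: eq_bigr => i _; rewrite mulrCA.
  apply: (le_trans (ler_normB _ _)).
  have s1 : `|\sum_(i < j) h * Ex (fun w => incr h j w * L u (eta (tau i) w))| <=
      T * (h * e' * CL).
    apply: (le_trans (ler_norm_sum _ _ _)).
    apply: (@le_trans _ _ (\sum_(i < j) h * (h * e' * CL))).
      apply: ler_sum => i _; rewrite normrM gtr0_norm// ler_pM2l//.
      by apply: EL; exact: ltnW.
    rewrite sumr_const card_ord -mulrnAl -[h *+ j]mulr_natr ler_wpM2r//.
    by apply: mulr_ge0 => //; apply: mulr_ge0; exact: ltW.
  have := ler_normB (Ex (fun w => incr h j w * u (eta (tau j) w)))
    (Ex (fun w => incr h j w * u (eta (tau 0%N) w))).
  have := EU j j (leqnn j); have := EU 0%N j (leq0n j).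
  by lra.
have var j : Ex (fun w => incr h j w ^+ 2) <= 2 * h * Du + 2 * h * e' * (Cu + CL).
  have lu2 : loc m (fun k => u k ^+ 2) by exact: locX.
  have luL : loc m.+2 (fun k => u k * L u k).
    by apply: locM; [exact: (locW (leqW (leqnSn m)) lu)|exact: (locW (leqnSn _) lL)].
  pose b1 := bmX 2 (bU' j); pose b2 := bmX 2 (bU j).
  have b3 : bounded_meas (fun w => incr h j w * u (eta (tau j) w)) by exact: bmM.
  have b4 : bounded_meas (fun w => u (eta (tau j) w) * L u (eta (tau j) w)) by exact: bmM.
  have b5 : bounded_meas (fun w => incr h j w * L u (eta (tau j) w)) by exact: bmM.
  apply: (@le_trans _ _ (Ex (fun w => u (eta (tau j + h) w) ^+ 2 - u (eta (tau j) w) ^+ 2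
     + (- 2 * (incr h j w * u (eta (tau j) w)) + (- 2 * h * (u (eta (tau j) w) * L u (eta (tau j) w))
     + (- 2 * h * (incr h j w * L u (eta (tau j) w)))))))).
    apply: Ex_le; [exact: bmX| |].
      by apply: bmD; [exact: bmB|apply: bmD; [exact: bmZ|apply: bmD; exact: bmZ]].
    move=> w; rewrite /incr -/(tau j) -subr_ge0.
    set a := u _; set b := u _; set c := L u _.
    rewrite [X in 0 <= X](_ : _ = (h * c) ^+ 2) ?sqr_ge0//; ring.
  have bA := bmB b1 b2; have bB := bmZ (-2) b3.
  have bC := bmZ (-2 * h) b4; have bD := bmZ (-2 * h) b5.
  rewrite (ExD P bA (bmD bB (bmD bC bD))) (ExD P bB (bmD bC bD)) (ExD P bC bD).
  rewrite (ExB P b1 b2) !ExZ// (Ex_nu lu2 (tauh0 j)) (Ex_nu lu2 (tau0 j)).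
  rewrite (Ex_nu luL (tau0 j)) subrr add0r.
  have := EU j j (leqnn j); have := EL j j (leqnn j).
  rewrite !ler_norml => /andP[l1 l2] /andP[l3 l4].
  (* the minimum with 1 in the bound on [h] is for this step *)
have h2 : h * (h * e' * CL) <= h * e' * CL.
    apply: ler_piMl; last exact: ltW.
    by apply: mulr_ge0 => //; apply: mulr_ge0; exact: ltW.
  have h3 : h * - (h * e' * CL) <= h * Ex (fun w => incr h j w * L u (eta (tau j) w)).
    by rewrite ler_pM2l.
  by rewrite /Du; lra.
have ind j : h * j%:R <= T ->
    Ex (fun w => mart h j w ^+ 2) <= h * j%:R * (2 * Du) + h * j%:R * (e' * K).
  elim: j => [|j IH] jT.
    rewrite mulr0 !mul0r addr0 (_ : (fun w => _) = fun=> 0) ?Ex_cst//.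
    by apply/funext => w; rewrite /mart big_ord0 subrr subr0 expr0n.
  have jT' : h * j%:R <= T by apply: le_trans jT; rewrite ler_pM2l// ler_nat.
  have -> : Ex (fun w => mart h j.+1 w ^+ 2) =
     Ex (fun w => mart h j w ^+ 2) + (2 * Ex (fun w => incr h j w * mart h j w)
       + Ex (fun w => incr h j w ^+ 2)).
    have b1 := bmX 2 (bMt j); have b2 := bmM (bI j) (bMt j); have b3 := bmX 2 (bI j).
    rewrite -(ExZ P 2 b2) -(ExD P (bmZ 2 b2) b3) -(ExD P b1 (bmD (bmZ 2 b2) b3)).
    congr (expect P); apply/funext => w; rewrite martS; ring.
  have := IH jT'; have := var j; have := cross j jT'.
  rewrite ler_norml => /andP[_]; rewrite -[j.+1%:R]natr1 (mulrDr h) mulr1 /K; lra.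
apply: (le_trans (ind n nT)); rewrite lerD2l.
apply: (@le_trans _ _ (T * (e' * K))); first by rewrite ler_wpM2r// mulr_ge0// ltW.
apply: (@le_trans _ _ (T * (e' * (K + 1)))); first by rewrite !ler_pM2l//; lra.
by rewrite /e' le_eqVlt; apply/orP; left; apply/eqP; field; rewrite !gt_eqF.
Qed.

End martingale.

End process.

(** * Time integrals of gradients *)

Lemma sqr_le_norm (R : realType) (x a : R) : `|x| <= a -> x ^+ 2 <= a ^+ 2.
Proof.
move=> xa; rewrite -real_normK ?num_real// lerXn2r ?nnegrE//.
exact: le_trans xa.
Qed.

Section kipnis_varadhan.
Variables (R : realType) (p q : R) (S : R -> (conf -> R) -> conf -> R).
Variables (d : measure_display) (Omega : measurableType d).
Variables (P : probability Omega R) (eta : R -> Omega -> conf).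
Hypotheses (p0 : 0 <= p) (q0 : 0 <= q) (pq1 : p + q = 1).
Hypothesis fS : feller_semigroup S.
Hypothesis gS : forall f, local f -> generates S f (exclusion_gen p q f).
Hypothesis meas : forall (t : R) x, 0 <= t -> measurable [set w | eta t w x].
Hypothesis markov : markov_process P S eta.
Hypothesis init : bernoulli_law P (1 / 2) (eta 0).
Implicit Types (f g u : conf -> R) (x y z : int) (m n : nat).
Local Notation L := (exclusion_gen p q).
Local Notation Ex := (expect P).
Local Notation xi := (xi R).

Let bml m f (t : R) : loc m f -> 0 <= t -> bounded_meas (fun w => f (eta t w)) :=
  @bm_loc _ _ _ _ meas m f t.

Variables (kap t : R).
Hypotheses (kap0 : 0 < kap) (t0 : 0 < t).

(** Riemann sums, at right endpoints, for the process speeded up by [1 / kap].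
    They replace time integrals in the martingale argument, so that it
    involves finitely many times. *)
Definition path_sum n f (w : Omega) : R :=
  \sum_(j < n) t / n%:R * f (eta (t / n%:R * j.+1%:R / kap) w).

Let tau0 n (j : nat) : 0 <= t / n%:R * j.+1%:R / kap.
Proof. by rewrite divr_ge0 ?mulr_ge0 ?ler0n ?invr_ge0// ltW. Qed.

Lemma bm_rsum m n f : loc m f -> bounded_meas (path_sum n f).
Proof. by move=> lf; apply: bm_sum => j; apply: bmZ; exact: (bml lf (tau0 n j)). Qed.

Lemma rsum_norm n f (C : R) w : (forall h, `|f h| <= C) -> `|path_sum n f w| <= t * C.
Proof.
move=> fC; have C0 : 0 <= C by exact: le_trans (fC (fun=> false)).
apply: (le_trans (ler_norm_sum _ _ _)).
apply: (@le_trans _ _ (\sum_(j < n) t / n%:R * C)).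
  have tn : 0 <= t / n%:R by rewrite divr_ge0// ltW.
  by apply: ler_sum => j _; rewrite normrM ger0_norm// ler_wpM2l.
rewrite sumr_const card_ord -mulrnAl -[_ *+ n]mulr_natr.
have [->|n0] := eqVneq n 0%N; first by rewrite mulr0 mul0r mulr_ge0// ltW.
by rewrite divfK// pnatr_eq0.
Qed.

(** Cauchy-Schwarz in time, then stationarity. *)
Lemma rsum_sqr_le m n f : loc m f -> (0 < n)%N ->
  Ex (fun w => path_sum n f w ^+ 2) <= t ^+ 2 * nu m (fun h => f h ^+ 2).
Proof.
move=> lf n0; have n00 : n%:R != 0 :> R by rewrite pnatr_eq0 -lt0n.
have lf2 : loc m (fun h => f h ^+ 2) by exact: locX.
pose F j w := t / n%:R * f (eta (t / n%:R * j.+1%:R / kap) w).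
have bF j : bounded_meas (fun w => F j w ^+ 2).
  by apply: bmX; apply: bmZ; exact: (bml lf (tau0 n j)).
have bS : bounded_meas (fun w => \sum_(j < n) F j w ^+ 2) by apply: bm_sum => j.
apply: (@le_trans _ _ (Ex (fun w => n%:R * \sum_(j < n) F j w ^+ 2))).
  apply: Ex_le; [exact: (bmX 2 (bm_rsum n lf))|exact: bmZ|].
  by move=> w; exact: (sum_sqr_le n (F^~ w)).
rewrite ExZ// Ex_sum => [|j]; last exact: bF.
have e (j : 'I_n) : Ex (fun w => F j w ^+ 2) = (t / n%:R) ^+ 2 * nu m (fun h => f h ^+ 2).
  rewrite -(Ex_nu p0 q0 pq1 fS gS meas markov init lf2 (tau0 n j)) -ExZ.
    by congr (expect P); apply/funext => w; rewrite exprMn.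
  exact: (bml lf2 (tau0 n j)).
rewrite (eq_bigr _ (fun j _ => e j)) sumr_const card_ord -[_ *+ n]mulr_natl.
by rewrite le_eqVlt; apply/orP; left; apply/eqP; field.
Qed.

(** [resolvent_decomp] gives [f = u - L u / kap + r]. Along the speeded up
    process [L u / kap] integrates to the increment of [u] minus a martingale
    whose variance is proportional to the Dirichlet form of [u]; all these
    terms have second moments of order [kap] times the squared norm of [b]. *)
Lemma kv_gradient m (b : int -> int -> R) (zeta : R) : 0 < zeta ->
  let f h := \sum_(z <- zbox m)
    (\sum_(x <- zbox m | x < z) b x z * xi h x) * (xi h z - xi h (z + 1)) in
  exists n0, forall n, (n0 <= n)%N ->
  Ex (fun w => path_sum n f w ^+ 2) <=
    10 * (t ^+ 2 + 2 * t + 2) * kap *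
      \sum_(z <- zbox m) \sum_(x <- zbox m | x < z) b x z ^+ 2 + zeta.
Proof.
move=> zeta0 f; set B := \sum_(z <- _) _.
pose c := t ^+ 2 + 2 * t + 2.
have c0 : 0 < c by rewrite /c ltr_wpDl// addr_ge0 ?sqr_ge0// mulr_ge0// ltW.
pose e : R := Num.min 1 (zeta / (20 * c)).
have e0 : 0 < e by rewrite lt_min ltr01 divr_gt0// mulr_gt0.
have e1 : e <= 1 by rewrite ge_min lexx.
have ec : e * (20 * c) <= zeta.
  by rewrite -ler_pdivlMr ?mulr_gt0// ge_min lexx orbT.
have [M [u [r [mM [lu lr] fE rE energy]]]] := resolvent_decomp p0 q0 pq1 m b kap0 e0.
have {}fE h : f h = u h - kap^-1 * L u h + r h := fE h.
rewrite -/B in energy.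
have lL : loc M.+1 (L u) by exact: loc_exclusion_gen.
have tk : 0 < t / kap by exact: divr_gt0.
have z10 : 0 < zeta / 10 by exact: divr_gt0.
have [D D0 HD] := martingale_bound p0 q0 pq1 fS gS meas markov init lu tk z10.
have [n0 Hn] := small_mesh (ltW tk) D0; exists n0 => n n0n.
have [n1 nD] := Hn n n0n; have n00 : n%:R != 0 :> R by rewrite pnatr_eq0 -lt0n.
have kap00 : kap != 0 by rewrite gt_eqF.
pose h := t / kap / n%:R; have h0 : 0 < h by rewrite divr_gt0// ltr0n.
have tauE (j : nat) : t / n%:R * j.+1%:R / kap = h * j.+1%:R.
  by rewrite /h; field; rewrite n00.
have hn : h * n%:R = t / kap by rewrite /h divfK.
have Zb := HD h h0 nD n; rewrite hn in Zb; have {}Zb := Zb (lexx _).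
set Du := - nu _ _ in Zb.
have := energy M.+2 (leqnn _); set V := nu M.+2 (fun k => u k ^+ 2).
rewrite -mulNr -/Du => {}energy.
have Du0 : 0 <= Du.
  rewrite /Du (dirichlet_form pq1 lu (leqnn _)) mulr_ge0//.
  by apply: sumr_ge0 => x _; apply: nu_ge0 => k; exact: sqr_ge0.
have lu2 : loc M.+2 (fun k => u k ^+ 2).
  by apply: locX; exact: (locW (leqW (leqnSn M)) lu).
pose N1 := n%:R : R.
have tn0 (j : nat) : 0 <= h * j.+1%:R by rewrite mulr_ge0// ltW.
have bU (j : nat) : bounded_meas (fun w => u (eta (h * j.+1%:R) w)) := bml lu (tn0 j).
have EU (j : nat) : Ex (fun w => u (eta (h * j.+1%:R) w) ^+ 2) = V.
  exact: (Ex_nu p0 q0 pq1 fS gS meas markov init lu2 (tn0 j)).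
have bZ : bounded_meas (mart p q eta u h n).
  apply: bmB; [apply: bmB; [exact: bU|exact: (bU 0%N)]|].
  by apply: bm_sum => i; apply: bmZ; exact: (bml lL (tn0 i)).
have fsum w : path_sum n f w = path_sum n u w + mart p q eta u h n w
    - u (eta (h * n.+1%:R) w) + u (eta (h * 1%:R) w) + path_sum n r w.
  rewrite /mart /path_sum.
  rewrite (eq_bigr (fun j : 'I_n => t / n%:R * u (eta (t / n%:R * j.+1%:R / kap) w)
     + (- (h * L u (eta (h * j.+1%:R) w))
     + t / n%:R * r (eta (t / n%:R * j.+1%:R / kap) w)))); last first.
    move=> j _; rewrite fE !tauE.
    have -> : h = t / n%:R * kap^-1 by rewrite /h; field; rewrite n00 kap00.
    by ring.
  rewrite big_split big_split/= sumrN; ring.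
have E1 : Ex (fun w => path_sum n u w ^+ 2) <= t ^+ 2 * V.
  apply: (le_trans (rsum_sqr_le (locW (leqW (leqnSn M)) lu) n1)).
  by rewrite /V.
have bf : bounded_meas (path_sum n f).
  have b1 := bmD (bm_rsum n lu) bZ; have b2 := bmB b1 (bU n).
  have := bmD (bmD b2 (bU 0%N)) (bm_rsum n lr).
  by congr bounded_meas; apply/funext => w; rewrite fsum.
(* the square of a sum of five terms is at most 5 times the sum of the squares *)
pose Q w := 5 * (path_sum n u w ^+ 2 + (mart p q eta u h n w ^+ 2
    + (u (eta (h * n.+1%:R) w) ^+ 2 + (u (eta (h * 1%:R) w) ^+ 2 + (t * e) ^+ 2)))).
have b1 := bmX 2 (bm_rsum n lu); have b2 := bmX 2 bZ.
have b3 := bmX 2 (bU n); have b4 := bmX 2 (bU 0%N).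
have b5 := bm_cst Omega ((t * e) ^+ 2).
have b45 := bmD b4 b5; have b345 := bmD b3 b45; have b25 := bmD b2 b345.
have b15 := bmD b1 b25.
apply: (@le_trans _ _ (Ex Q)).
  apply: Ex_le; [exact: bmX|exact: bmZ|] => w.
  rewrite /Q fsum.
  have : path_sum n r w ^+ 2 <= (t * e) ^+ 2.
    by apply: sqr_le_norm; exact: rsum_norm.
  set a := path_sum n u w; set z := mart _ _ _ _ _ _ w; set u1 := u _; set u0 := u _.
  set rr := path_sum n r w => rre.
  have := sqr_ge0 (a - z); have := sqr_ge0 (a + u1); have := sqr_ge0 (a - u0).
  have := sqr_ge0 (a - rr); have := sqr_ge0 (z + u1); have := sqr_ge0 (z - u0).
  have := sqr_ge0 (z - rr); have := sqr_ge0 (u1 + u0); have := sqr_ge0 (u1 + rr).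
  have := sqr_ge0 (u0 - rr); move: rre; clear; lra.
rewrite /Q (ExZ P 5 b15) (ExD P b1 b25) (ExD P b2 b345) (ExD P b3 b45) (ExD P b4 b5).
rewrite (Ex_cst P) EU (EU 0%N).
have V0 : 0 <= V by apply: nu_ge0 => k; exact: sqr_ge0.
have Dk0 : 0 <= Du / kap by rewrite divr_ge0// ltW.
have Ee : e ^+ 2 <= e by rewrite expr2 ger_pMl.
have te : t ^+ 2 * e ^+ 2 <= t ^+ 2 * e by rewrite ler_wpM2l// sqr_ge0.
have key : t ^+ 2 * V + 2 * (t * (Du / kap)) + 2 * V <= c * (V + Du / kap).
  rewrite /c; have := sqr_ge0 t; have := mulr_ge0 (sqr_ge0 t) Dk0.
  have := mulr_ge0 (ltW t0) V0; lra.
have key2 : c * (V + Du / kap) <= c * (2 * kap * B + e).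
  by rewrite ler_pM2l//; apply: le_trans energy _; lra.
have tc : t ^+ 2 * e <= c * e by rewrite ler_pM2r// /c; have := t0; lra.
have Zb' : Ex (fun w => mart p q eta u h n w ^+ 2) <= 2 * (t * (Du / kap)) + zeta / 10.
  by apply: le_trans Zb _; rewrite le_eqVlt; apply/orP; left; apply/eqP; field.
rewrite exprMn -/c; move: E1 Zb' key key2 te tc ec; clear.
set X1 := Ex _; set X2 := Ex _; set Y := Du / kap.
lra.
Qed.

End kipnis_varadhan.

(** * Limits of real integrals *)

Section convergence.
Variables (R : realType) (d : measure_display) (T : measurableType d).
Variables (mu : {measure set T -> \bar R}) (D : set T).
Hypothesis mD : measurable D.
Implicit Types (f g : T -> R).

Lemma dominated_Rintegral (F : nat -> T -> R) f g :
  (forall n, measurable_fun D (F n)) ->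
  (forall x, D x -> F n x @[n --> \oo] --> f x) ->
  mu.-integrable D (EFin \o g) ->
  (forall n x, D x -> `|F n x| <= g x) ->
  mu.-integrable D (EFin \o f) /\
  (\int[mu]_(x in D) F n x) @[n --> \oo] --> \int[mu]_(x in D) f x.
Proof.
move=> mF Ff ig Fg.
have mf : measurable_fun D f by exact: measurable_fun_cvg mF Ff.
have [] := @dominated_convergence _ _ _ mu D mD (fun n x => (F n x)%:E)
  (EFin \o f) (EFin \o g).
- by move=> n; apply/measurable_EFinP.
- exact/measurable_EFinP.
- apply: aeW => x Dx; apply: cvg_EFin; first exact: nearW.
  exact: Ff.
- exact: ig.
- by apply: aeW => x n Dx; rewrite lee_fin Fg.
move=> intf _ cv; split => //; rewrite /Rintegral; apply: fine_cvg.
by rewrite fineK//; exact: integrable_fin_num.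
Qed.

Hypothesis muD : (mu D < +oo)%E.

Lemma bounded_integrable f C : measurable_fun D f -> (forall x, D x -> `|f x| <= C) ->
  mu.-integrable D (EFin \o f).
Proof.
move=> mf fC; apply: measurable_bounded_integrable => //.
exists C; split; first exact: num_real.
by move=> M CM x Dx; apply: le_trans (ltW CM); exact: fC.
Qed.

Lemma bounded_Rintegral (F : nat -> T -> R) f C :
  (forall n, measurable_fun D (F n)) ->
  (forall x, D x -> F n x @[n --> \oo] --> f x) ->
  (forall n x, D x -> `|F n x| <= C) ->
  (\int[mu]_(x in D) F n x) @[n --> \oo] --> \int[mu]_(x in D) f x.
Proof.
move=> mF Ff FC; have [] := @dominated_Rintegral F f (fun=> C) mF Ff _ FC => //.
by apply: (bounded_integrable (C := `|C|)).
Qed.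

End convergence.

Lemma Rintegral_sum (R : realType) (d : measure_display) (T : measurableType d)
    (mu : {measure set T -> \bar R}) (D : set T) (I : Type) (s : seq I)
    (F : I -> T -> R) : measurable D ->
  (forall i, mu.-integrable D (EFin \o F i)) ->
  mu.-integrable D (EFin \o (fun x => \sum_(i <- s) F i x)) /\
  \int[mu]_(x in D) (\sum_(i <- s) F i x) = \sum_(i <- s) \int[mu]_(x in D) F i x.
Proof.
move=> mD iF; elim: s => [|i s [IH1 IH2]].
  rewrite big_nil; split.
    by under eq_fun do rewrite big_nil; exact: integrable0.
  by under eq_Rintegral do rewrite big_nil; rewrite Rintegral_cst// mul0r.
split.
  under eq_fun do rewrite big_cons.
  exact: (integrableD mD (iF i) IH1).
under eq_Rintegral do rewrite big_cons.
by rewrite RintegralD// IH2 big_cons.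
Qed.

Section riemann.
Variable R : realType.
Local Notation mu := (@lebesgue_measure R).

(** Right-endpoint Riemann sums of a right-continuous function are integrals
    of step functions converging pointwise. *)
Lemma riemann_sum_cvg (t C : R) (g : R -> R) : 0 < t ->
  (forall s, 0 <= s -> g r @[r --> s^'+] --> g s) -> (forall s, `|g s| <= C) ->
  measurable_fun `[0, t]%classic g /\
  (\sum_(j < n) t / n%:R * g (t / n%:R * j.+1%:R)) @[n --> \oo] -->
    \int[mu]_(s in `[0, t]) g s.
Proof.
move=> t0 cg gC.
pose bin (n j : nat) := `[t / n%:R * j%:R, t / n%:R * j.+1%:R[%classic : set R.
pose G n s := \sum_(j < n) g (t / n%:R * j.+1%:R) * \1_(bin n j) s.
pose D := `[0, t[%classic : set R.
have mD : measurable D by exact: measurable_itv.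
have mbin n j : measurable (bin n j) by exact: measurable_itv.
have Gval n s : (0 < n)%N -> D s -> exists j, [/\ (j < n)%N, G n s = g (t / n%:R * j.+1%:R),
    s < t / n%:R * j.+1%:R & t / n%:R * j.+1%:R <= s + t / n%:R].
  move=> n0; rewrite /D /= in_itv/= => /andP[s0 st].
  have h0 : 0 < t / n%:R by rewrite divr_gt0// ltr0n.
  pose j := Num.truncn (s / (t / n%:R)).
  have /andP[j1 j2] : j%:R <= s / (t / n%:R) < j.+1%:R.
    by apply: truncn_itv; rewrite divr_ge0// ltW.
  have j1' : t / n%:R * j%:R <= s by rewrite mulrC -ler_pdivlMr.
  have j2' : s < t / n%:R * j.+1%:R by rewrite mulrC -ltr_pdivrMr.
  have jn : (j < n)%N.
    rewrite -(ltr_nat R) (le_lt_trans j1)// invf_div mulrA ltr_pdivrMr//.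
    by rewrite [_ * t]mulrC ltr_pM2r// ltr0n.
  exists j; split => //; last first.
    by rewrite -natr1 mulrDr mulr1 lerD2r.
  rewrite /G (bigD1 (Ordinal jn))//= [X in _ + X]big1 ?addr0.
    rewrite indicE mem_set ?mulr1//= /bin /= in_itv/=.
    by apply/andP.
  move=> i ij; rewrite indicE memNset ?mulr0//= /bin/= in_itv/= => /andP[i1 i2].
  move/eqP: ij; apply; apply/val_inj => /=; apply/esym; apply: truncn_def.
  by rewrite ler_pdivlMr// mulrC i1/= ltr_pdivrMr// mulrC.
have mG n : measurable_fun setT (G n).
  apply: measurable_sum => j; apply: measurable_funM => //.
have GC n s : D s -> `|G n s| <= C.
  have C0 : 0 <= C by exact: le_trans (gC 0).
  case: n => [|n] Ds; first by rewrite /G big_ord0 normr0.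
  by have [j [_ -> _ _]] := Gval n.+1 s isT Ds.
have Gg s : D s -> G n s @[n --> \oo] --> g s.
  move=> Ds; have s0 : 0 <= s by move: Ds; rewrite /D/= in_itv/= => /andP[].
  apply/cvgrPdist_lt => e e0.
  have /cvgrPdist_lt/(_ _ e0) [del /= del0 Hdel] := cg s s0.
  have [n0 Hn] := small_mesh (ltW t0) del0.
  exists n0 => // n /= n0n; have [n1 nd] := Hn n n0n.
  have [j [_ -> sj js]] := Gval n s n1 Ds.
  apply: Hdel => //=; rewrite distrC gtr0_norm ?subr_gt0//; lra.
have muD : (mu D < +oo)%E.
  by rewrite /D lebesgue_measure_itv /= lte_fin t0 -EFinD ltry.
have mg : measurable_fun D g.
  by apply: measurable_fun_cvg Gg => n; exact: measurable_funTS.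
have mGD n : measurable_fun D (G n) by exact: measurable_funTS.
have cv : (\int[mu]_(s in D) G n s) @[n --> \oo] --> \int[mu]_(s in D) g s.
  by apply: (@bounded_Rintegral R _ _ mu D _ _ G g C); [exact: mD|exact: muD|exact: mGD|exact: Gg|exact: GC].
have bint (f : R -> R) (c : R) : measurable_fun D f -> (forall x, `|f x| <= c) ->
    mu.-integrable D (EFin \o f).
  by move=> mf fc; apply: (@bounded_integrable R _ _ mu D _ _ f c);
    [exact: mD|exact: muD|exact: mf|].
have intg : mu.-integrable D (EFin \o g) by apply: (bint _ C).
split; first by apply/(measurable_fun_itv_bndo_bndcP _ _ _).
rewrite -Rintegral_itv_bndo_bndc//; move: cv; apply: cvg_trans.
apply: near_eq_cvg; exists 1%N => // n /= n0.
rewrite /G; have [|_ ->] := @Rintegral_sum _ _ _ mu D _ (index_enum 'I_n)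
    (fun j s => g (t / n%:R * j.+1%:R) * \1_(bin n j) s) mD.
  move=> j; apply: (bint _ C).
    by apply: measurable_funM; [exact: measurable_cst|apply: measurable_indic; exact: mbin].
  move=> x; rewrite indicE; case: (_ \in _); rewrite ?mulr1// mulr0 normr0.
  exact: le_trans (gC 0).
apply: eq_bigr => j _; rewrite RintegralZl//; last first.
  apply: (bint _ 1); first by apply: measurable_indic; exact: mbin.
  by move=> x; rewrite indicE; case: (_ \in _); rewrite ?normr1 ?normr0.
rewrite mulrC; congr (_ * _).
have h0 : 0 < t / n%:R by rewrite divr_gt0// ltr0n.
have binD : bin n j `&` D = bin n j.
  apply/setIidl => x; rewrite /bin /D /= !in_itv/= => /andP[x1 x2].
  have -> : 0 <= x by apply: le_trans x1; apply: mulr_ge0 => //; exact: ltW.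
  apply: (lt_le_trans x2); rewrite mulrAC ler_pdivrMr ?ltr0n// ler_pM2l// ler_nat.
  exact: ltn_ord.
rewrite /Rintegral integral_indic//; last exact: mbin.
rewrite binD /bin /= lebesgue_measure_itv/= lte_fin ltr_pM2l// ltr_nat leqnn /=.
by rewrite -natr1; ring.
Qed.

End riemann.

(** * From Riemann sums to time integrals *)

(** The coefficient of the gradient at [z] involves spins to the left of [z]
    only, so the exchange of [z] and [z + 1] leaves it unchanged, as
    [gradient_duality] demands. *)
Definition gradsum (R : realType) m (b : int -> int -> R) (h : conf) : R :=
  \sum_(z <- zbox m)
    (\sum_(x <- zbox m | x < z) b x z * xi R h x) * (xi R h z - xi R h (z + 1)).

Lemma loc_gradsum (R : realType) m (b : int -> int -> R) : loc m.+1 (gradsum m b).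
Proof.
move=> h k hk; apply: eq_big_seq => z; rewrite mem_zbox => zm.
rewrite (@loc_xi R m.+1 z _ h k hk); last by lia.
rewrite (@loc_xi R m.+1 (z + 1) _ h k hk); last by lia.
congr (_ * _); rewrite big_seq_cond [RHS]big_seq_cond.
apply: eq_bigr => x /andP[]; rewrite mem_zbox => xm _; congr (_ * _).
by apply: (@loc_xi R m.+1 x _ h k hk); lia.
Qed.

Lemma cvg_norm_le (R : realType) (v : nat -> R) (l C : R) :
  v n @[n --> \oo] --> l -> (forall n, `|v n| <= C) -> `|l| <= C.
Proof.
move=> vl vC; have vC' n : - C <= v n <= C by rewrite -ler_norml.
rewrite ler_norml; apply/andP; split.
  by apply: (cvgr_to_ge vl); apply: nearW => n; case/andP: (vC' n).
by apply: (cvgr_to_le vl); apply: nearW => n; case/andP: (vC' n).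
Qed.

Section path.
Variables (R : realType) (p q : R) (S : R -> (conf -> R) -> conf -> R).
Variables (d : measure_display) (Omega : measurableType d).
Variables (P : probability Omega R) (eta : R -> Omega -> conf).
Hypotheses (p0 : 0 <= p) (q0 : 0 <= q) (pq1 : p + q = 1).
Hypothesis fS : feller_semigroup S.
Hypothesis gS : forall f, local f -> generates S f (exclusion_gen p q f).
Hypothesis meas : forall (t : R) x, 0 <= t -> measurable [set w | eta t w x].
Hypothesis cad : cadlag eta.
Hypothesis markov : markov_process P S eta.
Hypothesis init : bernoulli_law P (1 / 2) (eta 0).
Implicit Types (f g u : conf -> R) (x y z : int) (m n l : nat).
Local Notation Ex := (expect P).
Local Notation xi := (xi R).
Local Notation mu := (@lebesgue_measure R).

Variables (kap t : R).
Hypotheses (kap0 : 0 < kap) (t0 : 0 < t).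

Local Notation rsum := (path_sum eta kap t).

(** A constant, two gradient sums controlled through the dynamics, and a term
    [st] that is small at each fixed time. *)
Lemma rsum_second_moment m1 m2 m3 (b1 b2 : int -> int -> R) (st : conf -> R)
    (c B1 B2 B3 zeta : R) : 0 < zeta -> loc m3 st ->
  \sum_(z <- zbox m1) \sum_(x <- zbox m1 | x < z) b1 x z ^+ 2 <= B1 ->
  \sum_(z <- zbox m2) \sum_(x <- zbox m2 | x < z) b2 x z ^+ 2 <= B2 ->
  nu m3 (fun h => st h ^+ 2) <= B3 ->
  exists n0, forall n, (n0 <= n)%N ->
  Ex (fun w => rsum n (fun h => c + gradsum m1 b1 h + gradsum m2 b2 h + st h) w ^+ 2)
   <= 4 * (t ^+ 2 * c ^+ 2 + 10 * (t ^+ 2 + 2 * t + 2) * kap * (B1 + B2) + t ^+ 2 * B3)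
      + zeta.
Proof.
move=> zeta0 lst hB1 hB2 hB3.
have z8 : 0 < zeta / 8 by exact: divr_gt0.
have [n1 H1] := kv_gradient p0 q0 pq1 fS gS meas markov init kap0 t0 m1 b1 z8.
have [n2 H2] := kv_gradient p0 q0 pq1 fS gS meas markov init kap0 t0 m2 b2 z8.
exists (maxn 1 (maxn n1 n2)) => n; rewrite !geq_max => /and3P[n0 /H1 h1 /H2 h2].
rewrite -/(gradsum m1 b1) -/(gradsum m2 b2) in h1 h2.
have {}h1 : Ex (fun w => rsum n (gradsum m1 b1) w ^+ 2) <=
   10 * (t ^+ 2 + 2 * t + 2) * kap *
   (\sum_(z <- zbox m1) \sum_(x <- zbox m1 | x < z) b1 x z ^+ 2) + zeta / 8 := h1.
have {}h2 : Ex (fun w => rsum n (gradsum m2 b2) w ^+ 2) <=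
   10 * (t ^+ 2 + 2 * t + 2) * kap *
   (\sum_(z <- zbox m2) \sum_(x <- zbox m2 | x < z) b2 x z ^+ 2) + zeta / 8 := h2.
have h3 := rsum_sqr_le p0 q0 pq1 fS gS meas markov init kap0 t0 lst n0.
have h4 := rsum_sqr_le p0 q0 pq1 fS gS meas markov init kap0 t0 (@loc_cst R 0 c) n0.
rewrite nu_cst in h4.
have bm1 := bmX 2 (bm_rsum meas kap0 t0 n (loc_gradsum b1 (m := m1))).
have bm2 := bmX 2 (bm_rsum meas kap0 t0 n (loc_gradsum b2 (m := m2))).
have bm3 := bmX 2 (bm_rsum meas kap0 t0 n lst).
have bm4 := bmX 2 (bm_rsum meas kap0 t0 n (@loc_cst R 0 c)).
have bm12 := bmD bm1 bm2; have bm34 := bmD bm3 bm4; have bm14 := bmD bm12 bm34.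
have sumE w : rsum n (fun h => c + gradsum m1 b1 h + gradsum m2 b2 h + st h) w =
   rsum n (fun=> c) w + rsum n (gradsum m1 b1) w + rsum n (gradsum m2 b2) w + rsum n st w.
  rewrite /path_sum -!big_split/=; apply: eq_bigr => j _; ring.
apply: (@le_trans _ _ (Ex (fun w => 4 * ((rsum n (gradsum m1 b1) w ^+ 2 +
    rsum n (gradsum m2 b2) w ^+ 2) + (rsum n st w ^+ 2 + rsum n (fun=> c) w ^+ 2))))).
  apply: Ex_le; [|exact: bmZ|].
    apply: bmX; apply: (bm_rsum (m := maxn m1.+1 (maxn m2.+1 m3)) meas kap0 t0).
    apply: locD; [apply: locD; [apply: locD; first exact: loc_cst|]|].
    - by apply: (@locW R m1.+1); [rewrite leq_maxl|exact: loc_gradsum].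
    - by apply: (@locW R m2.+1); [rewrite leq_max leq_maxl orbT|exact: loc_gradsum].
    - by apply: (@locW R m3); [rewrite leq_max leq_maxr orbT|].
  move=> w; rewrite sumE.
  set x1 := rsum n _ w; set x2 := rsum n _ w; set x3 := rsum n _ w; set x4 := rsum n _ w.
  have := sqr_ge0 (x1 - x2); have := sqr_ge0 (x1 - x3); have := sqr_ge0 (x1 - x4).
  have := sqr_ge0 (x2 - x3); have := sqr_ge0 (x2 - x4); have := sqr_ge0 (x3 - x4).
  lra.
rewrite (ExZ P 4 bm14) (ExD P bm12 bm34) (ExD P bm1 bm2) (ExD P bm3 bm4).
have k0 : 0 <= 10 * (t ^+ 2 + 2 * t + 2) * kap.
  rewrite !mulr_ge0 ?(ltW kap0)// addr_ge0// addr_ge0 ?sqr_ge0// mulr_ge0// ltW//.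
have g1 := ler_wpM2l k0 hB1; have g2 := ler_wpM2l k0 hB2.
have g3 := ler_wpM2l (sqr_ge0 t) hB3.
move: h1 h2 h3 h4 g1 g2 g3 zeta0.
set X1 := Ex _; set X2 := Ex _; set X3 := Ex _; set X4 := Ex _.
set Y1 := \sum_(z <- _) _; set Y2 := \sum_(z <- _) _; set K := 10 * _ * _.
by lra.
Qed.

Lemma path_right_continuous m f w s : loc m f -> 0 <= s ->
  f (eta (r / kap) w) @[r --> s^'+] --> f (eta (s / kap) w).
Proof.
move=> lf s0; have cf := loc_continuous gS lf.
have sk : 0 <= s / kap by rewrite divr_ge0// ltW.
have [h _] := cad w; have {}h := h _ sk.
have sc : r / kap @[r --> s^'+] --> (s / kap)^'+.
  move=> A [e /= e0 eA]; exists (e * kap) => /=; first exact: mulr_gt0.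
  move=> r /= rs sr; apply: eA => /=; last by rewrite ltr_pM2r// invr_gt0.
  rewrite -mulrBl normrM (@gtr0_norm _ kap^-1) ?invr_gt0//.
  by rewrite ltr_pdivrMr.
exact: (cvg_comp _ _ (cvg_comp _ _ sc h) (cf _)).
Qed.

Lemma path_riemann m f w : loc m f ->
  measurable_fun `[0, t]%classic (fun s => f (eta (s / kap) w)) /\
  rsum n f w @[n --> \oo] --> \int[mu]_(s in `[0, t]) f (eta (s / kap) w).
Proof.
move=> lf; have [C fC] := loc_bounded lf.
apply: (@riemann_sum_cvg R t C (fun s => f (eta (s / kap) w))) => //.
by move=> s s0; exact: path_right_continuous lf s0.
Qed.

Lemma measure_seg : (mu `[0%R, t]%classic < +oo)%E.
Proof. by rewrite lebesgue_measure_itv /= lte_fin t0 -EFinD ltry. Qed.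

Section limits.
Variables (F : nat -> conf -> R) (W : conf -> R) (C : R).
Hypothesis lF : forall l, exists m, loc m (F l).
Hypothesis FC : forall l h, `|F l h| <= C.
Hypothesis FW : forall h, F l h @[l --> \oo] --> W h.

Lemma limit_path_integrable w :
  mu.-integrable `[0, t]%classic (EFin \o (fun s => W (eta (s / kap) w))).
Proof.
have [] // := @dominated_Rintegral R _ _ mu `[0, t]%classic _
  (fun l s => F l (eta (s / kap) w)) (fun s => W (eta (s / kap) w)) (fun=> C).
- by move=> l; have [m lm] := lF l; have [] := path_riemann w lm.
- apply: (@bounded_integrable _ _ _ mu _ _ measure_seg _ `|C|) => //.
Qed.

Lemma limit_path_cvg w :
  (\int[mu]_(s in `[0, t]) F l (eta (s / kap) w)) @[l --> \oo] -->
  \int[mu]_(s in `[0, t]) W (eta (s / kap) w).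
Proof.
have [] // := @dominated_Rintegral R _ _ mu `[0, t]%classic _
  (fun l s => F l (eta (s / kap) w)) (fun s => W (eta (s / kap) w)) (fun=> C).
- by move=> l; have [m lm] := lF l; have [] := path_riemann w lm.
- apply: (@bounded_integrable _ _ _ mu _ _ measure_seg _ `|C|) => //.
Qed.

(** Bounded convergence is used twice, from Riemann sums to time integrals and
    then from [F l] to [W]. *)
Lemma path_second_moment B :
  (forall l zeta, 0 < zeta -> exists n0, forall n, (n0 <= n)%N ->
     Ex (fun w => rsum n (F l) w ^+ 2) <= B + zeta) ->
  ('E_P[fun w => ((\int[mu]_(s in `[0, t]) W (eta (s / kap) w)) ^+ 2)%R] <= B%:E)%E.
Proof.
move=> FB; pose X l w := \int[mu]_(s in `[0, t]) F l (eta (s / kap) w).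
pose Y w := \int[mu]_(s in `[0, t]) W (eta (s / kap) w).
have C0 : 0 <= C by exact: le_trans (FC 0 (fun=> false)).
have PT : (P setT < +oo)%E by exact: (le_lt_trans (probability_le1 P measurableT) (ltry 1)).
have cX l w : rsum n (F l) w @[n --> \oo] --> X l w.
  by have [m lm] := lF l; have [] := path_riemann w lm.
have bX l : measurable_fun setT (X l) /\ forall w, `|X l w| <= t * C.
  split.
    apply: (@measurable_fun_cvg _ _ _ _ (fun n w => rsum n (F l) w)) => [n|w _]; last exact: cX.
    by have [m lm] := lF l; have [] := bm_rsum meas kap0 t0 n lm.
  by move=> w; apply: (cvg_norm_le (cX l w)) => n; apply: rsum_norm.
have bY : measurable_fun setT Y /\ forall w, `|Y w| <= t * C.
  split.
    apply: (@measurable_fun_cvg _ _ _ _ X) => [l|w _]; first exact: (bX l).1.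
    exact: limit_path_cvg.
  by move=> w; apply: (cvg_norm_le (@limit_path_cvg w)) => l; exact: (bX l).2.
have sqr (Z : nat -> Omega -> R) (Z' : Omega -> R) :
    (forall n, measurable_fun setT (Z n)) -> (forall n w, `|Z n w| <= t * C) ->
    (forall w, Z n w @[n --> \oo] --> Z' w) ->
    Ex (fun w => Z n w ^+ 2) @[n --> \oo] --> Ex (fun w => Z' w ^+ 2).
  move=> mZ ZC ZZ; apply: (@bounded_Rintegral _ _ _ P setT measurableT PT
     (fun n w => Z n w ^+ 2) (fun w => Z' w ^+ 2) ((t * C) ^+ 2)).
  - by move=> n; exact: measurable_funX.
  - by move=> w _; apply: cvgM; exact: ZZ.
  - by move=> n w _; rewrite normrX lerXn2r ?nnegrE// mulr_ge0// ltW.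
have EX l : Ex (fun w => X l w ^+ 2) <= B.
  apply/ler_addgt0Pr => e e0; have [n0 Hn] := FB l e e0.
  have [m lm] := lF l.
  have h := sqr (fun n => rsum n (F l)) (X l) _ _ (cX l).
  apply: (cvgr_to_le (h _ _)); last by exists n0.
    by move=> n; have [] := bm_rsum meas kap0 t0 n lm.
  by move=> n w; exact: rsum_norm.
have EY : Ex (fun w => Y w ^+ 2) <= B.
  have h := sqr X Y _ _ (fun w => @limit_path_cvg w).
  apply: (cvgr_to_le (h _ _)); last exact: nearW.
    by move=> l; exact: (bX l).1.
  by move=> l; exact: (bX l).2.
have bmY : bounded_meas Y by split; [exact: bY.1|exists (t * C); exact: bY.2].
rewrite unlock -(fineK (integrable_fin_num measurableT (bm_integrable P (bmX 2 bmY)))).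
by rewrite lee_fin.
Qed.

End limits.
End path.

(** * Transport of spins along bonds *)

Section quadratic.
Variable R : realType.
Implicit Types (x y z : int) (l m n j k K : nat).
Local Notation xi := (xi R).

(** The coefficient of the bond [(z, z + 1)] when, for all [k <= K], the spin
    at [x + k] is moved to [x + 1] through the bonds in between. *)
Definition bond_coef l K (al : int -> nat -> R) x z : R :=
  if (`|x| <= l)%N && (x < z) then
    - \sum_(1 <= k < K.+1 | (`|z - x| < k)%N) al x k
  else 0.

(** Summation by parts. *)
Lemma transport_telescope K (al : nat -> R) (a : nat -> R) :
  \sum_(1 <= k < K.+1) al k * (a k - a 1%N) =
  \sum_(1 <= j < K) (- \sum_(1 <= k < K.+1 | (j < k)%N) al k) * (a j - a j.+1).
Proof.
under [RHS]eq_bigr do rewrite mulNr -mulrN mulr_suml big_mkcond/=.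
rewrite exchange_big /=; apply: eq_big_nat => k /andP[k1 kK].
rewrite (eq_bigr (fun j => (if (j < k)%N then al k else 0) * (a j.+1 - a j))); last first.
  by move=> j _; rewrite opprB; case: ifP => //; rewrite mul0r.
rewrite (@big_cat_nat _ _ _ k)//= [X in _ = _ + X]big_nat_cond [X in _ = _ + X]big1 ?addr0.
  rewrite big_nat (eq_bigr (fun j => al k * (a j.+1 - a j))); last first.
    by move=> j /andP[_ ->].
  by rewrite -big_nat -mulr_sumr telescope_sumr.
by move=> j /andP[/andP[kj _] _]; rewrite ltnNge kj /= mul0r.
Qed.

Lemma sum_bond_coef l K (al : int -> nat -> R) x (a : int -> R) : (`|x| <= l)%N ->
  \sum_(z <- zbox (l + K) | x < z) bond_coef l K al x z * a z =
  \sum_(1 <= j < K) (- \sum_(1 <= k < K.+1 | (j < k)%N) al x k) * a (x + j%:Z).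
Proof.
move=> xl; rewrite -big_filter.
transitivity (\sum_(z <- [seq x + j%:Z | j <- index_iota 1 K]) bond_coef l K al x z * a z).
  apply: eq_sum_support.
  - exact/filter_uniq/zbox_uniq.
  - by rewrite map_inj_uniq ?iota_uniq// => i j; lia.
  - move=> z; rewrite mem_filter mem_zbox => /andP[xz zm] /mapP zK.
    rewrite /bond_coef xl xz /= big_nat_cond big1 ?oppr0 ?mul0r// => k /andP[kK zk].
    exfalso; apply: zK; exists `|z - x|%N; last by lia.
    by rewrite mem_index_iota; lia.
  - move=> z /mapP[j]; rewrite mem_index_iota => jK ->.
    by rewrite mem_filter mem_zbox => /negP[]; lia.
rewrite big_map; apply: eq_big_nat => j jK.
rewrite /bond_coef xl (_ : x < x + j%:Z) /=; last by lia.
by rewrite (_ : absz (x + j%:Z - x)%R = j)//; lia.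
Qed.

Lemma transport_gradsum l K (al : int -> nat -> R) h :
  \sum_(x <- zbox l) \sum_(1 <= k < K.+1) al x k * xi h x * (xi h (x + k%:Z) - xi h (x + 1)) =
  gradsum (l + K) (bond_coef l K al) h.
Proof.
rewrite /gradsum.
under [RHS]eq_bigr do rewrite mulr_suml big_mkcond.
rewrite [RHS]exchange_big/=.
transitivity (\sum_(x <- zbox (l + K)) (if (`|x| <= l)%N then
  \sum_(1 <= k < K.+1) al x k * xi h x * (xi h (x + k%:Z) - xi h (x + 1)) else 0)).
  rewrite [RHS](@sum_zbox_widen _ l (l + K)) ?leq_addr//; last first.
    by move=> x lx; rewrite leqNgt lx.
  by apply: eq_big_seq => x; rewrite mem_zbox => ->.
apply: eq_bigr => x _; rewrite -big_mkcond/=; case: ifP => xl; last first.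
  by rewrite big1// => z _; rewrite /bond_coef xl/= !mul0r.
rewrite (eq_bigr (fun z => bond_coef l K al x z * (xi h x * (xi h z - xi h (z + 1)))));
  last by move=> z _; rewrite mulrA.
rewrite (sum_bond_coef K al (fun z => xi h x * (xi h z - xi h (z + 1))) xl).
rewrite (eq_bigr (fun k => xi h x * (al x k * (xi h (x + k%:Z) - xi h (x + 1)))));
  last by move=> k _; ring.
rewrite -mulr_sumr (transport_telescope K (al x) (fun k => xi h (x + k%:Z))).
rewrite mulr_sumr; apply: eq_bigr => j _; rewrite mulrCA.
congr (_ * (_ * (_ - xi h _))); lia.
Qed.

(** The spins paired with [x] travel through at most [K] bonds, and each bond
    carries at most the total weight of [x]. *)
Lemma bond_coef_bound l K (al : int -> nat -> R) :
  \sum_(z <- zbox (l + K)) \sum_(x <- zbox (l + K) | x < z) bond_coef l K al x z ^+ 2 <=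
  K%:R * \sum_(x <- zbox l) (\sum_(1 <= k < K.+1) `|al x k|) ^+ 2.
Proof.
under eq_bigr do rewrite big_mkcond.
rewrite exchange_big/=.
have -> : \sum_(x <- zbox l) (\sum_(1 <= k < K.+1) `|al x k|) ^+ 2 =
   \sum_(x <- zbox (l + K)) (if (`|x| <= l)%N then
     (\sum_(1 <= k < K.+1) `|al x k|) ^+ 2 else 0).
  rewrite [RHS](@sum_zbox_widen _ l (l + K)) ?leq_addr//; last first.
    by move=> x lx; rewrite leqNgt lx.
  by apply: eq_big_seq => x; rewrite mem_zbox => ->.
rewrite mulr_sumr; apply: ler_sum => x _; rewrite -big_mkcond/=.
case: ifP => xl; last first.
  by rewrite big1 ?mulr0// => z _; rewrite /bond_coef xl/= expr0n.
rewrite (eq_bigr (fun z => bond_coef l K al x z * bond_coef l K al x z));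
  last by move=> z _; rewrite expr2.
rewrite (sum_bond_coef K al (fun z => bond_coef l K al x z) xl).
set A := \sum_(1 <= k < K.+1) _.
apply: (@le_trans _ _ (\sum_(1 <= j < K) A ^+ 2)); last first.
  rewrite sumr_const_nat -[leLHS]mulr_natl ler_wpM2r ?sqr_ge0// ler_nat.
  by rewrite leq_subr.
rewrite big_nat [leRHS]big_nat; apply: ler_sum => j /andP[j1 jK].
rewrite /bond_coef xl (_ : x < x + j%:Z) /=; last by lia.
rewrite (_ : absz (x + j%:Z - x)%R = j); last by lia.
rewrite mulrNN -expr2 /=; apply: sqr_le_norm.
apply: (le_trans (ler_norm_sum _ _ _)); rewrite /A big_mkcond.
by apply: ler_sum => k _; case: ifP.
Qed.

(** Products [xi x * Q x] with [Q x] depending on sites to the right of [x] are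
    orthogonal: flipping the leftmost of two sites changes one sign only. *)
Lemma static_variance l K (c : int -> R) : (0 < K)%N ->
  nu (l + K) (fun h => (\sum_(x <- zbox l) c x * xi h x *
     (K%:R^-1 * \sum_(1 <= k < K.+1) xi h (x + k%:Z))) ^+ 2) <=
  K%:R^-1 * \sum_(x <- zbox l) c x ^+ 2.
Proof.
move=> K0.
pose Q x h := K%:R^-1 * \sum_(1 <= k < K.+1) xi h (x + k%:Z).
have Qflip x y h : y <= x -> Q x (flip y h) = Q x h.
  move=> yx; congr (_ * _); apply: eq_big_nat => k /andP[k1 _].
  by rewrite xi_flip_out//; lia.
have orth x y : x \in zbox l -> y \in zbox l -> x != y ->
    nu (l + K) (fun h => (xi h x * Q x h) * (xi h y * Q y h)) = 0.
  wlog xy : x y / x < y => [wl xl yl xy|].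
    have [lt|lt|e] := ltgtP x y; first exact: wl.
      rewrite -[RHS](wl y x lt yl xl _); last by rewrite eq_sym.
      by apply: eq_nu => h; rewrite mulrC.
    by rewrite e eqxx in xy.
  rewrite !mem_zbox => xl yl xyn.
  apply: (@nu_odd _ _ _ x) => [|h]; first by lia.
  rewrite xi_flip xi_flip_out; last by rewrite eq_sym.
  by rewrite !Qflip ?(ltW xy)//; ring.
rewrite (eq_nu (g := fun h => \sum_(x <- zbox l) \sum_(y <- zbox l)
    (c x * c y) * ((xi h x * Q x h) * (xi h y * Q y h)))); last first.
  move=> h; rewrite expr2 mulr_suml; apply: eq_bigr => x _.
  by rewrite mulr_sumr; apply: eq_bigr => y _; rewrite /Q; ring.
rewrite nu_sum mulr_sumr big_seq [leRHS]big_seq; apply: ler_sum => x xl.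
rewrite nu_sum (bigD1_seq x)//=; last exact: zbox_uniq.
rewrite [X in _ + X]big_seq_cond [X in _ + X]big1 ?addr0; last first.
  by move=> y /andP[yl yx]; rewrite nuZ orth ?mulr0// eq_sym.
rewrite nuZ -expr2 mulrC ler_wpM2r ?sqr_ge0//.
rewrite (eq_nu (g := fun h => K%:R^-1 ^+ 2 * (\sum_(k <- index_iota 1 K.+1) 1 * xi h (x + k%:Z)) ^+ 2));
  last first.
  move=> h; rewrite mulrACA xi_sqr mul1r /Q -exprMn expr2; congr (_ * _); congr (_ * _);
    by apply: eq_bigr => k _; rewrite mul1r.
rewrite nuZ nu_linear_sqr ?iota_uniq//; last 2 first.
- by move=> i j; lia.
- by move=> k; rewrite mem_index_iota; move: xl; rewrite mem_zbox; lia.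
under eq_bigr do rewrite expr1n.
rewrite sumr_const_nat subn1 /= -mulr_natr mul1r expr2 -mulrA mulVf ?mulr1//.
by rewrite pnatr_eq0 -lt0n.
Qed.

End quadratic.

(** * Bump functions and an integrable weight *)

Section calculus.
Variable R : realType.
Implicit Types (f g psi : R -> R) (x y : R).
Local Notation mu := (@lebesgue_measure R).

Lemma derivable_continuous f : (forall x, derivable f x 1) -> continuous f.
Proof. by move=> df x; apply/differentiable_continuous/derivable1_diffP. Qed.

Lemma mean_value_bound f (C : R) x y : (forall z, derivable f z 1) ->
  (forall z, Num.min x y <= z -> z <= Num.max x y -> `|derive1 f z| <= C) ->
  `|f y - f x| <= C * `|y - x|.
Proof.
move=> df; wlog xy : x y / x <= y => [wl h|].
  have [xy|/ltW yx] := leP x y; first exact: wl.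
  by rewrite distrC [`|y - x|]distrC; apply: wl; rewrite // minC maxC.
rewrite min_l ?max_r// => h.
have [|z|c] := @MVT_segment R f (derive1 f) x y xy.
- by move=> z _; apply: DeriveDef => //; rewrite derive1E.
- exact/continuous_subspaceT/derivable_continuous.
rewrite in_itv/= => /andP[xc cy] ->; rewrite normrM ler_wpM2r//; exact: h.
Qed.

Definition lipschitz_bump psi (D L : R) :=
  [/\ forall x, 1 <= `|x| -> psi x = 0, forall x, 0 <= psi x,
      forall x, psi x <= D & forall x y, `|psi y - psi x| <= L * `|y - x|].

Lemma lipschitz_continuous psi (L : R) :
  (forall x y, `|psi y - psi x| <= L * `|y - x|) -> continuous psi.
Proof.
move=> lip x; have L1 : 0 < `|L| + 1 by rewrite ltr_wpDl.
apply/cvgrPdist_lt => e e0; near=> y; rewrite distrC.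
apply: (le_lt_trans (lip x y)).
apply: (@le_lt_trans _ _ ((`|L| + 1) * `|y - x|)).
  by rewrite ler_wpM2r// (le_trans (ler_norm L))// lerDl.
rewrite mulrC -ltr_pdivlMr// distrC; near: y.
by apply: cvgr_dist_lt; [exact: cvg_id|exact: divr_gt0].
Unshelve. all: by end_near. Qed.

Lemma segment_measure_lty (a b : R) : (mu `[a, b]%classic < +oo)%E.
Proof.
by rewrite lebesgue_measure_itv /=; case: ifP => _; rewrite ?ltry// -EFinD ltry.
Qed.

Lemma bump_integrable psi D L : lipschitz_bump psi D L -> mu.-integrable setT (EFin \o psi).
Proof.
move=> [supp pos bD lip]; have cpsi := lipschitz_continuous lip.
have mpsi : measurable_fun setT psi by exact: continuous_measurable_fun.
have h : mu.-integrable (`[-1, 1]%classic : set R) (EFin \o psi).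
  apply: (@bounded_integrable R _ _ mu _ _ _ _ D) => //.
  - exact: segment_measure_lty.
  - exact: measurable_funTS.
  - by move=> x _; rewrite ger0_norm.
have -> : EFin \o psi = (EFin \o psi) \_ (`[-1, 1]%classic : set R).
  apply/funext => x; rewrite /patch; case: ifPn => // /negP xn /=.
  rewrite supp//; rewrite leNgt; apply/negP => x1; apply: xn; rewrite inE /= in_itv/=.
  by move: x1; rewrite ltr_norml => /andP[/ltW-> /ltW->].
by have := (@integrable_mkcond _ _ _ mu _ (EFin \o psi) (measurable_itv `[-1, 1])).1 h.
Qed.

Lemma bump_primitive psi D L : lipschitz_bump psi D L -> exists Psi : R -> R,
  [/\ forall x, derivable Psi x 1 /\ derive1 Psi x = psi x,
      forall x, x <= -1 -> Psi x = 0 & forall x, 1 <= x -> Psi x = \int[mu]_u psi u].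
Proof.
move=> bpsi; have ipsi := bump_integrable bpsi.
have [supp pos bD lip] := bpsi; have cpsi := lipschitz_continuous lip.
exists (fun x => \int[mu]_(u in `]-oo, x]) psi u); split.
- move=> x; apply: (@continuous_FTC1 R psi -oo%O x (x + 1)).
  + by rewrite ltrDl.
  + by apply: integrableS ipsi.
  + by rewrite ltNyr.
  + exact: cpsi.
- move=> x x1; rewrite (@eq_Rintegral _ _ _ _ _ (fun=> 0)); first by rewrite Rintegral_cst// mul0r.
  move=> u; rewrite inE /= in_itv/= => ux; apply: supp.
  by rewrite ler0_norm; lra.
- move=> x x1; rewrite Rintegral_mkcond; apply: eq_Rintegral => u _.
  rewrite /patch; case: ifPn => // /negP un; apply/esym; apply: supp.
  rewrite (le_trans _ (ler_norm u))// (le_trans x1)// leNgt; apply/negP => ux; apply: un.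
  by rewrite inE /= in_itv/= ltW.
Qed.

(** The primitive telescopes along the grid, each cell leaving an error of
    second order in [del]. *)
Lemma bump_riemann psi D L Psi (del v : R) (l : nat) : lipschitz_bump psi D L ->
  (forall x, derivable Psi x 1 /\ derive1 Psi x = psi x) ->
  (forall x, x <= -1 -> Psi x = 0) ->
  0 < del -> v - del * l%:R <= -1 ->
  `|del * (\sum_(1 <= k < l.+1) psi (v - del * k%:R)) - Psi v| <= l%:R * (L * del ^+ 2).
Proof.
move=> [supp pos bD lip] dPsi Psi0 del0 vl.
have L0 : 0 <= L.
  by have := lip 0 1; rewrite subr0 normr1 mulr1; exact: le_trans.
have -> : Psi v = \sum_(1 <= k < l.+1) (Psi (v - del * k.-1%:R) - Psi (v - del * k%:R)).
  rewrite big_add1 /= (eq_bigr (fun k => - (Psi (v - del * k.+1%:R) - Psi (v - del * k%:R))));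
    last by move=> k _; rewrite opprB.
  rewrite sumrN telescope_sumr// mulr0 subr0 (Psi0 (v - _))//; ring.
rewrite mulr_sumr -sumrB; apply: (le_trans (ler_norm_sum _ _ _)).
have -> : l%:R * (L * del ^+ 2) = \sum_(1 <= k < l.+1) L * del ^+ 2.
  by rewrite sumr_const_nat subn1/= mulr_natl.
apply: ler_sum_nat => k /andP[k1 _].
set a := v - del * k%:R.
have -> : v - del * k.-1%:R = a + del.
  by rewrite /a -(prednK k1) -natr1 [k.-1.+1.-1]/=; ring.
have aad : a <= a + del by rewrite lerDl ltW.
have dP z : z \in `]a, a + del[ -> is_derive z 1 Psi (psi z).
  by move=> _; have [d1 d2] := dPsi z; apply: DeriveDef => //; rewrite -derive1E.
have cP : {within `[a, a + del], continuous Psi}.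
  by apply/continuous_subspaceT/derivable_continuous => z; have [] := dPsi z.
have [c] := MVT_segment aad dP cP.
rewrite in_itv/= => /andP[ac ca] ->.
have -> : del * psi a - psi c * (a + del - a) = - (del * (psi c - psi a)) by ring.
rewrite normrN normrM gtr0_norm// expr2 mulrA [L * del]mulrC -mulrA ler_pM2l//.
by apply: (le_trans (lip a c)); rewrite ler_wpM2l// ger0_norm; lra.
Qed.

Lemma bump_sqr psi D L : lipschitz_bump psi D L -> lipschitz_bump (fun x => psi x ^+ 2) (D ^+ 2) (2 * D * L).
Proof.
move=> [supp pos bD lip]; split => [x x1|x|x|x y].
- by rewrite supp// expr0n.
- exact: sqr_ge0.
- by apply: sqr_le_norm; rewrite ger0_norm.
- rewrite subr_sqr mulrC normrM -mulrA ler_pM//.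
  by apply: (le_trans (ler_normD _ _)); rewrite !ger0_norm//; have := bD x; have := bD y; lra.
Qed.

Lemma continuous_bounded_seg f (a b : R) : a <= b -> continuous f ->
  exists2 C : R, 0 <= C & forall x, a <= x <= b -> `|f x| <= C.
Proof.
move=> ab cf.
have [|c _ cmax] := @EVT_max R (fun x => `|f x|) a b ab _.
  apply: continuous_subspaceT => x; apply: (cvg_comp _ _ (cf x)).
  exact: norm_continuous.
by exists `|f c| => // x xab; apply: cmax; rewrite in_itv.
Qed.

(** The closed support is [[-1, 1]], so the function and its derivative vanish
    beyond it; continuity gives the value 0 at the end points as well, and
    makes the derivative bounded. *)
Lemma mollifier_bump (dd : R -> R) : mollifier dd ->
  exists D L, [/\ 0 <= D, 0 <= L & lipschitz_bump dd D L].
Proof.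
move=> [sm _ pos supp _].
have cd : continuous dd by apply: derivable_continuous => x; exact: (sm 0%N).
have cd' : continuous (derive1 dd) by apply: derivable_continuous => x; exact: (sm 1%N).
have out x : 1 < `|x| -> dd x = 0.
  move=> x1; apply: contrapT => /eqP dx.
  have : closure [set x | dd x != 0] x by exact: subset_closure.
  by rewrite supp /= in_itv/= -ler_norml leNgt x1.
have out1 x : 1 <= `|x| -> dd x = 0.
  rewrite le_eqVlt => /predU1P[x1|]; last exact: out.
  apply/eqP; rewrite -normr_le0; apply/ler_addgt0Pr => e e0; rewrite add0r.
  have /cvgrPdist_lt/(_ _ e0) [r /= r0 hr] := cd x.
  have x0 : x != 0 by rewrite -normr_gt0 -x1.
  pose y := x + x * (r / 2).
  have r2 : 0 < r / 2 by rewrite divr_gt0.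
  have dy : dd y = 0.
    apply: out; rewrite /y -{1}[x]mulr1 -mulrDr normrM -x1 mul1r gtr0_norm; lra.
  have xy : `|x - y| < r.
    by rewrite /y opprD addrA subrr sub0r normrN normrM -x1 mul1r gtr0_norm//; lra.
  by have := hr y xy; rewrite dy subr0 => /ltW.
have out' x : 1 < `|x| -> derive1 dd x = 0.
  move=> x1; have h0 : is_derive x 1 (cst 0 : R -> R) 0 by exact: is_derive_cst.
  have near0 : \near x, (cst 0 : R -> R) x = dd x.
    exists (`|x| - 1) => /=; first by rewrite subr_gt0.
    by move=> y /= xy; apply/esym; apply: out; have := lerB_dist x y; lra.
  by rewrite derive1E; have [_ ->] := near_eq_is_derive near0 h0.
have [D D0 hD] := @continuous_bounded_seg dd (-1) 1 ltac:(lra) cd.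
have [L L0 hL] := @continuous_bounded_seg _ (-1) 1 ltac:(lra) cd'.
exists D, L; split => //; split => // [x|x y].
  have [x1|x1] := leP `|x| 1; last by rewrite out.
  by apply: (le_trans (ler_norm _)); apply: hD; rewrite -ler_norml.
apply: mean_value_bound => [z|z _ _]; first exact: (sm 0%N).
have [z1|z1] := leP `|z| 1; last by rewrite out' ?normr0.
by apply: hL; rewrite -ler_norml.
Qed.

(** An integrable weight comparable with its translates by at most 1, in which
    the decay of the test function is expressed. *)
Definition rho x : R := (1 + x ^+ 2)^-1.

Lemma rho_gt0 x : 0 < rho x.
Proof. by rewrite invr_gt0 ltr_wpDr// sqr_ge0. Qed.

Lemma rho_le1 x : rho x <= 1.
Proof. by rewrite invf_le1 ?lerDl ?sqr_ge0// ltr_wpDr// sqr_ge0. Qed.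

Lemma rho_near x y : `|y - x| <= 1 -> rho y <= 3 * rho x.
Proof.
move=> yx; have hx := rho_gt0 x; have hy := rho_gt0 y.
have ex : rho x * (1 + x ^+ 2) = 1 by rewrite mulVf// gt_eqF// ltr_wpDr// sqr_ge0.
have ey : rho y * (1 + y ^+ 2) = 1 by rewrite mulVf// gt_eqF// ltr_wpDr// sqr_ge0.
have h : 1 + x ^+ 2 <= 3 * (1 + y ^+ 2).
  have : (y - x) ^+ 2 <= 1 ^+ 2 by apply: sqr_le_norm.
  have := sqr_ge0 (2 * y - x); nra.
have h2 : rho x * rho y * (1 + x ^+ 2) <= rho x * rho y * (3 * (1 + y ^+ 2)).
  by rewrite ler_wpM2l// mulr_ge0// ltW.
have e1 : rho x * rho y * (1 + x ^+ 2) = rho y by rewrite mulrAC ex mul1r.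
have e2 : rho x * rho y * (3 * (1 + y ^+ 2)) = 3 * rho x.
  by transitivity (3 * rho x * (rho y * (1 + y ^+ 2))); [ring|rewrite ey mulr1].
by rewrite -e1 -e2.
Qed.

Lemma rho_integrable : mu.-integrable setT (EFin \o rho).
Proof.
have crho : continuous rho by exact: (@continuous_oneDsqrV R).
have mrho : measurable_fun setT rho by exact: continuous_measurable_fun.
apply/integrableP; split; first exact/measurable_EFinP.
under eq_integral => x _ do rewrite /= (@ger0_norm _ (rho x)) ?ltW ?rho_gt0//.
rewrite ge0_symfun_integralT//=; last 2 first.
- by move=> x; rewrite ltW// rho_gt0.
- by move=> x; rewrite /rho /= sqrrN.
rewrite (_ : [set x | 0 <= x] = `[0, +oo[%classic); last first.
  by apply/seteqP; split => x/=; rewrite in_itv/= andbT.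
by rewrite (integral0y_oneDsqr R) -EFinM ltry.
Qed.

(** Comparison with the telescoping increments of [2 * (1 - 1 / (1 + v))]
    along [v = eps * i]. *)
Lemma rho_sum (eps : R) n : 0 < eps -> eps <= 1 ->
  eps * \sum_(x <- zbox n) rho (eps * x%:~R) <= 5.
Proof.
move=> e0 e1; rewrite mulr_sumr.
have half m : \sum_(1 <= i < m.+1) eps * rho (eps * i%:R) <= 2 * (1 - (1 + eps * m%:R)^-1).
  elim: m => [|m IH]; first by rewrite big_geq// mulr0 addr0 invr1 subrr mulr0.
  rewrite big_nat_recr//=; apply: (le_trans (lerD IH (lexx _))).
  set v := eps * m.+1%:R; have vE : eps * m%:R = v - eps by rewrite /v -natr1; ring.
  have v0 : 0 < v by rewrite mulr_gt0// ltr0n.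
  have ve : 0 <= v - eps by rewrite -vE mulr_ge0// ltW.
  rewrite vE /rho -subr_ge0.
  have -> : 2 * (1 - (1 + v)^-1) - (2 * (1 - (1 + (v - eps))^-1) + eps * (1 + v ^+ 2)^-1) =
    eps * ((1 - v) ^+ 2 + 2 * eps * (1 + v) ) / ((1 + v) * (1 + (v - eps)) * (1 + v ^+ 2))
    - eps * eps * (1 + v) / ((1 + v) * (1 + (v - eps)) * (1 + v ^+ 2)).
    by field; rewrite !gt_eqF//; nra.
  have den : 0 < (1 + v) * (1 + (v - eps)) * (1 + v ^+ 2) by rewrite !mulr_gt0//; nra.
  rewrite -mulrBl divr_ge0 ?(ltW den)//.
  have := sqr_ge0 (1 - v); nra.
have -> : \sum_(x <- zbox n) eps * rho (eps * x%:~R) =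
   eps * rho 0 + 2 * \sum_(1 <= i < n.+1) eps * rho (eps * i%:R).
  elim: n => [|n IH].
    by rewrite big_geq// mulr0 addr0 /zbox /= big_cons big_nil addr0 subrr mulr0.
  rewrite big_nat_recr//= mulrDr addrA -IH.
  transitivity (\sum_(x <- [:: n.+1%:Z, - n.+1%:Z & zbox n]) eps * rho (eps * x%:~R)).
    apply: eq_sum_support; first exact: zbox_uniq.
    - by rewrite cons_uniq cons_uniq zbox_uniq in_cons !mem_zbox; lia.
    - by move=> x; rewrite mem_zbox => xn; rewrite in_cons in_cons mem_zbox; lia.
    - by move=> x; rewrite in_cons in_cons !mem_zbox; lia.
  rewrite !big_cons mulrNz mulrN /rho sqrrN; ring.
have := half n; have := rho_le1 0; have : 0 < (1 + eps * n%:R)^-1.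
  by rewrite invr_gt0 ltr_wpDr// mulr_ge0// ltW.
move=> h1 h2 h3; have : eps * rho 0 <= 1 by have := rho_gt0 0; nra.
by lra.
Qed.

End calculus.

(** * Expansion of the squared mollified field *)

Section schwartz.
Variables (R : realType) (G : R -> R).
Hypothesis hG : schwartz G.
Local Notation mu := (@lebesgue_measure R).
Local Notation g := (derive1 G).

Lemma schwartz_derivable (x : R) : derivable g x 1.
Proof. by have [sm _] := hG; exact: (sm 1%N x). Qed.

Lemma schwartz_continuous : continuous g.
Proof. exact: derivable_continuous schwartz_derivable. Qed.

Lemma schwartz_decay : exists2 C : R, 0 <= C &
  (forall x, `|g x| <= C * rho x) /\ (forall x, `|derive1 g x| <= C * rho x).
Proof.
have [_ bd] := hG.
have dec n : exists C : R, forall x, `|derive1n n G x| <= C * rho x.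
  have [C0 h0] := bd 0%N n; have [C2 h2] := bd 2%N n; exists (C0 + C2) => x.
  rewrite /rho ler_pdivlMr ?ltr_wpDr ?sqr_ge0// mulrDr mulr1.
  apply: lerD; first by have := h0 x; rewrite expr0 mul1r.
  by have := h2 x; rewrite normrM (ger0_norm (sqr_ge0 x)) mulrC.
have [C1 h1] := dec 1%N; have [C2 h2] := dec 2%N.
exists (`|C1| + `|C2|); first by rewrite addr_ge0.
split=> x.
  apply: (le_trans (h1 x)); apply: ler_wpM2r; first exact/ltW/rho_gt0.
  by rewrite (le_trans (ler_norm _))// lerDl.
apply: (le_trans (h2 x)); apply: ler_wpM2r; first exact/ltW/rho_gt0.
by rewrite (le_trans (ler_norm _))// lerDr.
Qed.

Lemma schwartz_integrable : mu.-integrable setT (EFin \o g).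
Proof.
have [C C0 [gC _]] := schwartz_decay.
apply: (@le_integrable _ _ _ mu setT measurableT _ (fun x => (C * rho x)%:E)).
- apply/measurable_EFinP; exact: continuous_measurable_fun schwartz_continuous.
- move=> x _ /=; rewrite lee_fin (@ger0_norm _ (C * _)) ?gC//.
  by apply: mulr_ge0 => //; exact/ltW/rho_gt0.
- exact: (integrableZl measurableT C (rho_integrable R)).
Qed.

(** The fundamental theorem of calculus on growing intervals, the test
    function vanishing at infinity. *)
Lemma schwartz_mean0 : \int[mu]_u g u = 0.
Proof.
have [sm bd] := hG.
have dG x : derivable G x 1 by exact: (sm 0%N x).
have cG := derivable_continuous dG.
have mg : measurable_fun setT g by exact: continuous_measurable_fun schwartz_continuous.
pose F n u := g u * \1_(`[- n.+1%:R, n.+1%:R]%classic : set R) u.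
have mI n : measurable (`[- n.+1%:R, n.+1%:R]%classic : set R) by exact: measurable_itv.
have [] := @dominated_Rintegral R _ _ mu setT measurableT F g (fun u => `|g u|) _ _ _ _.
- move=> n; apply: measurable_funM => //; exact: (measurable_indic _ (mI n)).
- move=> x _; apply: cvg_near_cst; exists (Num.truncn `|x|) => // n /= nx.
  rewrite /F indicE mem_set ?mulr1//= in_itv/= -ler_norml.
  by rewrite (le_trans (ltW (truncnS_gt _)))// ler_nat.
- exact: integrable_norm schwartz_integrable.
- move=> n x _; rewrite /F normrM indicE; case: (_ \in _); rewrite ?normr1 ?mulr1//.
  by rewrite normr0 mulr0.
move=> _ cv; apply: (cvg_unique (@Rhausdorff R) cv).
have [C hC] := bd 1%N 0%N.
have FE n : \int[mu]_u F n u = G n.+1%:R - G (- n.+1%:R).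
  transitivity (\int[mu]_(u in `[- n.+1%:R, n.+1%:R]) g u).
    rewrite [RHS]Rintegral_mkcond; apply: eq_Rintegral => u _.
    by rewrite /F /patch indicE; case: ifP => _; rewrite ?mulr1 ?mulr0.
  have aa : - n.+1%:R < n.+1%:R :> R.
    by apply: (@lt_trans _ _ 0); rewrite ?oppr_lt0 ltr0n.
  have LR : derivable_oo_LRcontinuous G (- n.+1%:R) n.+1%:R.
    split => [x _||]; first exact: dG.
      exact/cvg_at_right_filter/cG.
    exact/cvg_at_left_filter/cG.
  have ftc := continuous_FTC2 aa (continuous_subspaceT schwartz_continuous) LR
    (fun x _ => erefl).
  by rewrite /Rintegral ftc.
apply/cvgrPdist_le => e e0.
have [n0 Hn] := small_mesh (t := 2 * `|C|) (mulr_ge0 (ler0n R 2) (normr_ge0 C)) e0.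
exists n0 => // n /= n0n; have [n1 nd] := Hn n.+1 (leqW n0n).
rewrite sub0r normrN FE.
have b x : `|G x| * `|x| <= `|C|.
  by have := hC x; rewrite expr1 normrM mulrC => /le_trans; apply; exact: ler_norm.
have n0' : 0 < n.+1%:R :> R by rewrite ltr0n.
apply: le_trans (ltW nd); rewrite ler_pdivlMr//.
have := b n.+1%:R; have := b (- n.+1%:R); rewrite normrN (ger0_norm (ltW n0')).
have := ler_normB (G n.+1%:R) (G (- n.+1%:R)); nra.
Qed.

End schwartz.

Section expand.
Variable R : realType.

Lemma sqr_sum_nat (a : nat -> R) n :
  (\sum_(1 <= k < n.+1) a k) ^+ 2 = \sum_(1 <= k < n.+1) a k ^+ 2 +
    2 * \sum_(1 <= j < n.+1) a j * \sum_(j.+1 <= k < n.+1) a k.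
Proof.
elim: n => [|n IH]; first by rewrite !big_geq// expr0n/= mulr0 addr0.
rewrite [in LHS]big_nat_recr//= sqrrD IH.
rewrite [X in _ = X + _]big_nat_recr//= [X in _ = _ + 2 * X]big_nat_recr//=.
rewrite [\sum_(n.+2 <= _ < _) _]big_geq// mulr0 addr0.
have -> : \sum_(1 <= j < n.+1) a j * \sum_(j.+1 <= k < n.+2) a k =
  \sum_(1 <= j < n.+1) a j * \sum_(j.+1 <= k < n.+1) a k + (\sum_(1 <= j < n.+1) a j) * a n.+1.
  rewrite mulr_suml -big_split/=; apply: eq_big_nat => j /andP[_ jn].
  by rewrite big_nat_recr// mulrDr.
by ring.
Qed.

(** Ordered pairs are indexed by their smaller member and their distance,
    which may range over all of [1, ..., l] because the terms past [l] vanish. *)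
Lemma sqr_sum_window (a : nat -> R) l : (forall k, (l < k)%N -> a k = 0) ->
  (\sum_(1 <= k < l.+1) a k) ^+ 2 = \sum_(1 <= k < l.+1) a k ^+ 2 +
    2 * \sum_(1 <= j < l.+1) \sum_(1 <= k < l.+1) a j * a (j + k)%N.
Proof.
move=> a0; rewrite sqr_sum_nat; congr (_ + 2 * _); apply: eq_big_nat => j /andP[j1 jl].
rewrite -mulr_sumr; congr (_ * _).
have -> : \sum_(1 <= k < l.+1) a (j + k)%N = \sum_(j.+1 <= k < j + l.+1) a k.
  rewrite -{1}[j.+1]add1n big_addn addKn.
  by apply: eq_bigr => k _; rewrite addnC.
have jl' : (j.+1 <= l.+1)%N by lia.
rewrite [RHS](@big_cat_nat _ _ _ l.+1 _ _ _ _ jl' (leq_addl _ _))/=.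
rewrite [X in _ = _ + X]big_nat_cond [X in _ = _ + X]big1 ?addr0//.
by move=> k /andP[/andP[lk _] _]; exact: a0.
Qed.

End expand.

Section profile.
Variables (R : realType) (dd : R -> R) (D L : R).
Hypothesis bd : lipschitz_bump dd D L.
Variables (eps : R) (N l : nat).
Hypotheses (eps0 : 0 < eps) (N0 : (0 < N)%N).
Local Notation del := (N%:R * eps).
Hypotheses (l2 : 2 <= del * l%:R) (l3 : del * l%:R <= 3).
Implicit Types (x y : int) (u : R) (n k : nat).
Local Notation mu := (@lebesgue_measure R).

Definition phi x u : R := dilate dd N (u - eps * x%:~R).

Let Npos : 0 < N%:R :> R. Proof. by rewrite ltr0n. Qed.
Let del0 : 0 < del. Proof. exact: mulr_gt0. Qed.
Let D0 : 0 <= D. Proof. by have [_ p b _] := bd; exact: le_trans (p 0) (b 0). Qed.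

Lemma phiE x u : phi x u = N%:R * dd (N%:R * u - del * x%:~R).
Proof. by rewrite /phi /dilate mulrBr mulrA. Qed.

Lemma phi_ge0 x u : 0 <= phi x u.
Proof. by have [_ p _ _] := bd; rewrite phiE mulr_ge0. Qed.

Lemma phi_le x u : phi x u <= N%:R * D.
Proof. by have [_ _ b _] := bd; rewrite phiE ler_pM2l. Qed.

Lemma phi_continuous x : continuous (phi x).
Proof.
have [_ _ _ lip] := bd.
apply: (@lipschitz_continuous _ _ (N%:R * (L * N%:R))) => u v.
rewrite !phiE -mulrBr normrM gtr0_norm// -[leRHS]mulrA ler_pM2l//.
apply: (le_trans (lip _ _)); rewrite opprB addrA subrK -mulrBr normrM gtr0_norm//.
by rewrite mulrA.
Qed.

(** The sites whose mollifier does not vanish at [u] are among [x0 u + 1],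
    ..., [x0 u + l]. *)
Definition x0 u : int := Num.floor ((N%:R * u - 1) / del).

Lemma x0_le u : 1 <= N%:R * u - del * (x0 u)%:~R.
Proof.
have := floor_le_tmp ((N%:R * u - 1) / del); rewrite -/(x0 u) ler_pdivlMr//; lra.
Qed.

Lemma x0_gt u : N%:R * u - del * (x0 u)%:~R < 1 + del.
Proof.
have := floorD1_gt ((N%:R * u - 1) / del); rewrite -/(x0 u) ltr_pdivrMr// intrD mulrDl mul1r; lra.
Qed.

Definition window u : seq int := [seq x0 u + k%:Z | k <- index_iota 1 l.+1].

Lemma window_uniq u : uniq (window u).
Proof. by rewrite map_inj_uniq ?iota_uniq// => i j; lia. Qed.

Lemma phi_out x u : x \notin window u -> phi x u = 0.
Proof.
move=> xw; have [supp _ _ _] := bd; rewrite phiE supp ?mulr0// leNgt; apply/negP.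
rewrite ltr_norml => /andP[y1 y2]; move/negP: xw; apply; apply/mapP.
have h1 : x0 u < x.
  rewrite -(ltr_int R) -(ltr_pM2l del0); move: y2 (x0_le u).
  by set X := del * x%:~R; set X0 := del * _; lra.
have h2 : x < x0 u + l%:Z + 1.
  rewrite -(ltr_int R) -(ltr_pM2l del0) !intrD !mulrDr mulr1 -pmulrn.
  move: y1 (x0_gt u) l2; set X := del * x%:~R; set X0 := del * (x0 u)%:~R.
  by set Y := del * l%:R; lra.
exists `|x - x0 u|%N; last by lia.
by rewrite mem_index_iota; lia.
Qed.

Lemma window_sum (F : int -> R) u : (forall x, x \notin window u -> F x = 0) ->
  exists n0, forall n, (n0 <= n)%N ->
    \sum_(x <- zbox n) F x = \sum_(1 <= k < l.+1) F (x0 u + k%:Z).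
Proof.
move=> F0; exists (`|x0 u| + l)%N => n hn.
rewrite -(big_map (fun k : nat => x0 u + k%:Z) predT F) -/(window u).
apply: eq_sum_support; [exact: zbox_uniq|exact: window_uniq| |].
  by move=> x _; exact: F0.
move=> x /mapP[k]; rewrite mem_index_iota => kl ->; rewrite mem_zbox => /negP[]; lia.
Qed.

Lemma window_le (F : int -> R) u (B : R) n : (forall x, x \notin window u -> F x = 0) ->
  (forall x, 0 <= F x) -> (forall x, F x <= B) -> \sum_(x <- zbox n) F x <= l%:R * B.
Proof.
move=> F0 Fp FB; have [n0 Hn] := window_sum F0.
apply: (@le_trans _ _ (\sum_(x <- zbox (maxn n n0)) F x)).
  have -> : \sum_(x <- zbox n) F x =
      \sum_(x <- zbox (maxn n n0)) (if (`|x| <= n)%N then F x else 0).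
    rewrite [RHS](@sum_zbox_widen _ n) ?leq_maxl// => [|x nx]; last by rewrite leqNgt nx.
    by apply: eq_big_seq => x; rewrite mem_zbox => ->.
  by apply: ler_sum => x _; case: ifP.
rewrite Hn ?leq_maxr//; apply: (@le_trans _ _ (\sum_(1 <= k < l.+1) B)).
  by apply: ler_sum => k _.
by rewrite sumr_const_nat subn1/= mulr_natl.
Qed.

Section expansion.
(** The diagonal of the expanded square: squared spins being 1, it is not
    random. *)
Definition diagonal u : R := eps * \sum_(1 <= k < l.+1) phi (x0 u + k%:Z) u ^+ 2.

Let mphi x : measurable_fun setT (phi x).
Proof. by apply: continuous_measurable_fun; exact: phi_continuous. Qed.

Let pair z n u := \sum_(x <- zbox n) \sum_(1 <= k < l.+1)
   2 * eps * (z x * phi x u) * (z (x + k%:Z) * phi (x + k%:Z) u) : R.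

Let pdiag n u := \sum_(x <- zbox n) eps * phi x u ^+ 2.

(** The finite window at [u] captures the field, so that both limits are
    reached after finitely many terms. *)
Lemma field_sqr (z : int -> R) u : (forall x, z x * z x = 1) ->
  exists n0, forall n, (n0 <= n)%N ->
   pdiag n u = diagonal u /\
   diagonal u + pair z n u = (Num.sqrt eps * sumZ (fun x => z x * phi x u)) ^+ 2.
Proof.
move=> z1.
have F0 x : x \notin window u -> z x * phi x u = 0 by move=> /phi_out->; rewrite mulr0.
have [n1 H1] := window_sum F0.
have F2 x : x \notin window u -> eps * phi x u ^+ 2 = 0.
  by move=> /phi_out->; rewrite expr0n mulr0.
have F3 x : x \notin window u -> \sum_(1 <= k < l.+1)
    2 * eps * (z x * phi x u) * (z (x + k%:Z) * phi (x + k%:Z) u) = 0.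
  by move=> xw; rewrite big1// => k _; rewrite F0// mulr0 mul0r.
have [n2 H2] := window_sum F2; have [n3 H3] := window_sum F3.
exists (maxn n1 (maxn n2 n3)) => n; rewrite !geq_max => /and3P[/H1 h1 /H2 h2 /H3 h3].
split; first by rewrite /pdiag h2 /diagonal mulr_sumr.
rewrite /pair h3 (@sumZ_eventually _ _ n1 (\sum_(1 <= k < l.+1) z (x0 u + k%:Z) * phi (x0 u + k%:Z) u)) //.
rewrite exprMn sqr_sqrtr ?ltW//.
rewrite (@sqr_sum_window _ (fun k => z (x0 u + k%:Z) * phi (x0 u + k%:Z) u)) => [|k lk].
  rewrite mulrDr; congr (_ + _).
    by rewrite /diagonal; congr (_ * _); apply: eq_bigr => k _; rewrite [RHS]exprMn [z _ ^+ 2]expr2 z1 mul1r.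
  rewrite !mulr_sumr; apply: eq_bigr => j _; rewrite !mulr_sumr; apply: eq_bigr => k _.
  rewrite (_ : x0 u + j%:Z + k%:Z = x0 u + (j + k)%N%:Z); last by lia.
  by ring.
apply: F0; apply/mapP => -[j]; rewrite mem_index_iota; lia.
Qed.

Let mpair z n : measurable_fun setT (pair z n).
Proof.
apply: measurable_sum => x; apply: measurable_sum => k.
by apply: measurable_funM; apply: measurable_funM => //; apply: measurable_funM.
Qed.

Let mpdiag n : measurable_fun setT (pdiag n).
Proof.
by apply: measurable_sum => x; apply: measurable_funM => //; exact: measurable_funX.
Qed.

Let pdiag_le n u : `|pdiag n u| <= l%:R * (eps * (N%:R * D) ^+ 2).
Proof.
have p0 x : 0 <= eps * phi x u ^+ 2 by rewrite mulr_ge0 ?sqr_ge0// ltW.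
rewrite ger0_norm; last by apply: sumr_ge0.
apply: (@window_le _ u) => // x; first by move=> /phi_out->; rewrite expr0n mulr0.
by rewrite ler_pM2l//; apply: sqr_le_norm; rewrite ger0_norm ?phi_ge0 ?phi_le.
Qed.

Let pair_le z n u : (forall x, `|z x| = 1) ->
  `|pair z n u| <= l%:R * (l%:R * (2 * eps * (N%:R * D) * (N%:R * D))).
Proof.
move=> z1.
pose F x := \sum_(1 <= k < l.+1) 2 * eps * phi x u * phi (x + k%:Z) u.
apply: (@le_trans _ _ (\sum_(x <- zbox n) F x)).
  apply: (le_trans (ler_norm_sum _ _ _)); apply: ler_sum => x _.
  apply: (le_trans (ler_norm_sum _ _ _)); apply: ler_sum => k _.
  move: (phi_ge0 x u) (phi_ge0 (x + k%:Z) u).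
  move: (phi x u) (phi (x + k%:Z) u) => a b a0 b0.
  by rewrite !normrM !z1 !mul1r !ger0_norm// ltW.
have e2 : 0 <= 2 * eps by rewrite mulr_ge0// ltW.
apply: (@window_le _ u).
- by move=> x /phi_out px; rewrite /F big1// => k _; rewrite px mulr0 mul0r.
- move=> x; apply: sumr_ge0 => k _.
  exact: mulr_ge0 (mulr_ge0 e2 (phi_ge0 _ _)) (phi_ge0 _ _).
- move=> x; apply: (@le_trans _ _ (\sum_(1 <= k < l.+1) 2 * eps * (N%:R * D) * (N%:R * D))).
    apply: ler_sum => k _; apply: ler_pM (phi_le _ _).
    - exact: mulr_ge0 e2 (phi_ge0 _ _).
    - exact: phi_ge0.
    - exact: ler_wpM2l e2 _ _ (phi_le _ _).
  by rewrite sumr_const_nat subn1/= -[leLHS]mulr_natl.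
Qed.

Lemma diag_limit u : pdiag n u @[n --> \oo] --> diagonal u.
Proof.
have [n0 Hn] := @field_sqr (fun=> 1) u (fun=> mulr1 1).
by apply: cvg_near_cst; exists n0 => // n /= /Hn[].
Qed.

Lemma measurable_diag : measurable_fun setT diagonal.
Proof. by apply: (measurable_fun_cvg mpdiag) => u _; exact: diag_limit. Qed.

Lemma diag_bound u : `|diagonal u| <= l%:R * (eps * (N%:R * D) ^+ 2).
Proof. by apply: (cvg_norm_le (diag_limit (u := u))) => n; exact: pdiag_le. Qed.

Variable g : R -> R.
Hypotheses (cg : continuous g) (ig : mu.-integrable setT (EFin \o g)).

(** The weight of the pair [x], [x + k] in the integrated square. *)
Definition coef x k : R := \int[mu]_u (2 * eps * (g u * phi x u * phi (x + k%:Z) u)).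

Let mg : measurable_fun setT g.
Proof. exact: continuous_measurable_fun. Qed.

Lemma integrable_mul_bounded (F : R -> R) (B : R) : measurable_fun setT F ->
  (forall u, `|F u| <= B) -> mu.-integrable setT (EFin \o (fun u => g u * F u)).
Proof.
move=> mF FB; have B0 : 0 <= B by exact: le_trans (FB 0).
apply: (le_integrable measurableT _ _ (integrableZl measurableT B ig)).
- by apply/measurable_EFinP; exact: measurable_funM.
- by move=> x _ /=; rewrite lee_fin !normrM (ger0_norm B0) mulrC ler_wpM2r.
Qed.

Lemma integral_pair z n : (\int[mu]_u (g u * pair z n u)) =
  \sum_(x <- zbox n) \sum_(1 <= k < l.+1) coef x k * z x * z (x + k%:Z).
Proof.
have ic x k : mu.-integrable setT
    (EFin \o (fun u => z x * z (x + k%:Z) * (2 * eps * (g u * phi x u * phi (x + k%:Z) u)))).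
  have h : mu.-integrable setT (EFin \o (fun u => g u * (phi x u * phi (x + k%:Z) u))).
    apply: (@integrable_mul_bounded _ (N%:R * D * (N%:R * D))).
      exact: measurable_funM.
    by move=> u; rewrite normrM !ger0_norm ?phi_ge0// ler_pM ?phi_ge0 ?phi_le.
  have := integrableZl measurableT (z x * z (x + k%:Z) * (2 * eps)) h.
  by congr (_.-integrable _ _); apply/funext => u /=; rewrite -EFinM; congr EFin; ring.
have is1 x : mu.-integrable setT (EFin \o (fun u => \sum_(1 <= k < l.+1)
    z x * z (x + k%:Z) * (2 * eps * (g u * phi x u * phi (x + k%:Z) u)))) /\
   \int[mu]_u (\sum_(1 <= k < l.+1) z x * z (x + k%:Z) *
      (2 * eps * (g u * phi x u * phi (x + k%:Z) u))) =
   \sum_(1 <= k < l.+1) coef x k * z x * z (x + k%:Z).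
  have [h1 h2] := @Rintegral_sum _ _ _ mu setT _ (index_iota 1 l.+1) _ measurableT (ic x).
  split => //; rewrite h2; apply: eq_bigr => k _; rewrite /coef.
  have e2 : z x * z (x + k%:Z) != 0 \/ z x * z (x + k%:Z) = 0 by case: eqP; [right|left].
  case: e2 => [nz|zz]; last first.
    under eq_Rintegral do rewrite zz mul0r.
    by rewrite Rintegral_cst// mul0r -mulrA zz mulr0.
  rewrite RintegralZl//; first by rewrite mulrC mulrA.
  have := integrableZl measurableT (z x * z (x + k%:Z))^-1 (ic x k).
  by congr (_.-integrable _ _); apply/funext => u /=; rewrite -EFinM mulKf.
have [_ h] := @Rintegral_sum _ _ _ mu setT _ (zbox n) _ measurableT (fun x => (is1 x).1).
rewrite -(eq_bigr _ (fun x _ => (is1 x).2)) -h; apply: eq_Rintegral => u _.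
rewrite /pair mulr_sumr; apply: eq_bigr => x _; rewrite mulr_sumr.
by apply: eq_bigr => k _; ring.
Qed.

(** Expanding the square of the mollified field separates a deterministic
    diagonal from the interactions of distinct sites. *)
Lemma quadratic_expansion (z : int -> R) : (forall x, `|z x| = 1) ->
  \sum_(x <- zbox n) \sum_(1 <= k < l.+1) coef x k * z x * z (x + k%:Z) @[n --> \oo] -->
  (\int[mu]_u (g u * (Num.sqrt eps * sumZ (fun x => z x * phi x u)) ^+ 2)) -
  (\int[mu]_u (g u * diagonal u)).
Proof.
move=> z1; have zz x : z x * z x = 1.
  by rewrite -expr2 -(real_normK (num_real (z x))) z1 expr1n.
set S2 := fun u => (Num.sqrt eps * sumZ (fun x => z x * phi x u)) ^+ 2.
pose B := l%:R * (eps * (N%:R * D) ^+ 2) + l%:R * (l%:R * (2 * eps * (N%:R * D) * (N%:R * D))).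
have mdp n : measurable_fun setT (fun u => diagonal u + pair z n u).
  by apply: measurable_funD => //; exact: measurable_diag.
have bdp n u : `|diagonal u + pair z n u| <= B.
  by apply: (le_trans (ler_normD _ _)); apply: lerD; [exact: diag_bound|exact: pair_le].
have lim u : [set: R] u -> g u * (diagonal u + pair z n u) @[n --> \oo] --> g u * S2 u.
  move=> _; apply: cvg_near_cst; have [n0 Hn] := field_sqr u zz.
  by exists n0 => // n /= /Hn[_ ->].
have igB : mu.-integrable setT (EFin \o (fun u => `|g u| * B)).
  have := integrableZl measurableT B (integrable_norm ig).
  by congr (_.-integrable _ _); apply/funext => u /=; rewrite -EFinM mulrC.
have dom n u : [set: R] u -> `|g u * (diagonal u + pair z n u)| <= `|g u| * B.
  by move=> _; rewrite normrM ler_wpM2l.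
have mgdp n : measurable_fun setT (fun u => g u * (diagonal u + pair z n u)).
  exact: measurable_funM.
have [] := @dominated_Rintegral R _ _ mu setT measurableT
    (fun n u => g u * (diagonal u + pair z n u)) (fun u => g u * S2 u)
    (fun u => `|g u| * B) _ _ _ _.
- exact: mgdp.
- exact: lim.
- exact: igB.
- exact: dom.
move=> _ cv.
have ge n : \int[mu]_u (g u * (diagonal u + pair z n u)) =
   \int[mu]_u (g u * diagonal u) + \int[mu]_u (g u * pair z n u).
  under eq_Rintegral do rewrite mulrDr.
  rewrite RintegralD//.
  - exact: integrable_mul_bounded measurable_diag diag_bound.
  - exact: integrable_mul_bounded (mpair z n) (fun u => pair_le n u z1).
rewrite (_ : (fun n => _) = (fun n => \int[mu]_u (g u * (diagonal u + pair z n u)) -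
    \int[mu]_u (g u * diagonal u))); first exact: (cvgB cv (cvg_cst _)).
by apply/funext => n; rewrite ge addrAC subrr add0r integral_pair.
Qed.

End expansion.
End profile.

(** * Bounds on the coefficients of the expansion *)

Section coefficients.
Variables (R : realType) (dd : R -> R) (D L : R).
Hypothesis bd : lipschitz_bump dd D L.
Local Notation mu := (@lebesgue_measure R).
Hypothesis dd1 : \int[mu]_u dd u = 1.
Variables (eps : R) (N l : nat).
Hypotheses (eps0 : 0 < eps) (N0 : (0 < N)%N) (epsN : 2 * (eps * N%:R ^+ 3) <= 1).
Local Notation del := (N%:R * eps).
Hypotheses (l2 : 2 + del <= del * l%:R) (l3 : del * l%:R <= 3).
Variables (g : R -> R) (C : R).
Hypotheses (dg : forall x, derivable g x 1) (C0 : 0 <= C).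
Hypotheses (gC : forall x, `|g x| <= C * rho x).
Hypotheses (g'C : forall x, `|derive1 g x| <= C * rho x).
Hypothesis ig : mu.-integrable setT (EFin \o g).
Hypothesis g0 : \int[mu]_u g u = 0.
Implicit Types (x y : int) (u v : R) (n k : nat).
Local Notation phi := (phi dd eps N).
Local Notation coef := (coef dd eps N g).
Local Notation diag := (diagonal dd eps N l).

Let Npos : 0 < N%:R :> R. Proof. by rewrite ltr0n. Qed.
Let N1 : 1 <= N%:R :> R. Proof. by rewrite ler1n. Qed.
Let del0 : 0 < del. Proof. exact: mulr_gt0. Qed.
Let D0 : 0 <= D. Proof. by have [_ p b _] := bd; exact: le_trans (p 0) (b 0). Qed.
Let L0 : 0 <= L.
Proof. by have [_ _ _ lip] := bd; have := lip 0 1; rewrite subr0 normr1 mulr1; exact: le_trans. Qed.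
Let l2' : 2 <= del * l%:R. Proof. by apply: le_trans l2; rewrite lerDl ltW. Qed.
Let cg : continuous g. Proof. exact: derivable_continuous. Qed.
Let mg : measurable_fun setT g. Proof. exact: continuous_measurable_fun. Qed.
Let mphi x : measurable_fun setT (phi x).
Proof. by apply: continuous_measurable_fun; exact: (phi_continuous bd). Qed.

Let delN2 : del * N%:R <= N%:R^-1.
Proof.
rewrite -[leRHS]mul1r ler_pdivlMr//.
have : 0 < eps * N%:R ^+ 3 by rewrite mulr_gt0// exprn_gt0.
have := epsN; have -> : del * N%:R * N%:R = eps * N%:R ^+ 3 by ring.
lra.
Qed.

Let delN : del <= N%:R^-1.
Proof. by apply: le_trans delN2; rewrite ler_peMr// ltW. Qed.

Lemma supported_integral (F : R -> R) (a r M : R) : 0 < r ->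
  measurable_fun setT F -> (forall u, r < `|u - a| -> F u = 0) ->
  (forall u, `|u - a| <= r -> `|F u| <= M) ->
  mu.-integrable setT (EFin \o F) /\ `|\int[mu]_u F u| <= 2 * r * M.
Proof.
move=> r0 mF F0 FM.
set I : set R := `[a - r, a + r]%classic.
have inI u : (u \in I) = (`|u - a| <= r).
  by apply/idP/idP; rewrite inE /I /= in_itv/= ler_norml; lra.
have FI : F = F \_ I.
  apply/funext => u; rewrite /patch inI; case: ltP => // ru; exact: F0.
have mI : measurable I by exact: measurable_itv.
have iI : mu.-integrable I (EFin \o F).
  apply: (@bounded_integrable R _ _ mu _ _ _ _ M) => //.
  - exact: segment_measure_lty.
  - exact: measurable_funTS.
  - by move=> u uI; apply: FM; rewrite -inI inE.
have M0 : 0 <= M by apply: le_trans (FM a _); rewrite ?subrr ?normr0// ltW.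
split.
  have := (@integrable_mkcond _ _ _ mu _ (EFin \o F) mI).1 iI.
  congr (_.-integrable _ _); apply/funext => u; rewrite [in RHS]FI /= /patch.
  by case: ifP.
have -> : \int[mu]_u F u = \int[mu]_(u in I) F u by rewrite [RHS]Rintegral_mkcond -FI.
apply: (@le_trans _ _ (\int[mu]_(u in I) `|F u|)); first exact: le_normr_Rintegral.
have iM : mu.-integrable I (EFin \o (fun=> M)).
  apply: (@bounded_integrable R _ _ mu _ _ _ _ M) => //.
  - exact: segment_measure_lty.
  - by move=> u _; rewrite ger0_norm.
apply: (@le_trans _ _ (\int[mu]_(u in I) M)).
  apply: le_Rintegral => //; first exact: integrable_norm.
  by move=> u uI; apply: FM; rewrite -inI inE.
rewrite Rintegral_cst// mulrC ler_wpM2r//.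
have ar : a - r < a + r by lra.
have muI : mu `[a - r, a + r]%classic = (2 * r)%:E.
  by rewrite lebesgue_measure_itv /= lte_fin ar -EFinD; congr EFin; ring.
have <- : fine (mu `[a - r, a + r]%classic) = 2 * r by rewrite muI.
exact: lexx.
Qed.

Let phi0 x u : N%:R^-1 < `|u - eps * x%:~R| -> phi x u = 0.
Proof.
move=> h; have [supp _ _ _] := bd; rewrite phiE supp ?mulr0//.
rewrite -mulrA -mulrBr normrM gtr0_norm// -ler_pdivrMl// mulr1; exact: ltW.
Qed.

Let ND0 : 0 <= N%:R * D. Proof. by rewrite mulr_ge0// ltW. Qed.

Let phi_norm x u : `|phi x u| <= N%:R * D.
Proof. by rewrite ger0_norm ?(phi_ge0 bd)// (phi_le bd). Qed.

Let g_near x u : `|u - eps * x%:~R| <= N%:R^-1 -> `|g u| <= 3 * C * rho (eps * x%:~R).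
Proof.
move=> h; apply: (le_trans (gC u)).
rewrite (_ : 3 * C * _ = C * (3 * rho (eps * x%:~R))); last by ring.
rewrite ler_wpM2l//; apply: rho_near; apply: (le_trans h); by rewrite invf_le1.
Qed.

Let Npos' : 0 < N%:R^-1 :> R. Proof. by rewrite invr_gt0. Qed.

Let coef_int x k : mu.-integrable setT
   (EFin \o (fun u => 2 * eps * (g u * phi x u * phi (x + k%:Z) u))) /\
  `|coef x k| <= 2 * N%:R^-1 * (2 * eps * (3 * C * rho (eps * x%:~R) * (N%:R * D) * (N%:R * D))).
Proof.
apply: (@supported_integral _ (eps * x%:~R)) => //.
- by apply: measurable_funM => //; apply: measurable_funM => //; apply: measurable_funM.
- by move=> u /phi0 ->; rewrite mulr0 mul0r mulr0.
- move=> u hu; rewrite normrM ger0_norm; last by rewrite mulr_ge0// ltW.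
  apply: ler_wpM2l; first by rewrite mulr_ge0// ltW.
  rewrite normrM; apply: ler_pM => //; rewrite normrM; apply: ler_pM => //.
  exact: g_near.
Qed.

(** Summing over the partner site produces a Riemann sum of mesh [del] with at
    most [3 / del] terms, hence a bound free of [N] and [eps]. *)
Lemma coef_sum_bound x :
  \sum_(1 <= k < l.+1) `|coef x k| <= 36 * C * D ^+ 2 * rho (eps * x%:~R).
Proof.
apply: (le_trans (ler_sum _ (fun k _ => (coef_int x k).2))).
rewrite sumr_const_nat subn1/= -[leLHS]mulr_natl.
have -> : l%:R * (2 * N%:R^-1 * (2 * eps * (3 * C * rho (eps * x%:~R) * (N%:R * D) * (N%:R * D)))) =
   (12 * C * D ^+ 2 * rho (eps * x%:~R)) * (del * l%:R).
  by field; rewrite gt_eqF.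
have -> : 36 * C * D ^+ 2 * rho (eps * x%:~R) = (12 * C * D ^+ 2 * rho (eps * x%:~R)) * 3 by ring.
rewrite ler_wpM2l// mulr_ge0 ?(ltW (rho_gt0 _))// mulr_ge0 ?sqr_ge0// mulr_ge0//.
Qed.

(** The integrand is the derivative of [Psi (N * u - del * x) ^+ 2], which
    climbs from 0 to 1. *)
Lemma bump_square_mass (Psi : R -> R) x :
  (forall v, derivable Psi v 1 /\ derive1 Psi v = dd v) ->
  (forall v, v <= -1 -> Psi v = 0) -> (forall v, 1 <= v -> Psi v = 1) ->
  \int[mu]_u (phi x u * (2 * Psi (N%:R * u - del * x%:~R))) = 1.
Proof.
move=> dPsi Psi0 Psi1; set a := eps * x%:~R; pose r : R := N%:R^-1.
have cPsi : continuous Psi by apply: derivable_continuous => v; exact: (dPsi v).1.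
pose A u := N%:R * u - del * x%:~R.
have AE u : A u = N%:R * (u - a) by rewrite /A /a; ring.
have dA u : is_derive u 1 A N%:R.
  rewrite /A; apply: is_derive_eq.
  by rewrite subr0; exact: mulr1.
have dF u : is_derive u 1 (fun u => Psi (A u) ^+ 2) (phi x u * (2 * Psi (A u))).
  have dP : is_derive (A u) 1 Psi (dd (A u)).
    by have [d1 d2] := dPsi (A u); apply: DeriveDef => //; rewrite -derive1E.
  have h2 := is_deriveX 2 (@is_derive1_comp _ Psi A u _ _ dP (dA u)).
  have -> : phi x u * (2 * Psi (A u)) = (2%:R * (Psi \o A) u ^+ 2.-1) *: (dd (A u) * N%:R).
    by rewrite phiE -/(A u) expr1 /= /GRing.scale /=; ring.
  exact: h2.
have cA : continuous A.
  by apply: derivable_continuous => u; have [] := dA u.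
have cPA : continuous (fun u => Psi (A u)) by move=> u; apply: (continuous_comp (cA u)); exact: cPsi.
have cphi : continuous (phi x) by exact: (phi_continuous bd).
have ar : a - r < a + r by have r0 : 0 < r := Npos'; lra.
have cF : continuous (fun u => Psi (A u) ^+ 2).
  by apply: derivable_continuous => u; have [] := dF u.
have ftc := @continuous_FTC2 R (fun u => phi x u * (2 * Psi (A u))) (fun u => Psi (A u) ^+ 2)
  (a - r) (a + r) ar.
rewrite (_ : \int[mu]_u _ = \int[mu]_(u in `[a - r, a + r]) (phi x u * (2 * Psi (A u)))).
  rewrite /Rintegral ftc.
  - rewrite !AE addrAC subrr add0r addrAC subrr add0r mulrN divff ?gt_eqF//.
    by rewrite Psi1// Psi0// expr1n expr0n /= subr0.
  - apply: continuous_subspaceT => u; apply: cvgM; first exact: cphi.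
    by apply: cvgM; [exact: cvg_cst|exact: cPA].
  - split => [u _||]; first by have [] := dF u.
      exact/cvg_at_right_filter/cF.
    exact/cvg_at_left_filter/cF.
  - by move=> u _; rewrite derive1E; have [_ ->] := dF u.
rewrite [RHS]Rintegral_mkcond; apply: eq_Rintegral => u _.
rewrite /patch; case: ifPn => // /negP un; rewrite phi0 ?mul0r// ltNge; apply/negP => h.
by apply: un; rewrite inE /= in_itv/=; move: h; rewrite -/a -/r ler_norml; lra.
Qed.

Definition coef_defect x : R := \sum_(1 <= k < l.+1) coef x k - g (eps * x%:~R).

(** The sum over the partner site is a Riemann sum in which [g] is integrated
    against the density of [bump_square_mass]; since that density lives within
    distance [1 / N] of [eps * x], the function [g] is nearly constant there. *)
Lemma defect_bound x :
  `|coef_defect x| <= 12 * C * D * (3 * L + 2 * D) * N%:R^-1 * rho (eps * x%:~R).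
Proof.
have [Psi [dPsi Psi0 Psi1']] := bump_primitive bd.
have Psi1 v : 1 <= v -> Psi v = 1 by move=> /Psi1'->.
set a := eps * x%:~R; pose A u := N%:R * u - del * x%:~R.
have AE u : A u = N%:R * (u - a) by rewrite /A /a; ring.
pose S u := \sum_(1 <= k < l.+1) dd (A u - del * k%:R).
have [h1 h2] := @Rintegral_sum _ _ _ mu setT _ (index_iota 1 l.+1) _ measurableT
  (fun k => (coef_int x k).1).
have cPsi : continuous Psi by apply: derivable_continuous => v; exact: (dPsi v).1.
have cPA : continuous (fun u => Psi (A u)).
  move=> u; apply: continuous_comp; last exact: cPsi.
  by rewrite /A; apply: cvgB; [apply: cvgM; [exact: cvg_cst|exact: cvg_id]|exact: cvg_cst].
have mPA : measurable_fun setT (fun u => Psi (A u)) by exact: continuous_measurable_fun.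
have PsiD v : `|v| <= 1 -> `|Psi v| <= 2 * D.
  move=> v1; have := @mean_value_bound _ Psi D (-1) v (fun z => (dPsi z).1).
  rewrite (Psi0 (-1))// subr0 => /(_ _)/le_trans; apply.
    by move=> z _ _; rewrite (dPsi z).2 ger0_norm//; have [_ p b _] := bd.
  move: v1; rewrite ler_norml => v1; rewrite mulrC ler_wpM2r// ger0_norm; lra.
have [i2 _] : mu.-integrable setT (EFin \o (fun u => g a * (phi x u * (2 * Psi (A u))))) /\
   `|\int[mu]_u (g a * (phi x u * (2 * Psi (A u))))| <= 2 * N%:R^-1 * (`|g a| * (N%:R * D * (2 * (2 * D)))).
  apply: (@supported_integral _ a) => //.
  - by apply: measurable_funM => //; apply: measurable_funM => //; apply: measurable_funM.
  - by move=> u /phi0 ->; rewrite mul0r mulr0.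
  - move=> u hu; rewrite normrM ler_wpM2l// normrM ler_pM// normrM ger0_norm// ler_pM2l//.
    by apply: PsiD; rewrite AE normrM gtr0_norm// mulrC -ler_pdivlMr// mul1r.
have -> : coef_defect x = \int[mu]_u (\sum_(1 <= k < l.+1) (2 * eps * (g u * phi x u * phi (x + k%:Z) u))
    - g a * (phi x u * (2 * Psi (A u)))).
  rewrite RintegralB// h2 -/a RintegralZl//; last first.
    have [ga|ga] := eqVneq (g a) 0.
      have [//] : mu.-integrable setT (EFin \o (fun u => (phi x u * (2 * Psi (A u))))) /\
   `|\int[mu]_u (phi x u * (2 * Psi (A u)))| <= 2 * N%:R^-1 * (N%:R * D * (2 * (2 * D))).
      apply: (@supported_integral _ a) => //.
      - by apply: measurable_funM => //; apply: measurable_funM.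
      - by move=> u /phi0 ->; rewrite mul0r.
      - move=> u hu; rewrite normrM ler_pM// normrM ger0_norm// ler_pM2l//.
        by apply: PsiD; rewrite AE normrM gtr0_norm// mulrC -ler_pdivlMr// mul1r.
    have := integrableZl measurableT (g a)^-1 i2.
    by congr (_.-integrable _ _); apply/funext => u /=; rewrite -EFinM mulKf.
  by rewrite bump_square_mass// mulr1.
pose Q := 3 * C * rho a.
have Q0 : 0 <= Q by rewrite !mulr_ge0// ltW// rho_gt0.
pose M := N%:R * D * (2 * (Q * (3 * L * N%:R^-1) + Q * N%:R^-1 * (2 * D))).
have -> : 12 * C * D * (3 * L + 2 * D) * N%:R^-1 * rho a = 2 * N%:R^-1 * M.
  by rewrite /M /Q; field; rewrite gt_eqF.
have SE u : \sum_(1 <= k < l.+1) (2 * eps * (g u * phi x u * phi (x + k%:Z) u)) =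
   phi x u * (2 * (g u * (del * S u))).
  rewrite /S !mulr_sumr; apply: eq_bigr => k _.
  rewrite (phiE _ _ _ (x + _)) intrD mulrDr -pmulrn opprD addrA -/(A u); ring.
apply: (fun m z b => (@supported_integral _ a N%:R^-1 M Npos' m z b).2).
- apply: measurable_funB.
    by apply: measurable_sum => k; apply: measurable_funM => //; apply: measurable_funM => //; apply: measurable_funM.
  by apply: measurable_funM => //; apply: measurable_funM => //; apply: measurable_funM.
- move=> u hu; rewrite SE phi0// mul0r mul0r mulr0 subrr//.
- move=> u hu; rewrite SE (_ : _ - _ = phi x u * (2 * (g u * (del * S u - Psi (A u)) +
    (g u - g a) * Psi (A u)))); last by ring.
  rewrite normrM ler_pM// normrM ger0_norm// ler_pM2l//.
  have A1 : `|A u| <= 1 by rewrite AE normrM gtr0_norm// mulrC -ler_pdivlMr// mul1r.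
  apply: (le_trans (ler_normD _ _)); apply: lerD; rewrite normrM; apply: ler_pM => //.
  + exact: g_near.
  + apply: (le_trans (bump_riemann bd dPsi Psi0 del0 _)).
      by move: A1; rewrite ler_norml; have := l2'; lra.
    rewrite (_ : l%:R * (L * del ^+ 2) = L * (del * (del * l%:R))); last by ring.
    rewrite (_ : 3 * L * N%:R^-1 = L * (N%:R^-1 * 3)); last by ring.
    apply: ler_wpM2l => //; apply: ler_pM => //; first exact: ltW.
    exact: mulr_ge0 (ltW del0) (ler0n _ _).
  + apply: le_trans (_ : Q * `|u - a| <= _); last by rewrite ler_wpM2l.
    apply: mean_value_bound => // z z1 z2; apply: (le_trans (g'C z)).
    rewrite /Q (_ : 3 * C * _ = C * (3 * rho a)); last by ring.
    rewrite ler_wpM2l//; apply: rho_near.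
    apply: (@le_trans _ _ `|u - a|).
      by move: z1 z2; have [au|ua] := leP a u => z1 z2;
        [rewrite !ger0_norm|rewrite !ler0_norm]; lra.
    by apply: (le_trans hu); rewrite invf_le1.
  + exact: PsiD.
Qed.

(** The diagonal is close to a constant, against which [g] integrates to 0. *)
Lemma diag_integral_bound :
  `|\int[mu]_u (g u * diag u)| <= 6 * D * L * N%:R^-1 * \int[mu]_u `|g u|.
Proof.
have bd2 := bump_sqr bd.
have [The [dT T0 T1]] := bump_primitive bd2.
set qq := \int[mu]_u dd u ^+ 2 in T1.
have h u : `|diag u - N%:R * qq| <= 6 * D * L * N%:R^-1.
  pose w := N%:R * u - del * (x0 eps N u)%:~R.
  have w1 : 1 <= w by exact: x0_le.
  have w2 : w < 1 + del by exact: x0_gt.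
  have dE : diag u = N%:R * (del * \sum_(1 <= k < l.+1) dd (w - del * k%:R) ^+ 2).
    rewrite /diagonal !mulr_sumr; apply: eq_bigr => k _.
    by rewrite phiE intrD mulrDr -pmulrn opprD addrA -/w; ring.
  rewrite -(T1 w)// dE -mulrBr normrM gtr0_norm//.
  have := bump_riemann bd2 dT T0 del0 (_ : w - del * l%:R <= -1).
  move=> /(_ ltac:(by have := l2; lra)) /(ler_wpM2l (ltW Npos))/le_trans; apply.
  rewrite (_ : N%:R * (l%:R * _) = 2 * D * L * (del * N%:R * (del * l%:R))); last by ring.
  rewrite (_ : 6 * D * L * N%:R^-1 = 2 * D * L * (N%:R^-1 * 3)); last by ring.
  apply: ler_wpM2l; first by rewrite !mulr_ge0.
  apply: ler_pM => //; first exact: mulr_ge0 (ltW del0) (ltW Npos).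
  exact: mulr_ge0 (ltW del0) (ler0n _ _).
have md : measurable_fun setT diag by exact: (measurable_diag bd eps0 N0 l2' l3).
have bdiag := diag_bound bd eps0 N0 l2' l3.
have i1 := integrable_mul_bounded cg ig md bdiag.
have i2 : mu.-integrable setT (EFin \o (fun u => g u * (N%:R * qq))).
  by apply: (integrable_mul_bounded cg ig (B := `|N%:R * qq|)).
have -> : \int[mu]_u (g u * diag u) = \int[mu]_u (g u * (diag u - N%:R * qq)).
  under [RHS]eq_Rintegral do rewrite mulrBr.
  by rewrite RintegralB// RintegralZr// g0 mul0r subr0.
have i3 : mu.-integrable setT (EFin \o (fun u => g u * (diag u - N%:R * qq))).
  by apply: (integrable_mul_bounded cg ig _ h); exact: measurable_funB.
apply: (@le_trans _ _ (\int[mu]_u `|g u * (diag u - N%:R * qq)|)).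
  exact: le_normr_Rintegral.
rewrite -RintegralZl//; last exact: integrable_norm.
apply: le_Rintegral => //; first exact: integrable_norm.
- have := integrableZl measurableT (6 * D * L * N%:R^-1) (integrable_norm ig).
  by congr (_.-integrable _ _); apply/funext => u /=; rewrite -EFinM.
- by move=> u _; rewrite normrM mulrC ler_wpM2r.
Qed.

End coefficients.

(** * Decomposition into gradients and a block average *)

Section scales.
Variable R : realType.

(** Mollifiers overlap over about [2 / del] sites; the window has a margin of
    one mesh, so that Riemann sums over it cover the whole bump. *)
Lemma window_length (del : R) : 0 < del -> 2 * del <= 1 ->
  exists l : nat, 2 + del <= del * l%:R /\ del * l%:R <= 3.
Proof.
move=> d0 d1.
have /truncn_itv/andP[] : 0 <= 2 / del by rewrite divr_ge0// ltW.
rewrite ler_pdivlMr// ltr_pdivrMr//; move: (Num.truncn _) => t h1 h2.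
by exists t.+2; move: h2; rewrite -addn1 -addn2 !natrD; lra.
Qed.

(** Blocks of about [1 / eps] sites balance the cost of transport, [eps ^+ 2]
    times the length of the block, and the variance of the block average, the
    inverse of the length. *)
Lemma block_length (eps : R) : 0 < eps -> eps <= 1 ->
  exists M : nat, 1 <= eps * M%:R /\ eps * M%:R <= 2.
Proof.
move=> e0 e1.
have /truncn_itv/andP[] : 0 <= eps^-1 by rewrite invr_ge0 ltW.
rewrite -[_^-1]div1r ler_pdivlMr// ltr_pdivrMr//; move: (Num.truncn _) => t h1 h2.
by exists t.+1; move: h2; rewrite -addn1 natrD; lra.
Qed.

Lemma sum_zbox_mono (F : int -> R) m n : (forall x, 0 <= F x) -> (m <= n)%N ->
  \sum_(x <- zbox m) F x <= \sum_(x <- zbox n) F x.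
Proof.
move=> F0 mn; have -> : \sum_(x <- zbox m) F x =
    \sum_(x <- zbox n) (if (`|x| <= m)%N then F x else 0).
  rewrite [RHS](@sum_zbox_widen _ m) => // [|x mx]; last by rewrite leqNgt mx.
  by apply: eq_big_seq => x; rewrite mem_zbox => ->.
by apply: ler_sum => x _; case: ifP.
Qed.

(** Both [`|a| + a] and [`|a|] have monotone bounded partial sums. *)
Lemma abs_summable (a : int -> R) (B : R) :
  (forall n, \sum_(x <- zbox n) `|a x| <= B) ->
  \sum_(x <- zbox n) a x @[n --> \oo] --> sumZ a.
Proof.
move=> aB.
have mono (F : int -> R) (B' : R) : (forall x, 0 <= F x) ->
    (forall n, \sum_(x <- zbox n) F x <= B') -> cvgn (fun n => \sum_(x <- zbox n) F x).
  move=> F0 FB; apply: nondecreasing_is_cvgn.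
    by move=> m n mn; exact: sum_zbox_mono.
  by exists B' => _ [n _ <-].
have c1 := mono (fun x => `|a x|) B (fun x => normr_ge0 _) aB.
have c2 : cvgn (fun n => \sum_(x <- zbox n) (`|a x| + a x)).
  apply: (mono _ (B + B)) => [x|n].
    by have := ler_norm (- a x); rewrite normrN; lra.
  rewrite big_split/= lerD//; apply: le_trans (aB n).
  by apply: ler_sum => x _; exact: ler_norm.
have aE : (fun n => \sum_(x <- zbox n) a x) =
    (fun n => \sum_(x <- zbox n) (`|a x| + a x) - \sum_(x <- zbox n) `|a x|).
  by apply/funext => n; rewrite big_split/= addrAC subrr add0r.
have ca := cvgB c2 c1.
have ca' : \sum_(x <- zbox n) a x @[n --> \oo] -->
    limn (fun n => \sum_(x <- zbox n) (`|a x| + a x)) - limn (fun n => \sum_(x <- zbox n) `|a x|).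
  by rewrite aE; exact: ca.
by rewrite (sumZE ca').
Qed.

Variables (eps : R).
Hypotheses (eps0 : 0 < eps) (eps1 : eps <= 1).

Lemma sum_norm_rho (a : int -> R) (A : R) n : 0 <= A ->
  (forall x, `|a x| <= A * rho (eps * x%:~R)) -> eps * (\sum_(x <- zbox n) `|a x|) <= A * 5.
Proof.
move=> A0 aA; apply: (@le_trans _ _ (A * (eps * \sum_(x <- zbox n) rho (eps * x%:~R)))).
  rewrite mulrCA; apply: ler_wpM2l; first exact: ltW.
  by rewrite mulr_sumr; exact: ler_sum.
by apply: ler_wpM2l => //; exact: rho_sum.
Qed.

Lemma sum_sqr_rho (a : int -> R) (A : R) n : 0 <= A ->
  (forall x, `|a x| <= A * rho (eps * x%:~R)) -> eps * (\sum_(x <- zbox n) a x ^+ 2) <= A ^+ 2 * 5.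
Proof.
move=> A0 aA; have := @sum_norm_rho (fun x => a x ^+ 2) (A ^+ 2) n (sqr_ge0 A).
under eq_bigr do rewrite ger0_norm ?sqr_ge0//.
apply=> x; rewrite ger0_norm ?sqr_ge0//.
apply: (@le_trans _ _ ((A * rho (eps * x%:~R)) ^+ 2)); first exact: sqr_le_norm.
rewrite exprMn ler_wpM2l ?sqr_ge0// expr2 ler_piMr ?rho_le1// ltW// rho_gt0//.
Qed.

End scales.

Section decomposition.
Variables (R : realType) (dd : R -> R) (eps : R) (N l M : nat) (g : R -> R) (c : R).
Local Notation xi := (xi R).
Local Notation coef := (coef dd eps N g).
Local Notation defect := (coef_defect dd eps N l g).

Definition square_part n (h : conf) : R :=
  c - \sum_(x <- zbox n) \sum_(1 <= k < l.+1) coef x k * xi h x * xi h (x + k%:Z).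

Definition neighbour_part n (h : conf) : R :=
  - \sum_(x <- zbox n) g (eps * x%:~R) * xi h x * xi h (x + 1).

Definition static_part n (h : conf) : R :=
  \sum_(x <- zbox n) - defect x * xi h x * (M%:R^-1 * \sum_(1 <= k < M.+1) xi h (x + k%:Z)).

Lemma loc_static_part n : loc (n + M) (static_part n).
Proof.
apply: loc_sum_in => x; rewrite mem_zbox => xn; apply: locM.
  by apply: locM; [exact: loc_cst|apply: loc_xi; lia].
apply: locZ; apply: loc_sum_in => k; rewrite mem_index_iota => kM; apply: loc_xi; lia.
Qed.

Lemma loc_square_part n : loc (n + l) (square_part n).
Proof.
apply: locB; first exact: loc_cst.
apply: loc_sum_in => x; rewrite mem_zbox => xn.
apply: loc_sum_in => k; rewrite mem_index_iota => kl.
apply: locM; last by apply: loc_xi; lia.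
by apply: locM; [exact: loc_cst|apply: loc_xi; lia].
Qed.

Lemma loc_neighbour_part n : loc n.+1 (neighbour_part n).
Proof.
apply: locN; apply: loc_sum_in => x; rewrite mem_zbox => xn.
apply: locM; last by apply: loc_xi; lia.
by apply: locM; [exact: loc_cst|apply: loc_xi; lia].
Qed.

(** Each product [xi x * xi (x + k)] is transported to [xi x * xi (x + 1)] at the
    cost of a gradient; the remaining nearest neighbour products, weighted by the
    small defect, are transported to an average over a block of length [M]. *)
Lemma square_neighbour_decomp n h : (0 < M)%N -> square_part n h - neighbour_part n h =
  c + gradsum (n + l) (bond_coef n l (fun x k => - coef x k)) h
    + gradsum (n + M) (bond_coef n M (fun x _ => defect x / M%:R)) h + static_part n h.
Proof.
move=> M0; rewrite -!transport_gradsum /square_part /neighbour_part /static_part opprK -!addrA.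
congr (c + _); rewrite -sumrN -!big_split/=; apply: eq_bigr => x _.
have -> : \sum_(1 <= k < l.+1) - coef x k * xi h x * (xi h (x + k%:Z) - xi h (x + 1)) =
   - (\sum_(1 <= k < l.+1) coef x k * xi h x * xi h (x + k%:Z)) +
   (\sum_(1 <= k < l.+1) coef x k) * (xi h x * xi h (x + 1)).
  rewrite mulr_suml -sumrN -big_split/=; apply: eq_bigr => k _; ring.
have -> : \sum_(1 <= k < M.+1) defect x / M%:R * xi h x * (xi h (x + k%:Z) - xi h (x + 1)) =
   defect x * xi h x * (M%:R^-1 * \sum_(1 <= k < M.+1) xi h (x + k%:Z)) -
   defect x * (xi h x * xi h (x + 1)).
  rewrite (eq_bigr (fun k => defect x * xi h x * M%:R^-1 * xi h (x + k%:Z) -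
     defect x * xi h x * M%:R^-1 * xi h (x + 1))); last by move=> k _; ring.
  rewrite big_split/= -mulr_sumr sumr_const_nat subn1/= -mulr_natr.
  by field; rewrite pnatr_eq0 -lt0n.
rewrite /coef_defect; ring.
Qed.

End decomposition.

(** * The second moment at a fixed scale *)

Section fluctuation.
Variables (R : realType) (dd G : R -> R) (D L C : R).
Local Notation mu := (@lebesgue_measure R).
Local Notation g := (derive1 G).
Hypothesis bd : lipschitz_bump dd D L.
Hypothesis dd1 : \int[mu]_u dd u = 1.
Hypothesis hG : schwartz G.
Hypotheses (C0 : 0 <= C) (gC : forall x, `|g x| <= C * rho x).
Hypothesis g'C : forall x, `|derive1 g x| <= C * rho x.
Variables (eps : R) (N : nat).
Hypotheses (eps0 : 0 < eps) (N0 : (0 < N)%N) (epsN : 2 * (eps * N%:R ^+ 3) <= 1).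
Variables (p q : R) (S : R -> (conf -> R) -> conf -> R).
Variables (d : measure_display) (Omega : measurableType d).
Variables (P : probability Omega R) (eta : R -> Omega -> conf).
Hypotheses (p0 : 0 <= p) (q0 : 0 <= q) (pq1 : p + q = 1).
Hypothesis fS : feller_semigroup S.
Hypothesis gS : forall f, local f -> generates S f (exclusion_gen p q f).
Hypothesis meas : forall (t : R) x, 0 <= t -> measurable [set w | eta t w x].
Hypothesis cad : cadlag eta.
Hypothesis markov : markov_process P S eta.
Hypothesis init : bernoulli_law P (1 / 2) (eta 0).
Variables (t T : R).
Hypotheses (t0 : 0 < t) (tT : t <= T).
Local Notation xi := (xi R).
Local Notation del := (N%:R * eps).

Definition coef_size : R := 36 * C * D ^+ 2.
Definition defect_size : R := 12 * C * D * (3 * L + 2 * D).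
Definition diag_size : R := 6 * D * L * \int[mu]_u `|g u|.

Definition moment_constant : R :=
  4 * (T ^+ 2 * diag_size ^+ 2
     + 10 * (T ^+ 2 + 2 * T + 2) * (15 * coef_size ^+ 2 + 10 * defect_size ^+ 2)
     + T ^+ 2 * (5 * defect_size ^+ 2)).

Let Npos : 0 < N%:R :> R. Proof. by rewrite ltr0n. Qed.
Let N1 : 1 <= N%:R :> R. Proof. by rewrite ler1n. Qed.
Let del0 : 0 < del. Proof. exact: mulr_gt0. Qed.
Let D0 : 0 <= D. Proof. by have [_ p' b _] := bd; exact: le_trans (p' 0) (b 0). Qed.
Let L0 : 0 <= L.
Proof. by have [_ _ _ lip] := bd; have := lip 0 1; rewrite subr0 normr1 mulr1; exact: le_trans. Qed.
Let dg : forall x, derivable g x 1. Proof. exact: schwartz_derivable hG. Qed.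
Let cg : continuous g. Proof. exact: schwartz_continuous. Qed.
Let ig : mu.-integrable setT (EFin \o g). Proof. exact: schwartz_integrable. Qed.

Let delh : 2 * del <= 1.
Proof.
apply: le_trans epsN; rewrite ler_pM2l// mulrC ler_pM2l//.
by rewrite -[leLHS]expr1 ler_weXn2l.
Qed.

Let eps1 : eps <= 1.
Proof. by have := delh; have := N1; have := eps0; nra. Qed.

Let norm_xi2 (a : R) h x y : `|a * xi h x * xi h y| = `|a|.
Proof. by rewrite (normrM (a * xi h x)) (normrM a) !xi_norm !mulr1. Qed.

(** Sums of squared coefficients over sites are of order [1 / eps]. Transport
    costs [eps ^+ 2] times the distance: at most [3 / (N * eps)] for the pairs
    of the square, and [1 / eps] for the nearest neighbour pairs, whose
    coefficients carry a factor [1 / N]. The static and the constant parts are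
    of order [1 / N] before being squared. *)
Lemma fluctuation_second_moment :
  ('E_P[fun w => ((\int[mu]_(s in `[0%R, t])
            FN dd N (fluctuation_field eps (xi (eta (s / eps ^+ 2) w))) G
         - \int[mu]_(s in `[0%R, t]) VG eps G (xi (eta (s / eps ^+ 2) w))) ^+ 2)%R]
   <= (moment_constant / N%:R)%:E)%E.
Proof.
have kap0 : 0 < eps ^+ 2 by rewrite exprn_gt0.
have [l [hl l3]] := window_length del0 delh.
have [M [M1 M2]] := block_length eps0 eps1.
have M0 : (0 < M)%N by rewrite lt0n; apply/eqP => M0; move: M1; rewrite M0 mulr0; lra.
have l2 : 2 <= del * l%:R by apply: le_trans hl; rewrite lerDl ltW.
pose c := - \int[mu]_u (g u * diagonal dd eps N l u).
pose F1 := square_part dd eps N l g c.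
pose F2 := neighbour_part eps g.
pose W1 h := FN dd N (fluctuation_field eps (xi h)) G.
pose W2 h := VG eps G (xi h).
have a0 : 0 <= coef_size by rewrite /coef_size !mulr_ge0// sqr_ge0.
have ha x : \sum_(1 <= k < l.+1) `|coef dd eps N g x k| <= coef_size * rho (eps * x%:~R).
  exact: (coef_sum_bound bd eps0 N0 l3 dg C0 gC).
pose ds := defect_size / N%:R.
have ds0 : 0 <= ds by rewrite /ds /defect_size !mulr_ge0 ?invr_ge0// addr_ge0// mulr_ge0.
have hd x : `|coef_defect dd eps N l g x| <= ds * rho (eps * x%:~R).
  exact: (defect_bound bd dd1 eps0 N0 epsN hl l3 dg C0 gC g'C).
have hc : `|c| <= diag_size / N%:R.
  rewrite normrN; apply: (le_trans (diag_integral_bound bd eps0 N0 epsN hl l3 dg ig (schwartz_mean0 hG))).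
  by rewrite /diag_size mulrAC.
have lF1 n : exists m, loc m (F1 n) by eexists; exact: loc_square_part.
have lF2 n : exists m, loc m (F2 n) by eexists; exact: loc_neighbour_part.
have b1 n h : `|F1 n h| <= `|c| + coef_size * 5 / eps.
  apply: (le_trans (ler_normB _ _)); rewrite lerD2l ler_pdivlMr// mulrC.
  pose A x := \sum_(1 <= k < l.+1) `|coef dd eps N g x k|.
  apply: le_trans (@sum_norm_rho _ eps eps0 eps1 A coef_size n a0 _); last first.
    by move=> x; rewrite ger0_norm ?ha// sumr_ge0.
  rewrite ler_pM2l//; apply: (le_trans (ler_norm_sum _ _ _)); apply: ler_sum => x _.
  apply: le_trans (ler_norm _); apply: (le_trans (ler_norm_sum _ _ _)).
  by apply: ler_sum => k _; rewrite norm_xi2.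
have b2 n h : `|F2 n h| <= C * 5 / eps.
  rewrite normrN ler_pdivlMr// mulrC.
  apply: le_trans (@sum_norm_rho _ eps eps0 eps1 (fun x => g (eps * x%:~R)) C n C0 _) => //.
  rewrite ler_pM2l//; apply: (le_trans (ler_norm_sum _ _ _)); apply: ler_sum => x _.
  by rewrite norm_xi2.
have w1 h : F1 n h @[n --> \oo] --> W1 h.
  have q1 := @quadratic_expansion R dd D L bd eps N l eps0 N0 l2 l3 g cg ig (xi h) (xi_norm R h).
  have -> : W1 h = c - (\int[mu]_u (g u * (Num.sqrt eps * sumZ (fun x => xi h x * phi dd eps N x u)) ^+ 2) -
      \int[mu]_u (g u * diagonal dd eps N l u)).
    by rewrite /W1 /FN /c opprB addrA addNr sub0r.
  exact: (cvgB (cvg_cst c) q1).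
have w2 h : F2 n h @[n --> \oo] --> W2 h.
  have s1 := @abs_summable R (fun x : int => g (eps * x%:~R) * xi h x * xi h (x + 1)) (C * 5 / eps) _.
  apply: cvgN; apply: s1 => n; rewrite ler_pdivlMr// mulrC.
  apply: le_trans (@sum_norm_rho _ eps eps0 eps1 (fun x => g (eps * x%:~R)) C n C0 _) => //.
  by rewrite ler_pM2l//; apply: ler_sum => x _; rewrite norm_xi2.
have i1 := limit_path_integrable gS cad kap0 t0 lF1 b1 w1.
have i2 := limit_path_integrable gS cad kap0 t0 lF2 b2 w2.
rewrite (_ : (fun w => _) = (fun w => (\int[mu]_(s in `[0, t])
   (W1 (eta (s / eps ^+ 2) w) - W2 (eta (s / eps ^+ 2) w))) ^+ 2)); last first.
  apply/funext => w; congr (_ ^+ 2); apply/esym.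
  by apply: RintegralB => //.
apply: (@path_second_moment R p q S d Omega P eta gS meas cad (eps ^+ 2) t kap0 t0
  (fun n h => F1 n h - F2 n h) (fun h => W1 h - W2 h)
  (`|c| + coef_size * 5 / eps + C * 5 / eps)).
- move=> n; have [m1 l1] := lF1 n; have [m2 l2'] := lF2 n; exists (maxn m1 m2).
  by apply: locB; [apply: locW l1; rewrite leq_maxl|apply: locW l2'; rewrite leq_maxr].
- by move=> n h; apply: (le_trans (ler_normB _ _)); rewrite lerD.
- by move=> h; apply: cvgB; [exact: w1|exact: w2].
move=> n zeta zeta0.
have e2 : eps * (5 * ds ^+ 2 / eps) = 5 * ds ^+ 2 by rewrite mulrC divfK ?gt_eqF.
have S1 : \sum_(x <- zbox n) (\sum_(1 <= k < l.+1) `|- coef dd eps N g x k|) ^+ 2 <= coef_size ^+ 2 * 5 / eps.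
  rewrite ler_pdivlMr// mulrC; apply: (@sum_sqr_rho _ eps eps0 eps1) => // x.
  under eq_bigr do rewrite normrN.
  by rewrite ger0_norm ?ha// sumr_ge0.
have S2 : \sum_(x <- zbox n) coef_defect dd eps N l g x ^+ 2 <= ds ^+ 2 * 5 / eps.
  by rewrite ler_pdivlMr// mulrC; apply: (@sum_sqr_rho _ eps eps0 eps1).
have S3 : \sum_(x <- zbox n) (\sum_(1 <= k < M.+1) `|coef_defect dd eps N l g x / M%:R|) ^+ 2 =
   \sum_(x <- zbox n) coef_defect dd eps N l g x ^+ 2.
  apply: eq_bigr => x _; rewrite sumr_const_nat subn1/= -[_ *+ M]mulr_natr normrM.
  by rewrite (@ger0_norm _ (M%:R^-1)) ?invr_ge0// divfK ?pnatr_eq0 -?lt0n// real_normK// num_real.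
have B1 := le_trans (bond_coef_bound n l (fun x k => - coef dd eps N g x k)) (ler_wpM2l (ler0n R l) S1).
have := bond_coef_bound n M (fun x (_ : nat) => coef_defect dd eps N l g x / M%:R).
rewrite S3 => /le_trans/(_ (ler_wpM2l (ler0n R M) S2)) B2.
have B3 : nu (n + M) (fun h => static_part dd eps N l M g n h ^+ 2) <= M%:R^-1 * (ds ^+ 2 * 5 / eps).
  apply: (le_trans (static_variance n (fun x => - coef_defect dd eps N l g x) M0)).
  rewrite ler_wpM2l ?invr_ge0//; under eq_bigr do rewrite sqrrN; exact: S2.
have [n0 Hn] := rsum_second_moment p0 q0 pq1 fS gS meas markov init kap0 t0 c zeta0
  (@loc_static_part R dd eps N l M g n) B1 B2 B3.
exists n0 => k /Hn.
under [X in path_sum _ _ _ _ X]eq_fun do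
  rewrite -(@square_neighbour_decomp R dd eps N l M g c n _ M0).
move=> /le_trans; apply; rewrite lerD2r.
have N2 (x y : R) : `|x| <= y / N%:R -> x ^+ 2 <= y ^+ 2 / N%:R.
  move=> xy; apply: (le_trans (sqr_le_norm xy)); rewrite exprMn.
  apply: ler_wpM2l; first exact: sqr_ge0.
  by rewrite -[leRHS]mulr1 expr2 ler_pM2l ?invr_gt0// invf_le1.
have k1 : t ^+ 2 * c ^+ 2 <= T ^+ 2 * (diag_size ^+ 2 / N%:R).
  apply: ler_pM (N2 _ _ hc); rewrite ?sqr_ge0//.
  by apply: sqr_le_norm; rewrite gtr0_norm.
have tt : t ^+ 2 <= T ^+ 2 by apply: sqr_le_norm; rewrite gtr0_norm.
have dsN : ds ^+ 2 <= defect_size ^+ 2 / N%:R.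
  by apply: N2; rewrite ger0_norm.
have k3 : t ^+ 2 * (M%:R^-1 * (ds ^+ 2 * 5 / eps)) <= T ^+ 2 * (5 * (defect_size ^+ 2 / N%:R)).
  have eM : 0 < eps * M%:R by exact: lt_le_trans M1.
  have Mn0 : M%:R != 0 :> R by rewrite pnatr_eq0 -lt0n.
  apply: ler_pM; rewrite ?sqr_ge0//.
    by rewrite mulr_ge0 ?invr_ge0// divr_ge0 ?(ltW eps0)// mulr_ge0 ?sqr_ge0.
  rewrite (_ : _ * (_ * 5 / _) = 5 * ds ^+ 2 * (eps * M%:R)^-1); last first.
    by field; rewrite Mn0 gt_eqF.
  apply: (@le_trans _ _ (5 * ds ^+ 2)); last by rewrite ler_pM2l.
  rewrite -[leRHS]mulr1; apply: ler_wpM2l; first by rewrite mulr_ge0// sqr_ge0.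
  by rewrite invf_le1.
have k2 : 10 * (t ^+ 2 + 2 * t + 2) * eps ^+ 2 *
   (l%:R * (coef_size ^+ 2 * 5 / eps) + M%:R * (ds ^+ 2 * 5 / eps)) <=
   10 * (T ^+ 2 + 2 * T + 2) * (15 * coef_size ^+ 2 / N%:R + 10 * (defect_size ^+ 2 / N%:R)).
  rewrite -mulrA (_ : eps ^+ 2 * _ = 5 * coef_size ^+ 2 / N%:R * (del * l%:R) + 5 * ds ^+ 2 * (eps * M%:R));
    last by field; rewrite !gt_eqF.
  have a20 := sqr_ge0 coef_size; have d20 := sqr_ge0 ds.
  have e0 : 0 <= eps * M%:R by rewrite mulr_ge0// ltW.
  have e1 : 0 <= del * l%:R by rewrite mulr_ge0// ltW.
  have aN : 0 <= 5 * coef_size ^+ 2 / N%:R by rewrite !mulr_ge0 ?invr_ge0.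
  have d5 : 0 <= 5 * ds ^+ 2 by rewrite mulr_ge0.
  apply: ler_pM.
  - by rewrite mulr_ge0//; have := sqr_ge0 t; have := t0; lra.
  - by rewrite addr_ge0// mulr_ge0.
  - by have := t0; have := tT; move: tt; lra.
  - apply: lerD.
      rewrite (_ : 15 * _ / _ = 5 * coef_size ^+ 2 / N%:R * 3); last by ring.
      exact: ler_wpM2l.
    apply: (@le_trans _ _ (5 * ds ^+ 2 * 2)); first exact: ler_wpM2l.
    by rewrite -mulrA [_ * 2]mulrC mulrA; move: dsN; lra.
rewrite /moment_constant.
rewrite (_ : 4 * _ / N%:R = 4 * (T ^+ 2 * (diag_size ^+ 2 / N%:R) +
   10 * (T ^+ 2 + 2 * T + 2) * (15 * coef_size ^+ 2 / N%:R + 10 * (defect_size ^+ 2 / N%:R)) +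
   T ^+ 2 * (5 * (defect_size ^+ 2 / N%:R)))); last by ring.
by rewrite ler_pM2l// lerD// lerD.
Qed.

End fluctuation.

(** * The limit *)

Section limits.
Variable R : realType.

(** The integral of a nonnegative function is a supremum over the simple
    functions below it. *)
Lemma ge0_le_integral_nonmeasurable (d : measure_display) (T : measurableType d)
    (mu : {measure set T -> \bar R}) (A : set T) (f g : T -> \bar R) :
  (forall x, A x -> (0 <= f x)%E) -> (forall x, A x -> (f x <= g x)%E) ->
  (\int[mu]_(x in A) f x <= \int[mu]_(x in A) g x)%E.
Proof.
move=> f0 fg; rewrite !ge0_integralE//; last by move=> x Ax; exact: le_trans (f0 x Ax) (fg x Ax).
apply/ge_ereal_sup => _ [h /= hf <-]; apply: ereal_sup_ubound; exists h => //= x.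
apply: (le_trans (hf x)); rewrite /patch; case: ifPn => // /set_mem; exact: fg.
Qed.

Lemma limf_esup_le (T : choiceType) (X : filteredType T) (F : set_system X)
    (f : X -> \bar R) (B : \bar R) :
  (\forall x \near F, (f x <= B)%E) -> (limf_esup f F <= B)%E.
Proof.
move=> fB; rewrite limf_esupE; apply: (@le_trans _ _ (ereal_sup (f @` [set x | (f x <= B)%E]))).
  by apply: ereal_inf_lbound; exists [set x | (f x <= B)%E].
by apply/ge_ereal_sup => _ [x /= xB <-].
Qed.

Lemma squeeze_inverse (u : nat -> \bar R) (K : R) : 0 <= K ->
  (forall N, (0 <= u N)%E) -> (forall N, (0 < N)%N -> (u N <= (K / N%:R)%:E)%E) ->
  u N @[N --> \oo] --> 0%E.
Proof.
move=> K0 u0 uK.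
apply: (@squeeze_cvge _ _ _ _ (fun=> 0%E) _ (fun N => (K / N%:R)%:E)); last 2 first.
- exact: cvg_cst.
- apply: cvg_EFin; first exact: nearW.
  apply/cvgrPdist_lt => e e0; have [n0 Hn] := small_mesh K0 e0.
  exists n0 => // n /= /Hn[n0' h]; rewrite sub0r normrN ger0_norm// divr_ge0//.
- by exists 1%N => // n /= n1; rewrite u0 uK.
Qed.

End limits.

Theorem corollary3p4 (R : realType) (gamma : R) (p q : R -> R)
  (hpq : forall eps : R, 0 < eps -> `|gamma| * Num.sqrt eps <= 1 ->
    [/\ 0 <= p eps, 0 <= q eps, p eps + q eps = 1 &
        p eps - q eps = gamma * Num.sqrt eps])
  (disp : measure_display) (Omega : R -> measurableType disp)
  (P : forall eps : R, probability (Omega eps) R)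
  (eta : forall eps : R, R -> Omega eps -> conf)
  (heta : forall eps : R, 0 < eps -> `|gamma| * Num.sqrt eps <= 1 ->
    exclusion_process (P eps) (p eps) (q eps) (eta eps))
  (heta0 : forall eps : R, 0 < eps -> `|gamma| * Num.sqrt eps <= 1 ->
    bernoulli_law (P eps) (1 / 2) (eta eps 0))
  (d : R -> R) (hd : mollifier d) (T : R) (hT : 0 < T)
  (G : R -> R) (hG : schwartz G) :
  limf_esup (fun eps : R =>
    \int[lebesgue_measure]_(t in `[0%R, T])
      'E_(P eps)[fun w : Omega eps =>
        (\int[lebesgue_measure]_(s in `[0%R, t])
            FN d N (fluctuation_field eps (xi R (eta eps (s / eps ^+ 2) w))) G
         - \int[lebesgue_measure]_(s in `[0%R, t])
            VG eps G (xi R (eta eps (s / eps ^+ 2) w))) ^+ 2]%R)%E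
    0^'+
  @[N --> \oo] --> 0%E.
Proof.
have [D [L [D0 L0 bd]]] := mollifier_bump hd.
have [C C0 [gC g'C]] := schwartz_decay hG.
have dd1 : \int[lebesgue_measure]_u d u = 1.
  by rewrite /Rintegral; have [_ _ _ _ ->] := hd.
pose K := moment_constant G D L C T.
have K0 : 0 <= K.
  have T0 := ltW hT.
  by rewrite /K /moment_constant; do ?[exact: sqr_ge0|done|apply: addr_ge0|apply: mulr_ge0].
apply: (@squeeze_inverse _ _ (K * T)); first by rewrite mulr_ge0// ltW.
  move=> N; apply: limf_esup_ge0 => [F0|eps]; first exact: (filter_not_empty _ F0).
  apply: integral_ge0 => t _; apply: expectation_ge0 => w; exact: sqr_ge0.
move=> N N0; have Npos : 0 < N%:R :> R by rewrite ltr0n.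
apply: limf_esup_le; near=> eps.
have eps0 : 0 < eps by near: eps; exact: nbhs_right_gt.
(* then the mesh [N * eps] is at most [N ^- 2] and [N] times the mesh at most [1 / N] *)
have epsN : 2 * (eps * N%:R ^+ 3) <= 1.
  rewrite mulrCA -ler_pdivlMr ?mulr_gt0 ?exprn_gt0// div1r; apply: ltW.
  by near: eps; apply: nbhs_right_lt; rewrite invr_gt0 mulr_gt0 ?exprn_gt0.
have small : `|gamma| * Num.sqrt eps <= 1.
  rewrite -sqrtr_sqr -sqrtrM ?sqr_ge0// -[leRHS]sqrtr1 ler_wsqrtr//.
  apply: (@le_trans _ _ ((1 + gamma ^+ 2) * eps)); first by rewrite ler_wpM2r ?lerDr// ltW.
  have g1 : 0 < 1 + gamma ^+ 2 by rewrite ltr_wpDr// sqr_ge0.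
  rewrite mulrC -ler_pdivlMr// div1r; apply: ltW.
  by near: eps; apply: nbhs_right_lt; rewrite invr_gt0 ltr_wpDr// sqr_ge0.
have [p0 q0 pq1 _] := hpq eps eps0 small.
have [meas cad [S [fS gS markov]]] := heta eps eps0 small.
have init := heta0 eps eps0 small.
apply: (@le_trans _ _ (\int[lebesgue_measure]_(t in `[0%R, T]) (K / N%:R)%:E)%E).
  apply: ge0_le_integral_nonmeasurable => t.
    by move=> _; apply: expectation_ge0 => w; exact: sqr_ge0.
  rewrite /= in_itv/= => /andP[t0 tT].
  have [t0'|t0'] := ltP 0 t.
    exact: (fluctuation_second_moment bd dd1 hG C0 gC g'C eps0 N0 epsN p0 q0 pq1
       fS gS meas cad markov init t0' tT).
  have -> : t = 0 by apply/eqP; rewrite eq_le t0 t0'.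
  rewrite (_ : (fun w => _) = (cst 0%R)); last first.
    by apply/funext => w; rewrite set_itv1 !Rintegral_set1 subrr expr0n.
  by rewrite expectation_cst lee_fin divr_ge0.
rewrite integral_cst//= lebesgue_measure_itv /= lte_fin hT -EFinD -EFinM lee_fin.
by rewrite subr0 mulrAC.
Unshelve. all: by end_near. Qed.
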